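(* Let $A\in\mathbb{R}^{n\times n}$, $B\in\mathbb{R}^{n\times m}$, $\sigma\in\mathbb{R}$, $\tau>0$, $N\in\mathbb{N}_0$, and let $L,P\in\mathbb{R}^{n\times n}$ and $R\in\mathbb{R}^{m\times m}$ be positive definite. Let $f$ be the map defined in the context. Define recursively $W_N(N):=P$ and, for $k=N-1,\ldots,0$, $$Q_k(s;N):=R+\sigma^2B^\top e^{A^\top s}W_{k+1}(N)e^{As}B,\qquad W_k(N):=f(W_{k+1}(N)),$$ $$K_k(s;N):=-Q_k^{-1}(\tau-s;N)B^\top e^{-A^\top s}(W_k(N)-\tau L),\quad s\in[0,\tau).$$ Then, for any $x\in\mathbb{R}^n$, the optimal control problem of minimizing $$J(x,u;N):=\mathbb{E}\left[\tau\sum_{k=0}^{N-1}x_{k\tau}^\top Lx_{k\tau}+\int_0^{N\tau}u^\top(t)Ru(t)\,dt+x_{N\tau}^\top Px_{N\tau}\,\Big|\,x_0=x\right]$$ over $u\in\mathcal{U}_N$, subject to $dx_t=Ax_t\,dt+Bu(t)(dt+\sigma\,dw_t)$, has a unique minimizer $u_N^*\in\mathcal{U}_N$, given by $$u_N^*(t):=K_k(t-k\tau;N)x_{k\tau},\quad t\in[k\tau,(k+1)\tau),\ k=0,\ldots,N-1.$$ The minimized cost is $J^*(x;N):=J(x,u_N^*;N)=x^\top W_0(N)x$.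
   Context: Here $x_t\in\mathbb{R}^n$ is the state, $u(t)\in\mathbb{R}^m$ the control, $w_t$ a standard (scalar) Wiener process, and the equation is in the Itô sense. $\mathbb{N}_0$ is the set of nonnegative integers. $\mathrm{L}^2([0,\tau),\mathbb{R}^{m\times n})$ is the space of functions $K:[0,\tau)\to\mathbb{R}^{m\times n}$ with $\int_0^\tau\operatorname{tr}(K^\top(s)K(s))\,ds<\infty$. $\mathcal{U}$ is the set of admissible linear feedback control laws, i.e., those of the form $u(t)=K_k(t-k\tau)x_{k\tau}$ for $t\in[k\tau,(k+1)\tau)$, $k\in\mathbb{N}_0$, with $K_k\in\mathrm{L}^2([0,\tau),\mathbb{R}^{m\times n})$ for all $k$; and $\mathcal{U}_N:=\{u|_{[0,N\tau)}\mid u\in\mathcal{U}\}$. Uniqueness of a control law refers to the resulting control process: two controls are identified if, along the trajectory starting at $x_0=x$, they agree almost surely for almost every $t$. $\mathbb{S}_n^+$ denotes the cone of real symmetric positive semidefinite $n\times n$ matrices; ''positive definite'' means symmetric positive definite. The map $f:\mathbb{S}_n^+\to\mathbb{S}_n^+$ is defined as follows: for $W\in\mathbb{S}_n^+$, set $Q(s):=\sigma^2 B^\top e^{A^\top s}We^{As}B+R$, $M:=\int_0^\tau e^{As}BQ^{-1}(s)B^\top e^{A^\top s}\,ds$, and $$f(W):=e^{A^\top\tau}W^{1/2}\left(I+W^{1/2}MW^{1/2}\right)^{-1}W^{1/2}e^{A\tau}+\tau L,$$ where $W^{1/2}$ is the positive semidefinite square root of $W$. *)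

(* Defs.v *)
From HB Require Import structures.
From mathcomp Require Import all_boot all_order all_algebra.
From mathcomp Require Import all_classical all_reals all_analysis.
Set Implicit Arguments.
Unset Strict Implicit.
Unset Printing Implicit Defensive.
Import Order.TTheory GRing.Theory Num.Theory.
Import numFieldNormedType.Exports.
Local Open Scope classical_set_scope.
Local Open Scope ring_scope.

Section Matrices.
Context {R : realType}.

Definition quadmx n (W : 'M[R]_n) (v : 'cV[R]_n) : R := (v^T *m W *m v) 0 0.

Definition psdmx n (W : 'M[R]_n) : Prop :=
  W^T = W /\ forall v : 'cV[R]_n, 0 <= quadmx W v.

Definition posdefmx n (W : 'M[R]_n) : Prop :=
  W^T = W /\ forall v : 'cV[R]_n, v != 0 -> 0 < quadmx W v.

(* [xget] selects the unique positive semidefinite S with S *m S = W; the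
   default value 0 is only returned when W is not positive semidefinite. *)
Definition sqrtmx n (W : 'M[R]_n) : 'M[R]_n :=
  xget 0 [set S : 'M[R]_n | psdmx S /\ S *m S = W].

Definition expmx n (A : 'M[R]_n) : 'M[R]_n :=
  lim (series (fun k : nat => (k`!%:R)^-1 *: A ^+ k) @ \oo).

Definition intmx p q (a b : R) (G : R -> 'M[R]_(p, q)) : 'M[R]_(p, q) :=
  \matrix_(i, j) (\int[lebesgue_measure]_(s in `[a, b]) G s i j).

End Matrices.

Section Riccati.
Context {R : realType} {n m : nat}.
Variables (A : 'M[R]_n) (B : 'M[R]_(n, m)) (sigma tau : R).
Variables (L : 'M[R]_n) (Ru : 'M[R]_m).

Definition weightQ (W : 'M[R]_n) (s : R) : 'M[R]_m :=
  Ru + sigma ^+ 2 *: (B^T *m expmx (s *: A^T) *m W *m expmx (s *: A) *m B).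

Definition gramM (W : 'M[R]_n) : 'M[R]_n :=
  intmx 0 tau (fun s =>
    expmx (s *: A) *m B *m invmx (weightQ W s) *m B^T *m expmx (s *: A^T)).

Definition riccati_map (W : 'M[R]_n) : 'M[R]_n :=
  expmx (tau *: A^T) *m sqrtmx W
    *m invmx (1%:M + sqrtmx W *m gramM W *m sqrtmx W)
    *m sqrtmx W *m expmx (tau *: A)
  + tau *: L.

(* For k <= N this is the backward recursion W_N = P, W_k = f(W_{k+1}). *)
Definition riccati (P : 'M[R]_n) (N k : nat) : 'M[R]_n :=
  iter (N - k) riccati_map P.

Definition optimal_gain (P : 'M[R]_n) (N k : nat) (s : R) : 'M[R]_(m, n) :=
  - (invmx (weightQ (riccati P N k.+1) (tau - s)) *m B^T
       *m expmx (- s *: A^T) *m (riccati P N k - tau *: L)).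

End Riccati.

Section Ito.
Context {d : measure_display} {Omega : measurableType d} {R : realType}.
Variable Pr : probability Omega R.
Variable F : R -> set (set Omega).
Variable w : R -> Omega -> R.
Local Notation mu := (@lebesgue_measure R).

Definition measurable_wrt (G : set (set Omega)) (f : Omega -> R) : Prop :=
  forall U : set R, measurable U -> G (f @^-1` U).

Record filtration : Prop := Filtration {
  filtration_sigma : forall t, 0 <= t -> sigma_algebra setT (F t);
  filtration_sub : forall t, 0 <= t -> F t `<=` measurable;
  filtration_mono : forall s t, 0 <= s -> s <= t -> F s `<=` F t }.

Definition increment (s t : R) (o : Omega) : R := w t o - w s o.

(* [normal_prob m s] is parametrized by the standard deviation s. *)
Record wiener_process : Prop := WienerProcess {
  wiener_filtration : filtration;
  wiener_adapted : forall t, 0 <= t -> measurable_wrt (F t) (w t);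
  wiener0 : {ae Pr, forall o, w 0 o = 0};
  wiener_normal : forall s t, 0 <= s -> s < t ->
    forall U : set R, measurable U ->
      Pr (increment s t @^-1` U) = normal_prob 0 (Num.sqrt (t - s)) U;
  wiener_indep : forall s t, 0 <= s -> s < t ->
    forall (E : set Omega) (U : set R), F s E -> measurable U ->
      (Pr (E `&` increment s t @^-1` U)
       = Pr E * Pr (increment s t @^-1` U))%E;
  wiener_continuous :
    {ae Pr, forall o, {within `[0, +oo[, continuous (fun t => w t o)}} }.

(* The process  sum_(k < size) coef k * 1_[time k, time k.+1). *)
Record simple_process := SimpleProcess {
  simple_size : nat;
  simple_time : nat -> R;
  simple_coef : nat -> Omega -> R }.

Definition simple_adapted (T : R) (S : simple_process) : Prop :=
  forall k, (k < simple_size S)%N ->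
    [/\ 0 <= simple_time S k,
        simple_time S k <= simple_time S k.+1,
        simple_time S k.+1 <= T,
        measurable_wrt (F (simple_time S k)) (simple_coef S k)
      & (\int[Pr]_o ((simple_coef S k o) ^+ 2)%:E < +oo)%E].

Definition simple_val (S : simple_process) (s : R) (o : Omega) : R :=
  \sum_(k < simple_size S)
    simple_coef S k o * \1_(`[simple_time S k, simple_time S k.+1[) s.

Definition simple_int (S : simple_process) (o : Omega) : R :=
  \sum_(k < simple_size S)
    simple_coef S k o * increment (simple_time S k) (simple_time S k.+1) o.

(* [is_ito_integral T H I] : the random variable I is (a version of) the Ito
   integral of H against w over [0, T), i.e. the L^2 limit of the integrals of
   adapted simple processes converging to H in L^2([0, T) x Omega). *)
Definition is_ito_integral (T : R) (H : R -> Omega -> R) (I : Omega -> R)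
  : Prop :=
  [/\ measurable_fun ((`[0, T[ : set (measurableTypeR R)) `*` setT)
        (fun p : measurableTypeR R * Omega => H p.1 p.2),
      measurable_fun setT I
    & exists S : nat -> simple_process,
      [/\ forall j, simple_adapted T (S j),
          (fun j => \int[Pr]_o \int[mu]_(s in `[0%R, T[)
             ((H s o - simple_val (S j) s o) ^+ 2)%:E)%E @ \oo --> 0%E
        & (fun j => \int[Pr]_o ((I o - simple_int (S j) o) ^+ 2)%:E)%E
             @ \oo --> 0%E]].

Section StateEquation.
Context {n m : nat}.
Variables (A : 'M[R]_n) (B : 'M[R]_(n, m)) (sigma T : R) (x : 'cV[R]_n).

(* X solves  dX = A X dt + B u (dt + sigma dw)  on [0, T] with X_0 = x, in
   integrated form: the equation holds almost surely at every fixed time. *)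
Record state_solution (u : R -> Omega -> 'cV[R]_m) (X : R -> Omega -> 'cV[R]_n)
  : Prop := StateSolution {
  state_adapted : forall t, 0 <= t <= T ->
    forall i, measurable_wrt (F t) (fun o => X t o i 0);
  state_measurable : forall i,
    measurable_fun ((`[0, T] : set (measurableTypeR R)) `*` setT)
      (fun p : measurableTypeR R * Omega => X p.1 p.2 i 0);
  state_drift : {ae Pr, forall o, forall i,
    mu.-integrable `[0, T[ (fun s => ((A *m X s o + B *m u s o) i 0)%:E)};
  state_equation : forall t, 0 <= t <= T ->
    exists I : Omega -> 'cV[R]_n,
      (forall i, is_ito_integral t (fun s o => (B *m u s o) i 0)
                                   (fun o => I o i 0)) /\
      {ae Pr, forall o, forall i,
        X t o i 0 = x i 0
          + (\int[mu]_(s in `[0, t[) ((A *m X s o + B *m u s o) i 0))%R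
          + sigma * I o i 0} }.

End StateEquation.

Section Control.
Context {n m : nat}.
Variables (A : 'M[R]_n) (B : 'M[R]_(n, m)) (sigma tau : R) (N : nat).
Variables (L P : 'M[R]_n) (Ru : 'M[R]_m) (x : 'cV[R]_n).

(* A law in U_N is represented by its gains K_k, of which only those with
   k < N matter on [0, N tau). *)
Definition admissible_law (K : nat -> R -> 'M[R]_(m, n)) : Prop :=
  forall k, (k < N)%N ->
    (forall i j, measurable_fun (`[0, tau[ : set (measurableTypeR R))
                   (fun s => K k s i j)) /\
    (\int[mu]_(s in `[0%R, tau[) (\tr ((K k s)^T *m K k s))%:E < +oo)%E.

(* For t >= 0, [Num.truncn (t / tau)] is the k with
   k tau <= t < (k + 1) tau. *)
Definition feedback (K : nat -> R -> 'M[R]_(m, n)) (X : R -> Omega -> 'cV[R]_n)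
    (t : R) (o : Omega) : 'cV[R]_m :=
  let k := Num.truncn (t / tau) in
  K k (t - k%:R * tau) *m X (k%:R * tau) o.

Definition trajectory (K : nat -> R -> 'M[R]_(m, n))
    (X : R -> Omega -> 'cV[R]_n) : Prop :=
  state_solution A B sigma (N%:R * tau) x (feedback K X) X.

(* The initial state is the constant x, so conditioning on x_0 = x is built
   into the trajectory X. *)
Definition cost (K : nat -> R -> 'M[R]_(m, n)) (X : R -> Omega -> 'cV[R]_n)
  : \bar R :=
  (\int[Pr]_o
    ((tau * \sum_(k < N) quadmx L (X (k%:R * tau)%R o))%R%:E
     + \int[mu]_(t in `[0%R, (N%:R * tau)%R[) (quadmx Ru (feedback K X t o))%:E
     + (quadmx P (X (N%:R * tau)%R o))%:E))%E.

Definition same_control (u v : R -> Omega -> 'cV[R]_m) : Prop :=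
  {ae mu, forall t, t \in `[0, N%:R * tau[ -> {ae Pr, forall o, u t o = v t o}}.

End Control.
End Ito.

(* Main.v *)
Require Import Defs.
From HB Require Import structures.
From mathcomp Require Import all_boot all_order all_algebra.
From mathcomp Require Import all_classical all_reals all_analysis.
From mathcomp Require Import measurable_realfun ring lra spectral sesquilinear complex.
Set Implicit Arguments.
Unset Strict Implicit.
Unset Printing Implicit Defensive.
Import Order.TTheory GRing.Theory Num.Theory.
Import numFieldNormedType.Exports.
Local Open Scope classical_set_scope.
Local Open Scope ring_scope.

(** On each sampling period the control is a deterministic gain applied to the
    state at the start of the period. The state equation is therefore affine in
    that state: with Phi and Gamma deterministic, the variation of constants
    formula gives X_((k+1) tau) as Phi X_(k tau) plus sigma times the Ito
    integral of Gamma(s) X_(k tau). By the Ito isometry, and because such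
    integrals are uncorrelated with the past, the second moments of the sampled
    states evolve linearly; dually, the mean of the quadratic form of W at time
    (k+1) tau is the mean at time k tau of the form of second_moment_map W.

    The cost of a law is thus a finite sum of means of quadratic forms of
    sampled states. Working backwards from P, the cost of period k weighted by
    W_(k+1) is period_value, and completing the square in the gain
    (complete_square) writes it as W_k - tau L plus a positive semidefinite
    matrix excess_k, quadratic in the difference between the gain and the
    optimal one. Summing over the periods, the cost telescopes (cost_excess)
    into the form of W_0 at x plus the sum of the nonnegative means of the forms
    of excess_k. The optimal gains have excess zero, which gives the value and
    the optimality. If a law attains the minimum, every excess form vanishes
    almost surely along its trajectory; since the control weight is definite its
    gains then agree with the optimal ones on the visited states (excess0_gain),
    and uniqueness of solutions carries this from one period to the next
    (trajectory_compare).

    Most of the text builds the calculus on which this rests: the Ito integral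
    as the L2 closure of elementary integrals (ito, ito_isometry); for a
    deterministic integrand times a variable known at the start, a version that
    is adapted and jointly measurable in time and chance (wint); a stochastic
    Fubini theorem (stochastic_fubini), which turns the variation of constants
    formula into a solution (period_drift); the exponential of a matrix; a
    Gronwall lemma for integrable functions (gronwall0), which makes solutions
    unique; and the existence of positive semidefinite square roots
    (sqrtmx_exists), which makes sqrtmx the square root that the Riccati map
    calls for. *)

(** * Square roots of positive semidefinite matrices *)

Section SquareRoot.
Context {R : realType}.

Lemma interpolation (s : seq R) (f : R -> R) :
  exists p : {poly R}, {in s, forall x, p.[x] = f x}.
Proof.
elim: s => [|x s [p hp]]; first by exists 0.
have [xs|xs] := boolP (x \in s).
  by exists p => y; rewrite inE => /predU1P[->|]; exact: hp.
pose q := \prod_(y <- s) ('X - y%:P); have qx : q.[x] != 0.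
  by apply: contra xs; rewrite -[x \in s](root_prod_XsubC s).
exists (p + ((f x - p.[x]) / q.[x]) *: q) => y.
rewrite inE hornerD hornerZ => /predU1P[->|ys].
  by rewrite divfK// addrC subrK.
have : root q y by rewrite root_prod_XsubC.
by move=> /rootP ->; rewrite mulr0 addr0 hp.
Qed.

Let iota : {rmorphism R -> R[i]} := real_complex R.

(** Over R[i] a real symmetric matrix is Hermitian, so the complex spectral
    theorem applies; its eigenvalues being real, the diagonal can be taken over
    R. *)
Lemma symmetric_diagonalizable n (W : 'M[R]_n) : W^T = W ->
  exists (P : 'M[R[i]]_n) (lam : 'rV[R]_n), P \in unitmx /\
    map_mx iota W = invmx P *m diag_mx (map_mx iota lam) *m P.
Proof.
move=> sW; pose WC := map_mx iota W.
have herm : WC \is hermsymmx.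
  apply: realsym_hermsym.
    by apply/is_hermitianmxP; rewrite /= scale1r map_mx_id// /WC map_trmx sW.
  by apply/mxOverP => i j; rewrite mxE; apply/complex_realP; exists (W i j).
have eW := orthomx_spectralP (hermitian_normalmx herm).
have /mxOverP rl := hermitian_spectral_diag_real herm.
pose lam : 'rV[R]_n := \row_j complex.Re (spectral_diag WC 0 j).
have lamE : map_mx iota lam = spectral_diag WC.
  by apply/rowP => j; rewrite !mxE; exact: RRe_real.
by exists (spectralmx WC), lam; rewrite lamE; split; [exact: spectral_unit|exact: eW].
Qed.

(** A real eigenvalue of the complexified matrix is already an eigenvalue over
    R, and evaluating the form at a real eigenvector shows its sign. *)
Lemma psd_eigenvalue_ge0 n (W : 'M[R]_n) (P : 'M[R[i]]_n) (lam : 'rV[R]_n) i :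
  psdmx W -> P \in unitmx ->
  map_mx iota W = invmx P *m diag_mx (map_mx iota lam) *m P -> 0 <= lam 0 i.
Proof.
move=> [sW pW] uP eW.
have : eigenvalue (map_mx iota W) (iota (lam 0 i)).
  apply/eigenvalueP; exists (row i P).
    by rewrite eW -!mulmxA -row_mul mulKVmx// row_mul row_diag_mx -scalemxAl -rowE mxE.
  apply: contraTneq uP => r0; rewrite -row_free_unit; apply/row_freePn.
  by exists i; rewrite r0 sub0mx.
rewrite eigenvalue_map => /eigenvalueP[v vW v0].
have vv : 0 < (v *m v^T) 0 0.
  rewrite mxE; have [j vj] : exists j, v 0 j != 0.
    by apply/existsP; apply: contraNT v0 => /existsPn h; apply/eqP/rowP => j; rewrite mxE; apply/eqP; have := h j; rewrite negbK.
  rewrite (bigD1 j)//= ltr_pwDl//; first by rewrite mxE -expr2 exprn_even_gt0.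
  by apply: sumr_ge0 => k _; rewrite mxE -expr2 sqr_ge0.
have := pW v^T; rewrite /quadmx trmxK vW -scalemxAl mxE.
by rewrite pmulr_lge0.
Qed.

Lemma trmx_horner n (W : 'M[R]_n.+1) (p : {poly R}) : W^T = W ->
  (horner_mx W p)^T = horner_mx W p.
Proof.
move=> sW; elim/poly_ind: p => [|p c ih]; first by rewrite rmorph0 trmx0.
rewrite rmorphD rmorphM /= horner_mx_X horner_mx_C linearD /= tr_scalar_mx.
congr (_ + _); rewrite trmx_mul ih sW.
have e : horner_mx W ('X * p) = horner_mx W (p * 'X) by rewrite mulrC.
by move: e; rewrite !rmorphM /= horner_mx_X.
Qed.

(** The root is Q ^ 2 with Q = q(W) for a real polynomial q taking the fourth
    roots of the eigenvalues. A polynomial in W is real and symmetric whatever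
    the basis that diagonalizes W over R[i], and being the square of a symmetric
    matrix makes the root positive semidefinite at once. *)
Lemma sqrtmx_exists n (W : 'M[R]_n) : psdmx W ->
  exists S : 'M[R]_n, psdmx S /\ S *m S = W.
Proof.
case: n W => [|n] W pW.
  exists 0; split; last by rewrite !flatmx0.
  by split; [rewrite trmx0|move=> v; rewrite /quadmx mulmx0 mul0mx mxE].
have [sW _] := pW.
have [P [lam [uP eW]]] := symmetric_diagonalizable sW.
have l0 i : 0 <= lam 0 i by exact: (psd_eigenvalue_ge0 i pW uP eW).
have [q hq] := interpolation [seq lam 0 i | i : 'I_n.+1] (fun x => Num.sqrt (Num.sqrt x)).
pose Q := horner_mx W q; exists (Q *m Q).
have sQ : Q^T = Q by exact: trmx_horner.
split.
  split; first by rewrite trmx_mul sQ.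
  move=> v; rewrite /quadmx -{1}sQ !mulmxA -trmx_mul -mulmxA mxE.
  by apply: sumr_ge0 => j _; rewrite mxE -expr2 sqr_ge0.
apply/eqP; rewrite -subr_eq0; apply/eqP.
have -> : Q *m Q *m (Q *m Q) - W = horner_mx W (q ^+ 4 - 'X).
  by rewrite rmorphB /= horner_mx_X rmorphXn /= !exprS expr0 mulr1 mulrA.
apply/(map_mx_inj (f := iota)); rewrite map_horner_mx eW horner_mx_uconjC//.
rewrite horner_mx_diag (_ : map_mx _ _ = 0).
  by rewrite linear0 mulmx0 mul0mx map_mx0.
apply/rowP => i; rewrite !mxE horner_map /= -[RHS](rmorph0 iota); congr (iota _).
rewrite hornerD hornerN hornerX horner_exp hq; last by apply/mapP; exists i; rewrite // mem_enum.
rewrite (exprM _ 2 2) sqr_sqrtr ?sqrtr_ge0// sqr_sqrtr ?l0//.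
exact: subrr.
Qed.

End SquareRoot.

(** * Square-integrable functions *)

Section SquareIntegrable.
Context {d : measure_display} {T : measurableType d} {R : realType}.
Variable mu : {measure set T -> \bar R}.
Implicit Types f g h : T -> R.

Definition L1 f := mu.-integrable [set: T] (EFin \o f).
(** A predicate on functions and not a space of classes: the different versions
    of a stochastic process have to be told apart. *)
Definition L2 f := measurable_fun [set: T] f /\ L1 (fun x => f x ^+ 2).
Definition ip f g := \int[mu]_x (f x * g x).
Definition nrm f := Num.sqrt (ip f f).

Lemma eq_int f g : (forall x, f x = g x) -> \int[mu]_x f x = \int[mu]_x g x.
Proof. by move=> /funext ->. Qed.

Lemma L1_meas f : L1 f -> measurable_fun [set: T] f.
Proof. by move=> /integrableP[/measurable_EFinP]. Qed.

Lemma L1_eq f g : f =1 g -> L1 f -> L1 g.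
Proof. by move=> /funext ->. Qed.

Lemma L1_le f g : measurable_fun [set: T] f -> (forall x, `|f x| <= `|g x|) ->
  L1 g -> L1 f.
Proof.
move=> mf fg; apply: le_integrable => //; first exact/measurable_EFinP.
by move=> x _; rewrite /= lee_fin.
Qed.

Lemma L1D f g : L1 f -> L1 g -> L1 (fun x => f x + g x).
Proof. by move=> lf lg; exact: (integrableD _ lf lg). Qed.

Lemma L1Z c f : L1 f -> L1 (fun x => c * f x).
Proof. by move=> lf; exact: (integrableZl _ c lf). Qed.

Lemma L1_0 : L1 (fun=> 0).
Proof. exact: integrable0. Qed.

Lemma L1_sum I (s : seq I) (P : pred I) (F : I -> T -> R) :
  (forall i, P i -> L1 (F i)) -> L1 (fun x => \sum_(i <- s | P i) F i x).
Proof.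
move=> lF; elim: s => [|i s ih].
  by under [X in L1 X]eq_fun do rewrite big_nil; exact: L1_0.
case Pi : (P i); last by under [X in L1 X]eq_fun do rewrite big_cons Pi.
under [X in L1 X]eq_fun do rewrite big_cons Pi.
by apply: L1D => //; exact: lF.
Qed.

Lemma int_sum I (s : seq I) (P : pred I) (F : I -> T -> R) :
  (forall i, P i -> L1 (F i)) ->
  \int[mu]_x (\sum_(i <- s | P i) F i x) = \sum_(i <- s | P i) \int[mu]_x F i x.
Proof.
move=> lF; elim: s => [|i s ih].
  rewrite big_nil (@eq_int _ (fun=> 0)) => [|x]; last by rewrite big_nil.
  by rewrite Rintegral_cst// mul0r.
rewrite big_cons -ih; case Pi : (P i); last first.
  by apply: eq_int => x; rewrite big_cons Pi.
rewrite -RintegralD//; [|exact: lF | exact: L1_sum].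
by apply: eq_int => x; rewrite big_cons Pi.
Qed.

Lemma fin_L1 f : L1 f -> (\int[mu]_x (f x)%:E)%E = (\int[mu]_x f x)%:E.
Proof. by move=> lf; rewrite /Rintegral fineK//; exact: integrable_fin_num. Qed.

Lemma ae_L1 f g : measurable_fun [set: T] g -> {ae mu, forall x, f x = g x} ->
  L1 f -> L1 g.
Proof.
move=> mg fg lf; have mf := L1_meas lf; move: lf => /integrableP[_ fi].
apply/integrableP; split; first exact/measurable_EFinP.
rewrite -(@ge0_ae_eq_integral _ _ _ mu setT (fun x => `|(f x)%:E|)%E)//.
- by apply: measurableT_comp => //; exact/measurable_EFinP.
- by apply: measurableT_comp => //; exact/measurable_EFinP.
- by apply: filterS fg => x /= -> _.
Qed.

Lemma ae_int f g : measurable_fun [set: T] f -> measurable_fun [set: T] g ->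
  {ae mu, forall x, f x = g x} -> \int[mu]_x f x = \int[mu]_x g x.
Proof.
move=> mf mg fg; congr fine; apply: ae_eq_integral => //.
- exact/measurable_EFinP.
- exact/measurable_EFinP.
- by apply: filterS fg => x /= -> _.
Qed.

Lemma int0_ae f : L1 f -> (forall x, 0 <= f x) -> \int[mu]_x f x = 0 ->
  {ae mu, forall x, f x = 0}.
Proof.
move=> lf f0 i0.
have e0 : (\int[mu]_x (f x)%:E = 0)%E by rewrite fin_L1// i0.
have /ae_eq_integral_abs : (\int[mu]_x `|(EFin \o f) x| = 0)%E.
  by rewrite -e0; apply: eq_integral => x _; rewrite /= ger0_norm.
move=> /(_ measurableT); case; first exact/measurable_EFinP/L1_meas.
move=> N [mN N0 sN]; exists N; split => // x fx; apply: sN => /= h; apply: fx.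
by have /= [] := h I.
Qed.

Lemma L2_meas f : L2 f -> measurable_fun [set: T] f.
Proof. by case. Qed.

Lemma L2P f : measurable_fun [set: T] f ->
  (\int[mu]_x ((f x) ^+ 2)%:E < +oo)%E -> L2 f.
Proof.
move=> mf fi; split => //; apply/integrableP; split.
  by apply/measurable_EFinP; exact: measurable_funX.
rewrite (eq_integral (fun x => ((f x)^+2)%:E))// => x _ /=.
by rewrite ger0_norm ?sqr_ge0.
Qed.

Lemma L2_lty f : L2 f -> (\int[mu]_x ((f x) ^+ 2)%:E < +oo)%E.
Proof. by move=> [_ lf]; rewrite (fin_L1 lf) ltry. Qed.

Lemma L2_le f g : measurable_fun [set: T] f -> (forall x, `|f x| <= `|g x|) ->
  L2 g -> L2 f.
Proof.
move=> mf fg [_ lg]; split=> //; apply: L1_le lg.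
  exact: measurable_funX.
by move=> x; rewrite !normrX ler_sqr ?nnegrE.
Qed.

Lemma L2M f g : L2 f -> L2 g -> L1 (fun x => f x * g x).
Proof.
move=> [mf lf] [mg lg]; apply: L1_le (L1D lf lg); first exact: measurable_funM.
move=> x; rewrite [leRHS]ger0_norm ?addr_ge0 ?sqr_ge0// normrM.
rewrite -[f x ^+ 2]real_normK ?num_real// -[g x ^+ 2]real_normK ?num_real//.
have : 0 <= (`|f x| - `|g x|) ^+ 2 by exact: sqr_ge0.
have : 0 <= `|f x| * `|g x| by exact: mulr_ge0.
nra.
Qed.

Lemma L2Z c f : L2 f -> L2 (fun x => c * f x).
Proof.
move=> [mf lf]; split; first exact: measurable_funM.
by apply: L1_eq (L1Z (c^+2) lf) => x; rewrite exprMn.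
Qed.

Lemma L2D f g : L2 f -> L2 g -> L2 (fun x => f x + g x).
Proof.
move=> lf lg; split; first exact: measurable_funD (L2_meas lf) (L2_meas lg).
have := L1D (L1D (proj2 lf) (L1Z 2 (L2M lf lg))) (proj2 lg).
by apply: L1_eq => x; ring.
Qed.

Lemma L2N f : L2 f -> L2 (fun x => - f x).
Proof. by move=> /(L2Z (-1)) [? ?]; under [X in L2 X]eq_fun do rewrite -mulN1r. Qed.

Lemma L2B f g : L2 f -> L2 g -> L2 (fun x => f x - g x).
Proof. by move=> lf /L2N; exact: L2D. Qed.

Lemma L2_0 : L2 (fun=> 0).
Proof.
split; first exact: measurable_cst.
by under [X in L1 X]eq_fun do rewrite expr0n /=; exact: L1_0.
Qed.

Lemma L2_sum I (s : seq I) (P : pred I) (F : I -> T -> R) :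
  (forall i, P i -> L2 (F i)) -> L2 (fun x => \sum_(i <- s | P i) F i x).
Proof.
move=> lF; elim: s => [|i s ih].
  by under [X in L2 X]eq_fun do rewrite big_nil; exact: L2_0.
case Pi : (P i); last by under [X in L2 X]eq_fun do rewrite big_cons Pi.
under [X in L2 X]eq_fun do rewrite big_cons Pi.
by apply: L2D => //; exact: lF.
Qed.

Lemma ae_L2 f g : measurable_fun [set: T] g -> {ae mu, forall x, f x = g x} ->
  L2 f -> L2 g.
Proof.
move=> mg fg [mf lf]; split => //; apply: ae_L1 lf; first exact: measurable_funX.
by apply: filterS fg => x ->.
Qed.

Lemma ipC f g : ip f g = ip g f.
Proof. by apply: eq_int => x; rewrite mulrC. Qed.

Lemma ipDl f g h : L2 f -> L2 g -> L2 h ->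
  ip (fun x => f x + g x) h = ip f h + ip g h.
Proof.
move=> lf lg lh; rewrite /ip -RintegralD//; [|exact: L2M|exact: L2M].
by apply: eq_int => x; rewrite mulrDl.
Qed.

Lemma ipZl c f g : L2 f -> L2 g -> ip (fun x => c * f x) g = c * ip f g.
Proof.
move=> lf lg; rewrite /ip -RintegralZl//; last exact: L2M.
by apply: eq_int => x; rewrite mulrA.
Qed.

Lemma ipBl f g h : L2 f -> L2 g -> L2 h ->
  ip (fun x => f x - g x) h = ip f h - ip g h.
Proof.
move=> lf lg lh; rewrite /ip -RintegralB//; [|exact: L2M|exact: L2M].
by apply: eq_int => x; rewrite mulrBl.
Qed.

Lemma ipDr f g h : L2 f -> L2 g -> L2 h ->
  ip h (fun x => f x + g x) = ip h f + ip h g.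
Proof. by move=> *; rewrite ipC ipDl// ![ip _ h]ipC. Qed.

Lemma ipBr f g h : L2 f -> L2 g -> L2 h ->
  ip h (fun x => f x - g x) = ip h f - ip h g.
Proof. by move=> *; rewrite ipC ipBl// ![ip _ h]ipC. Qed.

Lemma ipZr c f g : L2 f -> L2 g -> ip g (fun x => c * f x) = c * ip g f.
Proof. by move=> *; rewrite ipC ipZl// ipC. Qed.

Lemma ip_suml I (s : seq I) (P : pred I) (F : I -> T -> R) g :
  (forall i, P i -> L2 (F i)) -> L2 g ->
  ip (fun x => \sum_(i <- s | P i) F i x) g = \sum_(i <- s | P i) ip (F i) g.
Proof.
move=> lF lg; rewrite /ip -int_sum.
  by apply: eq_int => x; rewrite mulr_suml.
by move=> i Pi; exact: (L2M (lF i Pi) lg).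
Qed.

Lemma ip_sumr I (s : seq I) (P : pred I) (F : I -> T -> R) g :
  (forall i, P i -> L2 (F i)) -> L2 g ->
  ip g (fun x => \sum_(i <- s | P i) F i x) = \sum_(i <- s | P i) ip g (F i).
Proof.
by move=> lF lg; rewrite ipC ip_suml//; apply: eq_bigr => i _; rewrite ipC.
Qed.

Lemma ipff_ge0 f : 0 <= ip f f.
Proof. by apply: Rintegral_ge0 => x _; rewrite -expr2 sqr_ge0. Qed.

Lemma nrm_ge0 f : 0 <= nrm f. Proof. exact: sqrtr_ge0. Qed.

Lemma nrm2 f : nrm f ^+ 2 = ip f f.
Proof. by rewrite sqr_sqrtr// ipff_ge0. Qed.

Lemma nrm2E f : L2 f -> (\int[mu]_x ((f x) ^+ 2)%:E)%E = (nrm f ^+ 2)%:E.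
Proof. by move=> [mf lf]; rewrite (fin_L1 lf) nrm2. Qed.

Lemma nrm_eq f g : f =1 g -> nrm f = nrm g.
Proof. by move=> /funext ->. Qed.

Lemma nrm_0 : nrm (fun=> 0) = 0.
Proof. by rewrite /nrm /ip mulr0 Rintegral_cst// mul0r sqrtr0. Qed.

(** The quadratic t |-> ip (f - t g) (f - t g) is nonnegative, hence has
    nonpositive discriminant; when ip g g = 0 it is affine, which leaves no room
    for ip f g > 0. *)
Lemma cauchy_schwarz f g : L2 f -> L2 g -> ip f g <= nrm f * nrm g.
Proof.
move=> lf lg.
have quad t : 0 <= ip f f - 2 * t * ip f g + t ^+ 2 * ip g g.
  have lt := L2Z t lg; have := ipff_ge0 (fun x => f x - t * g x).
  rewrite ipBl//; last exact: L2B.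
  rewrite !ipBr// !ipZl// !ipZr// [ip g f]ipC => h; apply: le_trans h _.
  by rewrite le_eqVlt; apply/orP; left; apply/eqP; ring.
have [g0|gn0] := eqVneq (ip g g) 0.
  rewrite {2}/nrm g0 sqrtr0 mulr0 leNgt; apply/negP => fg0.
  have := quad ((ip f f + 1) / ip f g).
  rewrite g0 mulr0 addr0 -mulrA divfK ?gt_eqF//.
  by have := ipff_ge0 f; lra.
have gp : 0 < ip g g by rewrite lt_neqAle eq_sym gn0 ipff_ge0.
have h : ip f g ^+ 2 <= ip f f * ip g g.
  have := mulr_ge0 (quad (ip f g / ip g g)) (ltW gp).
  suff -> : (ip f f - 2 * (ip f g / ip g g) * ip f g +
     (ip f g / ip g g) ^+ 2 * ip g g) * ip g g = ip f f * ip g g - ip f g ^+ 2.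
    by rewrite subr_ge0.
  by field.
apply: le_trans (ler_norm _) _; rewrite -sqrtr_sqr -sqrtrM ?ipff_ge0//.
exact: ler_wsqrtr.
Qed.

Lemma nrmZ c f : L2 f -> nrm (fun x => c * f x) = `|c| * nrm f.
Proof.
move=> lf; rewrite /nrm ipZl//; last exact: L2Z.
by rewrite ipZr// mulrA -expr2 sqrtrM ?sqr_ge0// sqrtr_sqr.
Qed.

Lemma nrmN f : nrm (fun x => - f x) = nrm f.
Proof.
by congr Num.sqrt; apply: eq_Rintegral => x _; rewrite mulrNN.
Qed.

Lemma nrmBC f g : nrm (fun x => f x - g x) = nrm (fun x => g x - f x).
Proof. by rewrite -nrmN; apply: nrm_eq => x; rewrite opprB. Qed.

Lemma nrmD f g : L2 f -> L2 g -> nrm (fun x => f x + g x) <= nrm f + nrm g.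
Proof.
move=> lf lg; rewrite -ler_sqr ?nnegrE ?addr_ge0 ?nrm_ge0// nrm2.
rewrite ipDl//; last exact: L2D.
rewrite !ipDr// [ip g f]ipC.
rewrite sqrrD !nrm2.
by have := cauchy_schwarz lf lg; lra.
Qed.

Lemma nrmB_le f g h : L2 f -> L2 g -> L2 h ->
  nrm (fun x => f x - h x) <= nrm (fun x => f x - g x) + nrm (fun x => g x - h x).
Proof.
move=> lf lg lh; apply: le_trans (nrmD (L2B lf lg) (L2B lg lh)).
by rewrite (@nrm_eq _ (fun x => f x - h x))// => x; ring.
Qed.

Lemma nrm_le f g : L2 f -> L2 g -> nrm f <= nrm (fun x => f x - g x) + nrm g.
Proof.
move=> lf lg; apply: le_trans (nrmD (L2B lf lg) lg).
by rewrite (@nrm_eq _ f)// => x; rewrite subrK.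
Qed.

Lemma nrm_mono f g : L2 f -> L2 g -> (forall x, `|f x| <= `|g x|) ->
  nrm f <= nrm g.
Proof.
move=> lf lg fg; apply: ler_wsqrtr; apply: le_Rintegral => //; try exact: L2M.
move=> x _; rewrite -!expr2.
by rewrite -[leLHS]real_normK ?num_real// -[leRHS]real_normK ?num_real// ler_sqr ?nnegrE.
Qed.

Lemma nrm0_ae f : L2 f -> nrm f = 0 -> {ae mu, forall x, f x = 0}.
Proof.
move=> lf f0.
have := @int0_ae _ (L2M lf lf); case.
- by move=> x; rewrite -expr2 sqr_ge0.
- by rewrite -[LHS]nrm2 f0 expr0n.
move=> N [mN N0 sN]; exists N; split => // x fx; apply: sN => /= h; apply: fx.
by move/eqP: h; rewrite mulf_eq0 orbb => /eqP.
Qed.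

Lemma ae_ip f g h k : L2 f -> L2 g -> L2 h -> L2 k ->
  {ae mu, forall x, f x = g x} -> {ae mu, forall x, h x = k x} ->
  ip f h = ip g k.
Proof.
move=> [mf _] [mg _] [mh _] [mk _] fg hk; apply: ae_int; try exact: measurable_funM.
by apply: filterS2 fg hk => x -> ->.
Qed.

Lemma ae_nrm f g : L2 f -> L2 g -> {ae mu, forall x, f x = g x} -> nrm f = nrm g.
Proof. by move=> lf lg fg; congr Num.sqrt; exact: ae_ip. Qed.

Lemma nrm_ae0 f : L2 f -> {ae mu, forall x, f x = 0} -> nrm f = 0.
Proof. by move=> lf f0; rewrite (ae_nrm lf L2_0)// nrm_0. Qed.

End SquareIntegrable.

Section RieszFischer.
Context {d : measure_display} {T : measurableType d} {R : realType}.
Implicit Types f : nat -> T -> R.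

(** An explicit formula for the limit, so that it is measurable for every
    sigma-algebra that makes the sequence measurable: limits inherit both
    adaptedness and joint measurability in time and chance. *)
Definition limfun f (x : T) : R := fine (limn_esup (fun j => (f j x)%:E)).

Lemma measurable_limfun f : (forall j, measurable_fun [set: T] (f j)) ->
  measurable_fun [set: T] (limfun f).
Proof.
move=> mf; apply: measurableT_comp; first exact: fine_measurable.
by apply: measurable_fun_limn_esup => // j; exact/measurable_EFinP.
Qed.

Lemma limfun_cvg f x : cvgn (fun j => f j x) ->
  (fun j => f j x) @ \oo --> limfun f x.
Proof.
move=> cf; suff -> : limfun f x = limn (fun j => f j x) by [].
rewrite /limfun is_cvg_limn_esupE; last first.
  by apply/cvg_ex; exists (limn (fun j => f j x))%:E; apply: cvg_EFin => //; near=> n.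
by rewrite (EFin_lim cf).
Unshelve. all: by end_near. Qed.

Variable mu : {measure set T -> \bar R}.

Lemma geo_le (C : R) n : 0 <= C -> C * (2 - 2 / 2 ^+ n) <= 2 * C.
Proof.
move=> C0; rewrite mulrC ler_wpM2r// lerBlDr lerDl.
by rewrite divr_ge0// exprn_ge0.
Qed.

Lemma nrm_telescope f (C : R) j i :
  (forall j, L2 mu (f j)) ->
  (forall j, nrm mu (fun x => f j.+1 x - f j x) <= C / 2 ^+ j) ->
  nrm mu (fun x => f (j + i)%N x - f j x) <= C / 2 ^+ j * (2 - 2 / 2 ^+ i).
Proof.
move=> lf fC; elim: i => [|i ih].
  rewrite addn0 expr0 divr1 subrr mulr0 (@nrm_eq _ _ _ mu _ (fun=> 0)) ?nrm_0//.
  by move=> x; rewrite subrr.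
rewrite addnS; apply: le_trans (nrmB_le (lf _) (lf (j + i)%N) (lf _)) _.
apply: le_trans (lerD (fC _) ih) _.
rewrite le_eqVlt; apply/orP; left; apply/eqP; rewrite exprD !exprS.
by field; rewrite !expf_neq0.
Qed.

Section limit.
Variables (f : nat -> T -> R) (C : R).
Hypothesis lf : forall j, L2 mu (f j).
Hypothesis fC : forall j, nrm mu (fun x => f j.+1 x - f j x) <= C / 2 ^+ j.

Let C0 : 0 <= C.
Proof. by have := fC 0; rewrite expr0 divr1; apply: le_trans; exact: nrm_ge0. Qed.

Let s n x := \sum_(j < n) `|f j.+1 x - f j x|.

Let ls n : L2 mu (s n).
Proof.
apply: L2_sum => j _; have [mg lg] := L2B (lf j.+1) (lf j).
split; first exact: measurableT_comp.
by apply: L1_eq lg => x; rewrite real_normK ?num_real.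
Qed.

Let ns n : nrm mu (s n) <= C * (2 - 2 / 2 ^+ n).
Proof.
elim: n => [|n ih].
  rewrite expr0 divr1 subrr mulr0 (@nrm_eq _ _ _ mu _ (fun=> 0)) ?nrm_0//.
  by move=> x; rewrite /s big_ord0.
have ld : L2 mu (fun x => `|f n.+1 x - f n x|).
  have [mg lg] := L2B (lf n.+1) (lf n).
  split; first exact: measurableT_comp.
  by apply: L1_eq lg => x; rewrite real_normK ?num_real.
rewrite (@nrm_eq _ _ _ mu _ (fun x => s n x + `|f n.+1 x - f n x|)); last first.
  by move=> x; rewrite /s big_ord_recr.
apply: le_trans (nrmD (ls n) ld) _.
apply: le_trans (lerD ih (_ : _ <= C / 2 ^+ n)) _.
  apply: le_trans (fC n); apply: nrm_mono => //; first exact: L2B.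
  by move=> x; rewrite normr_id.
rewrite le_eqVlt; apply/orP; left; apply/eqP; rewrite !exprS.
by field; rewrite !expf_neq0.
Qed.

(** The partial sums of the absolute increments have norm at most 2 C, so by
    monotone convergence their limit is almost everywhere finite and the
    sequence converges absolutely. *)
Lemma rf_ae_cvg : {ae mu, forall x, cvgn (fun j => f j x)}.
Proof.
pose g n x := ((s n x) ^+ 2)%:E.
have ndg x : nondecreasing_seq (g ^~ x).
  apply/nondecreasing_seqP => n; rewrite lee_fin ler_sqr ?nnegrE ?sumr_ge0//.
  by rewrite /s big_ord_recr/= lerDl.
have mg n : measurable_fun setT (g n).
  by apply/measurable_EFinP; apply: measurable_funX; exact: L2_meas (ls n).
have g0 n x : (0 <= g n x)%E by rewrite lee_fin sqr_ge0.
have := @cvg_monotone_convergence _ _ _ mu setT measurableT g mg (fun n x _ => g0 n x)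
  (fun x _ => ndg x).
set G := fun x => limn (g ^~ x) => cG.
have G0 x : (0 <= G x)%E.
  apply: lime_ge; first exact: ereal_nondecreasing_is_cvgn.
  by near=> n; exact: g0.
have mG : measurable_fun setT G.
  apply: (emeasurable_fun_cvg g) => // x _.
  exact: ereal_nondecreasing_is_cvgn.
have iG : (\int[mu]_x G x <= ((2 * C) ^+ 2)%:E)%E.
  rewrite -(cvg_lim _ cG)//; apply: lime_le; first by apply/cvg_ex; eexists; exact: cG.
  near=> n; rewrite (nrm2E (ls n)) lee_fin ler_sqr ?nnegrE ?nrm_ge0 ?mulr_ge0//.
  by apply: le_trans (ns n) _; exact: geo_le.
have : mu.-integrable setT G.
  apply/integrableP; split => //.
  under eq_integral do rewrite gee0_abs//.
  by apply: le_lt_trans iG _; rewrite ltry.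
move=> /(integrable_ae measurableT); apply: filterS => x /(_ I) Gx.
have bs : exists M, forall n, s n x <= M.
  exists (fine (G x) + 1) => n.
  have : (g n x <= G x)%E.
    apply: lime_ge; first exact: ereal_nondecreasing_is_cvgn.
    by near=> k; apply: (ndg x); near: k; exists n.
  rewrite -[G x in X in X -> _]fineK// lee_fin.
  have : 0 <= s n x by apply: sumr_ge0.
  by nra.
have cs : cvgn (series (fun j => `|f j.+1 x - f j x|)).
  apply: nondecreasing_is_cvgn.
    apply/nondecreasing_seqP => n; rewrite !seriesEnat /= big_nat_recr//=.
    by rewrite lerDl.
  have [M sM] := bs; exists M => _ [n _ <-].
  by rewrite seriesEnat /= big_mkord; exact: sM.
have := normed_cvg cs => cs'.
have -> : (fun j => f j x) = (fun j => series (fun j => f j.+1 x - f j x) j + f 0%N x).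
  by apply/funext => j; rewrite seriesEnat/= telescope_sumr// subrK.
by apply: is_cvgD => //; exact: is_cvg_cst.
Unshelve. all: by end_near.
Qed.

Lemma rf_ae_limfun :
  {ae mu, forall x, (fun j => f j x) @ \oo --> limfun f x}.
Proof. by apply: filterS rf_ae_cvg => x; exact: limfun_cvg. Qed.

Let mF : measurable_fun [set: T] (limfun f).
Proof. by apply: measurable_limfun => j; exact: L2_meas (lf j). Qed.

Let rf_fatou j : (\int[mu]_x ((limfun f x - f j x) ^+ 2)%:E <=
   ((2 * C / 2 ^+ j) ^+ 2)%:E)%E.
Proof.
have fj := L2_meas (lf j).
pose h k x := ((f k x - f j x) ^+ 2)%:E.
have mh k : measurable_fun setT (h k).
  apply/measurable_EFinP; apply: measurable_funX; apply: measurable_funB => //.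
  exact: L2_meas (lf k).
have h0 k x : (0 <= h k x)%E by rewrite lee_fin sqr_ge0.
rewrite (@ae_eq_integral _ _ _ mu setT (fun x => limn_einf (h ^~ x)))//.
- apply: le_trans (fatou mu measurableT mh (fun n x _ => h0 n x)) _.
  rewrite limn_einf_lim; apply: lime_le.
    apply: ereal_nondecreasing_is_cvgn; exact: nondecreasing_einfs.
  near=> n; apply: (@le_trans _ _ (\int[mu]_x h (n + j)%N x)%E).
    by apply: ereal_inf_lbound; exists (n + j)%N => //=; exact: leq_addr.
  rewrite (nrm2E (L2B (lf _) (lf j))) lee_fin ler_sqr ?nnegrE ?nrm_ge0//; last first.
    by rewrite divr_ge0 ?mulr_ge0// exprn_ge0.
  rewrite addnC; apply: le_trans (nrm_telescope _ _ lf fC) _.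
  by rewrite -[leRHS]mulrA; apply: geo_le; rewrite divr_ge0// exprn_ge0.
- by apply/measurable_EFinP; apply: measurable_funX; exact: measurable_funB.
- rewrite (_ : (fun x => limn_einf (h ^~ x)) =
     (fun x => - limn_esup (fun k => - h k x))%E).
    apply: measurableT_comp => //; apply: measurable_fun_limn_esup => k.
    exact: measurableT_comp.
  by apply/funext => x; rewrite (limn_esupN (h ^~ x)) oppeK.
- apply: filterS rf_ae_limfun => x cx _.
  have ch : h ^~ x @ \oo --> (((limfun f x - f j x) ^+ 2)%:E).
    apply: cvg_EFin; first by near=> n.
    apply: (@cvg_comp _ _ _ _ (fun y => y ^+ 2) _ (nbhs (limfun f x - f j x))).
      by apply: cvgB => //; exact: cvg_cst.
    exact: exprn_continuous.
  by rewrite (cvg_limn_einf_sup ch).1.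
Unshelve. all: by end_near.
Qed.

(** Fatou passes the geometric bound on the increments to the limit. The
    explicit geometric rate replaces the extraction of a subsequence. *)
Lemma riesz_fischer : L2 mu (limfun f) /\
  forall j, nrm mu (fun x => limfun f x - f j x) <= 2 * C / 2 ^+ j.
Proof.
have lB j : L2 mu (fun x => limfun f x - f j x).
  apply: L2P; first by apply: measurable_funB => //; exact: L2_meas (lf j).
  by apply: le_lt_trans (rf_fatou j) _; rewrite ltry.
have lF : L2 mu (limfun f).
  have := L2D (lB 0%N) (lf 0%N); congr (L2 mu _).
  by apply/funext => x; rewrite subrK.
split=> // j; rewrite -ler_sqr ?nnegrE ?nrm_ge0//; last first.
  by rewrite divr_ge0 ?mulr_ge0// exprn_ge0.
by rewrite -lee_fin -(nrm2E (lB j)); exact: rf_fatou.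
Qed.

End limit.
End RieszFischer.

(** * Gaussian moments and increments of the Wiener process *)

Section GaussianMoments.
Context {R : realType}.
Notation mu := (@lebesgue_measure R).
Variable c : R.
Hypothesis c0 : 0 < c.
Let K (x : R) := expR (- (c * x ^+ 2)).

Let dK (x : R) : is_derive x (1 : R) K (- (2 * c * x) * K x).
Proof.
rewrite /K; apply: is_derive_eq.
by rewrite scaler1 /GRing.scale/=; ring.
Qed.

Let cK : continuous K.
Proof. by move=> x; apply: differentiable_continuous; apply/derivable1_diffP; case: (dK x). Qed.

Let K0 x : 0 <= K x. Proof. exact: expR_ge0. Qed.

Let mK : measurable_fun [set: R] K.
Proof. exact: continuous_measurable_fun. Qed.

Let Klim : K x @[x --> +oo] --> 0.
Proof.
apply: (cvg_comp (fun x => c * x ^+ 2) (fun x => expR (- x))); last exact: cvgr_expR.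
apply/cvgryPge => M; near=> x.
rewrite -ler_pdivrMl//; apply: (@le_trans _ _ x).
  by near: x; apply: nbhs_pinfty_ge; rewrite num_real.
have x1 : 1 <= x by near: x; apply: nbhs_pinfty_ge; rewrite num_real.
by rewrite expr2 ler_peMl// (le_trans ler01).
Unshelve. all: by end_near. Qed.

Let pK (y : R) : 0 <= y -> 0 <= 2 * c * y * K y.
Proof. by move=> y0; rewrite mulr_ge0 ?mulr_ge0 ?(ltW c0). Qed.

(** The function y K y has the explicit primitive - K / (2 c). *)
Let K_tail (x : R) : 0 <= x ->
  (\int[mu]_(y in `[x, +oo[) (2 * c * y * K y)%:E = (K x)%:E)%E.
Proof.
move=> x0.
rewrite (@ge0_continuous_FTC2y _ _ (fun y => - K y) x 0).
- by rewrite sub0e -EFinN opprK.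
- by move=> y xy; apply: pK; apply: le_trans xy.
- apply: continuous_subspaceT => y; apply: cvgM; last exact: cK.
  by apply: cvgM; [exact: cvg_cst|exact: cvg_id].
- by rewrite -oppr0; apply: cvgN; exact: Klim.
- by move=> y _; apply: derivableN; case: (dK y).
- by apply: cvgN; apply: cvg_at_right_filter; exact: cK.
- move=> y _; rewrite derive1E deriveN; last by case: (dK y).
  by have [_ ->] := dK y; rewrite mulNr opprK.
Qed.

(** Write one factor y of y ^ 2 K y as the length of [0, y] and exchange the
    integrals over 0 <= x <= y; the inner integral is then the tail computed in
    K_tail. *)
Lemma gauss_second_moment :
  (\int[mu]_x (x ^+ 2 * K x)%:E = ((2 * c)^-1)%:E * \int[mu]_x (K x)%:E)%E.
Proof.
have c2 : (0 <= ((2 * c)^-1)%:E)%E by rewrite lee_fin invr_ge0 mulr_ge0// ltW.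
have pos : [set x : R | 0 <= x] = `[0, +oo[%classic.
  by apply/seteqP; split => x/=; rewrite in_itv/= andbT.
have cx2 : continuous (fun x : R => x ^+ 2 * K x).
  by move=> x; apply: cvgM; [exact: exprn_continuous|exact: cK].
rewrite (@ge0_symfun_integralT _ (fun x => x ^+ 2 * K x))//; last 2 first.
- by move=> x; rewrite mulr_ge0// sqr_ge0.
- by move=> x; rewrite /= /K sqrrN.
rewrite (@ge0_symfun_integralT _ K)//; last by move=> x; rewrite /= /K sqrrN.
rewrite muleCA; congr (_ * _)%E; rewrite pos.
have mle : measurable [set p : R * R | p.1 <= p.2].
  by rewrite -[X in measurable X]setTI; apply: measurable_fun_le.
have inle (x y : R) : ((x, y) \in [set p : R * R | p.1 <= p.2]) = (x <= y).
  by apply/idP/idP; rewrite inE.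
have mrK : measurable_fun setT ((fun x : R => (K x)%:E) \_ (`[0, +oo[%classic : set R)).
  apply/(measurable_restrictT _ _).1; first exact: measurable_itv.
  by apply: measurable_funTS; exact/measurable_EFinP.
have step (y : R) : 0 <= y ->
    (\int[mu]_x ((\1_(`[0, y]%classic : set R) x)%:E * (y * K y)%:E) =
     (y ^+ 2 * K y)%:E)%E.
  move=> y0; have mI : measurable (`[0, y]%classic : set R) by exact: measurable_itv.
  rewrite ge0_integralZr; first last.
  - by rewrite lee_fin mulr_ge0.
  - by move=> x _; rewrite lee_fin.
  - by apply/measurable_EFinP; exact: measurable_indic.
  - exact: measurableT.
  rewrite integral_indic// setIT expr2 -mulrA [RHS]EFinM; congr (_ * _)%E.
  apply: etrans (lebesgue_measure_itv _) _; rewrite /= lte_fin.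
  case: ltP => [_|y0']; first by rewrite oppr0 adde0.
  by have -> : y = 0 by lra.
pose f (p : R * R) : \bar R :=
  (\1_[set p : R * R | p.1 <= p.2] p * \1_(`[0, +oo[%classic : set R) p.1 * (`|p.2| * K p.2))%:E.
have mf : measurable_fun setT f.
  apply/measurable_EFinP; apply: measurable_funM; first apply: measurable_funM.
  - exact: measurable_indic.
  - apply: (measurableT_comp (measurable_indic _)) => //; exact: measurable_itv.
  - apply: measurable_funM; first exact: measurableT_comp.
    exact: (measurableT_comp mK).
have f0 p : (0 <= f p)%E.
  by rewrite lee_fin !mulr_ge0.
have := @fubini_tonelli _ _ _ _ _ mu mu f mf f0.
rewrite /f /= {f mf f0} => fub.
transitivity (\int[mu]_y \int[mu]_x (\1_[set p : R * R | p.1 <= p.2] (x, y) *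
   \1_(`[0, +oo[%classic : set R) x * (`|y| * K y))%:E)%E.
  rewrite integral_mkcond; apply: eq_integral => y _.
  rewrite patchE; case: ifPn => [|] yP.
    have y0 : 0 <= y by move: yP; rewrite inE/= in_itv/= andbT.
    transitivity (\int[mu]_x ((\1_(`[0, y]%classic : set R) x)%:E * (y * K y)%:E))%E.
      by rewrite step.
    apply: eq_integral => x _; rewrite -EFinM (ger0_norm y0) !indicE.
    rewrite inle !mem_setE !in_itv/= andbT; congr (_ * _)%:E.
    by rewrite -natrM mulnb andbC.
  transitivity (0%:E : \bar R); first by [].
  apply/esym; apply: integral0_eq => x _; rewrite !indicE inle mem_setE.
  have yn : y < 0 by move: yP; rewrite notin_setE/= in_itv/= andbT => /negP; rewrite -ltNge.
  rewrite in_itv/= andbT; congr EFin.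
  case: (leP x y) => [xy|_]; last by rewrite !mul0r.
  by rewrite leNgt (le_lt_trans xy yn)/= mulr0 mul0r.
rewrite -fub.
rewrite [X in (_ = _ * X)%E]integral_mkcond -ge0_integralZl; first last.
- exact: c2.
- by move=> x _; apply: erestrict_ge0 => y _; rewrite lee_fin.
- exact: mrK.
- exact: measurableT.
apply: eq_integral => x _; rewrite patchE; case: ifPn => xP; last first.
  apply: (@etrans _ _ 0%:E); last by rewrite mule0.
  apply: integral0_eq => y _; congr EFin.
  by rewrite [X in _ * X * _]indicE (negbTE xP) mulr0 mul0r.
have x0 : 0 <= x by move: xP; rewrite inE/= in_itv/= andbT.
rewrite -(K_tail x0) -ge0_integralZl; first last.
- exact: c2.
- move=> y; rewrite /= in_itv/= andbT => xy.
  by rewrite lee_fin; apply: pK; apply: le_trans xy.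
- apply/measurable_EFinP; apply: measurable_funTS; exact: measurable_funM.
- exact: measurable_itv.
rewrite [RHS]integral_mkcond; apply: eq_integral => y _.
rewrite patchE !indicE xP mulr1 inle mem_setE in_itv/= andbT.
case: leP => xy; last by rewrite mul0r.
rewrite mul1r (ger0_norm (le_trans x0 xy)) -EFinM; congr (_%:E).
by field; rewrite gt_eqF.
Qed.

(** The reflection x |-> - x exchanges the two sides. Keeping the positive and
    negative parts apart keeps all integrands nonnegative. *)
Lemma gauss_first_moment :
  (\int[mu]_x (Num.max x 0 * K x)%:E = \int[mu]_x (Num.max (- x) 0 * K x)%:E)%E.
Proof.
transitivity (\int[mu]_(x in `[0%R, +oo[) (x * K x)%:E)%E.
  rewrite [RHS]integral_mkcond; apply: eq_integral => x _.
  rewrite patchE mem_setE in_itv/= andbT maxEle.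
  by case: (ltgtP x 0) => [_|_|->]; rewrite ?mul0r.
have cN : continuous (fun x : R => - x * K x).
  by move=> x; apply: cvgM; [apply: cvgN; exact: cvg_id|exact: cK].
transitivity (\int[mu]_(x in `]-oo, (- 0)%R]) (- x * K x)%:E)%E; last first.
  rewrite [LHS]integral_mkcond; apply: eq_integral => x _.
  rewrite patchE mem_setE in_itv/= oppr0 maxEle oppr_le0.
  by case: (ltgtP x 0) => [_|_|->]; rewrite ?oppr0 ?mul0r.
rewrite ge0_integration_by_substitutionNy.
- by apply: eq_integral => x _; rewrite /= opprK /K sqrrN.
- exact: continuous_subspaceT.
- move=> x; rewrite in_itv/= oppr0 => x0; apply: mulr_ge0; last exact: K0.
  by rewrite oppr_ge0 ltW.
Qed.

End GaussianMoments.

Section NormalMoments.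
Context {R : realType}.
Notation mu := (@lebesgue_measure R).
Variable s : R.
Hypothesis s0 : 0 < s.

Lemma ge0_integral_normal (f : R -> \bar R) :
  measurable_fun [set: R] f -> (forall x, 0 <= f x)%E ->
  (\int[normal_prob 0 s]_x f x = \int[mu]_x (f x * (normal_pdf 0 s x)%:E))%E.
Proof.
move=> mf f0; have dom := normal_prob_dominates 0 s.
rewrite -(Radon_Nikodym_SigmaFinite.change_of_variables dom)//.
have mp : measurable_fun [set: R] (fun x => (normal_pdf 0 s x)%:E).
  by apply/measurable_EFinP; exact: measurable_normal_pdf.
have iF := Radon_Nikodym_SigmaFinite.f_integrable dom.
apply: ae_eq_integral => //.
- by apply: emeasurable_funM => //; exact: measurable_int iF.
- exact: emeasurable_funM.
apply: ae_eqe_mul2l; apply: integral_ae_eq => // E _ mE.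
by rewrite -Radon_Nikodym_SigmaFinite.f_integral.
Qed.

Let c := (s ^+ 2 *+ 2)^-1.
Let c0 : 0 < c. Proof. by rewrite invr_gt0 mulrn_wgt0// exprn_gt0. Qed.

Let pdfE x : normal_pdf 0 s x = normal_peak s * expR (- (c * x ^+ 2)).
Proof.
rewrite normal_pdfE ?gt_eqF// /normal_fun subr0 mulNr.
by rewrite [c * _]mulrC.
Qed.

Let pk0 : 0 <= normal_peak s. Proof. exact: normal_peak_ge0. Qed.

Let mK : measurable_fun [set: R] (fun x => expR (- (c * x ^+ 2))).
Proof.
apply: measurableT_comp => //; apply: measurableT_comp => //.
by apply: measurable_funM.
Qed.

Let scaled (f : R -> R) : measurable_fun [set: R] f -> (forall x, 0 <= f x) ->
  (\int[normal_prob 0 s]_x (f x)%:E =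
   (normal_peak s)%:E * \int[mu]_x (f x * expR (- (c * x ^+ 2)))%:E)%E.
Proof.
move=> mf f0; rewrite ge0_integral_normal//; last exact/measurable_EFinP.
rewrite -ge0_integralZl//.
- by apply: eq_integral => x _; rewrite -!EFinM pdfE; congr EFin; ring.
- by apply/measurable_EFinP; exact: measurable_funM.
- by move=> x _; rewrite lee_fin mulr_ge0// expR_ge0.
Qed.

Lemma normal_second_moment :
  (\int[normal_prob 0 s]_x (x ^+ 2)%:E = (s ^+ 2)%:E)%E.
Proof.
rewrite scaled//; last by move=> x; exact: sqr_ge0.
rewrite gauss_second_moment// muleCA -ge0_integralZl//; last exact/measurable_EFinP.
transitivity (((2 * c)^-1)%:E * 1)%E.
  congr (_ * _)%E; rewrite -(integral_normal_pdf 0 s).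
  by apply: eq_integral => x _; rewrite pdfE.
rewrite mule1 /c; congr EFin.
by rewrite -mulr_natr; field; rewrite gt_eqF.
Qed.

Lemma normal_first_moment :
  (\int[normal_prob 0 s]_x (Num.max x 0)%:E =
   \int[normal_prob 0 s]_x (Num.max (- x) 0)%:E)%E.
Proof.
rewrite !scaled; first by rewrite gauss_first_moment.
- by apply: measurable_maxr => //; exact: measurableT_comp.
- by move=> x; rewrite le_max lexx orbT.
- exact: measurable_maxr.
- by move=> x; rewrite le_max lexx orbT.
Qed.

End NormalMoments.

Section ProbL2.
Context {d : measure_display} {T : measurableType d} {R : realType}.
Variable Pr : probability T R.

Lemma L2_cst c : L2 Pr (fun=> c).
Proof.
split; first exact: measurable_cst.
exact: finite_measure_integrable_cst.
Qed.

Lemma L2_L1 f : L2 Pr f -> L1 Pr f.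
Proof.
by move=> lf; apply: (L1_eq _ (L2M lf (L2_cst 1))) => x; rewrite mulr1.
Qed.

End ProbL2.

Section Increments.
Context {d : measure_display} {Omega : measurableType d} {R : realType}.
Variable Pr : probability Omega R.
Variable F : R -> set (set Omega).
Variable w : R -> Omega -> R.
Hypothesis hw : wiener_process Pr F w.

Lemma wrt_measurable t (f : Omega -> R) : 0 <= t ->
  measurable_wrt (F t) f -> measurable_fun [set: Omega] f.
Proof.
move=> t0 mf _ U mU; rewrite setTI.
exact: (filtration_sub (wiener_filtration hw) t0) (mf U mU).
Qed.

Lemma measurable_w t : 0 <= t -> measurable_fun [set: Omega] (w t).
Proof. by move=> t0; apply: (wrt_measurable t0); exact: wiener_adapted hw _ t0. Qed.

Lemma measurable_increment s t : 0 <= s -> s <= t ->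
  measurable_fun [set: Omega] (increment w s t).
Proof.
move=> s0 st; apply: measurable_funB; apply: measurable_w => //.
exact: le_trans st.
Qed.

Section fixed.
Variables s t : R.
Hypotheses (s0 : 0 <= s) (st : s < t).
Let D := increment w s t.
Let sd := Num.sqrt (t - s).
Let sd0 : 0 < sd. Proof. by rewrite sqrtr_gt0 subr_gt0. Qed.
Let mD : measurable_fun [set: Omega] D.
Proof. by apply: measurable_increment => //; exact: ltW. Qed.

Lemma ge0_integral_increment (h : R -> \bar R) : measurable_fun [set: R] h ->
  (forall x, 0 <= h x)%E ->
  (\int[Pr]_o h (D o) = \int[normal_prob 0 sd]_x h x)%E.
Proof.
move=> mh h0.
have mD' : @measurable_fun _ _ Omega (measurableTypeR R) setT D := mD.
have mh' : @measurable_fun _ _ (measurableTypeR R) (\bar R) setT h := mh.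
pose Dp : {mfun Omega >-> measurableTypeR R} := HB.pack D (isMeasurableFun.Build _ _ _ _ _ mD').
rewrite -[LHS](ge0_integral_distribution (Dp : {RV Pr >-> measurableTypeR R}) mh' h0).
apply: (@eq_measure_integral _ _ R setT (normal_prob 0 sd) (distribution Pr Dp)) => U mU _.
exact: (wiener_normal hw s0 st mU).
Qed.

(** The joint law of (Y, D) and the product of the laws agree on rectangles,
    hence are equal, and Tonelli factorizes the integral. *)
Lemma ge0_indep (Y : Omega -> R) (g h : R -> \bar R) :
  measurable_wrt (F s) Y ->
  measurable_fun [set: R] g -> (forall x, 0 <= g x)%E ->
  measurable_fun [set: R] h -> (forall x, 0 <= h x)%E ->
  (\int[Pr]_o (g (Y o) * h (D o)) = \int[Pr]_o g (Y o) * \int[Pr]_o h (D o))%E.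
Proof.
move=> wY mg g0 mh h0; have mY := wrt_measurable s0 wY.
have mY' : @measurable_fun _ _ Omega (measurableTypeR R) setT Y := mY.
have mD' : @measurable_fun _ _ Omega (measurableTypeR R) setT D := mD.
have mh' : @measurable_fun _ _ (measurableTypeR R) (\bar R) setT h := mh.
have mg' : @measurable_fun _ _ (measurableTypeR R) (\bar R) setT g := mg.
pose Yp : {mfun Omega >-> measurableTypeR R} := HB.pack Y (isMeasurableFun.Build _ _ _ _ _ mY').
pose YD o : measurableTypeR R * measurableTypeR R := (Y o, D o).
have mYD : measurable_fun [set: Omega] YD by exact: measurable_fun_pair.
pose YDp : {mfun Omega >-> (measurableTypeR R * measurableTypeR R)%type} := HB.pack YD (isMeasurableFun.Build _ _ _ _ _ mYD).
pose PY := distribution Pr Yp.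
have pE := @product_measure_unique _ _ _ _ R PY (normal_prob 0 sd) (distribution Pr YDp).
have {}pE : forall X : set (measurableTypeR R * measurableTypeR R), measurable X ->
    (PY \x normal_prob 0 sd)%E X = distribution Pr YDp X.
  apply: pE => A B mA mB.
  rewrite [LHS](_ : _ = Pr (Y @^-1` A `&` D @^-1` B)) //.
  by rewrite (wiener_indep hw s0 st (wY _ mA) mB) (wiener_normal hw s0 st mB).
pose f (p : measurableTypeR R * measurableTypeR R) := (g p.1 * h p.2)%E.
have mf : measurable_fun setT f.
  by apply: emeasurable_funM; [exact: (measurableT_comp mg')|exact: (measurableT_comp mh')].
have f0 p : (0 <= f p)%E by apply: mule_ge0.
rewrite -[LHS](ge0_integral_distribution (YDp : {RV Pr >-> (measurableTypeR R * measurableTypeR R)%type}) mf f0).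
transitivity (\int[PY \x normal_prob 0 sd]_p f p)%E.
  by apply: eq_measure_integral => X mX _; apply/esym; exact: pE.
rewrite fubini_tonelli1// /fubini_F /f/=.
transitivity (\int[PY]_y (g y * \int[normal_prob 0 sd]_z h z))%E.
  by apply: eq_integral => y _; rewrite ge0_integralZl.
rewrite ge0_integralZr//; last by apply: integral_ge0 => x _.
rewrite ge0_integral_increment//; congr (_ * _)%E.
exact: (ge0_integral_distribution (Yp : {RV Pr >-> measurableTypeR R}) mg' g0).
Qed.

Lemma increment_sqr : (\int[Pr]_o (D o ^+ 2)%:E = (t - s)%:E)%E.
Proof.
rewrite (ge0_integral_increment (h := fun x => (x ^+ 2)%:E)).
- by rewrite normal_second_moment// sqr_sqrtr// subr_ge0 ltW.
- by apply/measurable_EFinP; exact: measurable_funX.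
- by move=> x; rewrite lee_fin sqr_ge0.
Qed.

Lemma L2_increment : L2 Pr D.
Proof. by apply: L2P => //; rewrite increment_sqr ltry. Qed.

Let mpos : measurable_fun [set: R] (fun x : R => (Num.max x 0)%:E).
Proof. by apply/measurable_EFinP; exact: measurable_maxr. Qed.
Let mneg : measurable_fun [set: R] (fun x : R => (Num.max (- x) 0)%:E).
Proof.
by apply/measurable_EFinP; apply: measurable_maxr => //; exact: measurableT_comp.
Qed.
Let pos0 (x : R) : (0 <= (Num.max x 0)%:E)%E.
Proof. by rewrite lee_fin le_max lexx orbT. Qed.

Let pn (x : R) : x = Num.max x 0 - Num.max (- x) 0.
Proof. by rewrite !maxEle oppr_le0; case: (ltgtP x 0) => [||->]; rewrite ?subrr; lra. Qed.

Let Dpn : (\int[Pr]_o (Num.max (D o) 0)%:E = \int[Pr]_o (Num.max (- D o) 0)%:E)%E.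
Proof.
rewrite (ge0_integral_increment (h := fun x => (Num.max x 0)%:E))//.
rewrite (ge0_integral_increment (h := fun x => (Num.max (- x) 0)%:E))//.
exact: normal_first_moment.
Qed.

Lemma L1_mul_increment Y : measurable_wrt (F s) Y -> L1 Pr Y ->
  L1 Pr (fun o => Y o * D o).
Proof.
move=> wY lY; have mY := L1_meas lY.
apply/integrableP; split; first by apply/measurable_EFinP; exact: measurable_funM.
under eq_integral do rewrite /= normrM EFinM.
have mabs : measurable_fun [set: R] (fun x : R => `|x|%:E).
  by apply/measurable_EFinP; exact: normr_measurable.
rewrite (ge0_indep (g := fun x => `|x|%:E) (h := fun x => `|x|%:E))//.
have /integrableP[_ a] := lY; have /integrableP[_ b] := L2_L1 L2_increment.
apply: lte_mul_pinfty => //; first exact: integral_ge0.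
by rewrite ge0_fin_numE//; exact: integral_ge0.
Qed.

Lemma L1_mul_increment2 Y : measurable_wrt (F s) Y -> L1 Pr Y ->
  L1 Pr (fun o => Y o * D o ^+ 2).
Proof.
move=> wY lY; have mY := L1_meas lY.
apply/integrableP; split.
  by apply/measurable_EFinP; apply: measurable_funM => //; exact: measurable_funX.
under eq_integral do rewrite /= normrM normrX EFinM.
have mabs : measurable_fun [set: R] (fun x : R => `|x|%:E).
  by apply/measurable_EFinP; exact: normr_measurable.
rewrite (ge0_indep (g := fun x => `|x|%:E) (h := fun x => (`|x|^+2)%:E))//; last first.
  by apply/measurable_EFinP; apply: measurable_funX; exact: normr_measurable.
under [X in (_ * X < _)%E]eq_integral do rewrite real_normK ?num_real//.
have /integrableP[_ a] := lY.
rewrite increment_sqr; apply: lte_mul_pinfty; rewrite ?ltry//.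
  exact: integral_ge0.
by rewrite ge0_fin_numE//; exact: integral_ge0.
Qed.

Let cross (a : R -> R) Y (b1 b2 : R -> R) : measurable_wrt (F s) Y ->
  measurable_fun [set: R] a -> (forall x, 0 <= a x) ->
  measurable_fun [set: R] b1 -> (forall x, 0 <= b1 x) ->
  measurable_fun [set: R] b2 -> (forall x, 0 <= b2 x) ->
  (\int[Pr]_o (b1 (D o))%:E = \int[Pr]_o (b2 (D o))%:E)%E ->
  \int[Pr]_o (a (Y o) * b1 (D o)) = \int[Pr]_o (a (Y o) * b2 (D o)).
Proof.
move=> wY ma a0 m1 h1 m2 h2 e; congr fine.
under eq_integral do rewrite EFinM.
under [RHS]eq_integral do rewrite EFinM.
rewrite (ge0_indep (g := fun x => (a x)%:E) (h := fun x => (b1 x)%:E))//; last 2 first.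
- exact/measurable_EFinP.
- exact/measurable_EFinP.
rewrite (ge0_indep (g := fun x => (a x)%:E) (h := fun x => (b2 x)%:E))//; last 2 first.
- exact/measurable_EFinP.
- exact/measurable_EFinP.
by rewrite e.
Qed.

(** Independence is available for nonnegative functions, so both factors are
    split into positive and negative parts; the four terms cancel in pairs
    because the two parts of a centred Gaussian have the same mean. *)
Lemma mul_increment_mean0 Y : measurable_wrt (F s) Y -> L1 Pr Y ->
  \int[Pr]_o (Y o * D o) = 0.
Proof.
move=> wY lY; have mY := L1_meas lY; have lYD := L1_mul_increment wY lY.
pose p (x : R) := Num.max x 0; pose n (x : R) := Num.max (- x) 0.
have mp : measurable_fun [set: R] p by exact/measurable_EFinP.
have mn : measurable_fun [set: R] n by exact/measurable_EFinP.
have p0 x : 0 <= p x by rewrite le_max lexx orbT.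
have n0 x : 0 <= n x by rewrite le_max lexx orbT.
have lp x : p x <= `|x| by rewrite /p ge_max ler_norm normr_ge0.
have ln x : n x <= `|x| by rewrite /n ge_max -normrN ler_norm normr_ge0.
have L (a b : R -> R) : measurable_fun [set: R] a -> measurable_fun [set: R] b ->
    (forall x, 0 <= a x <= `|x|) -> (forall x, 0 <= b x <= `|x|) ->
    L1 Pr (fun o => a (Y o) * b (D o)).
  move=> ma mb ha hb; apply: L1_le lYD.
    apply: measurable_funM; [exact: (measurableT_comp ma)|exact: (measurableT_comp mb)].
  move=> o; rewrite !normrM.
  have /andP[a0 a1] := ha (Y o); have /andP[b0 b1] := hb (D o).
  by rewrite (ger0_norm a0) (ger0_norm b0); apply: ler_pM.
have hp x : 0 <= p x <= `|x| by rewrite p0 lp.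
have hn x : 0 <= n x <= `|x| by rewrite n0 ln.
rewrite (@eq_int _ _ _ Pr _ (fun o => (p (Y o) * p (D o) - p (Y o) * n (D o))
  - (n (Y o) * p (D o) - n (Y o) * n (D o)))); last first.
  by move=> o; rewrite {1}(pn (Y o)) {1}(pn (D o)) -/(p _) -/(n _) -/(p _) -/(n _); ring.
have i1 := L _ _ mp mp hp hp; have i2 := L _ _ mp mn hp hn.
have i3 := L _ _ mn mp hn hp; have i4 := L _ _ mn mn hn hn.
rewrite RintegralB//; [|exact: (integrableB _ i1 i2)|exact: (integrableB _ i3 i4)].
rewrite !RintegralB//.
rewrite (cross wY mp p0 mp p0 mn n0 Dpn) (cross wY mn n0 mp p0 mn n0 Dpn).
by rewrite !subrr.
Qed.

(** As for mul_increment_mean0, but only Y needs to be split. *)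
Lemma mul_increment_var Y : measurable_wrt (F s) Y -> L1 Pr Y ->
  \int[Pr]_o (Y o * D o ^+ 2) = (t - s) * \int[Pr]_o Y o.
Proof.
move=> wY lY; have mY := L1_meas lY; have lYD := L1_mul_increment2 wY lY.
pose p (x : R) := Num.max x 0; pose n (x : R) := Num.max (- x) 0.
have mp : measurable_fun [set: R] p by exact/measurable_EFinP.
have mn : measurable_fun [set: R] n by exact/measurable_EFinP.
have p0 x : 0 <= p x by rewrite le_max lexx orbT.
have n0 x : 0 <= n x by rewrite le_max lexx orbT.
have lp x : p x <= `|x| by rewrite /p ge_max ler_norm normr_ge0.
have ln x : n x <= `|x| by rewrite /n ge_max -normrN ler_norm normr_ge0.
have key (a : R -> R) : measurable_fun [set: R] a -> (forall x, 0 <= a x) ->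
    (forall x, a x <= `|x|) -> [/\ L1 Pr (fun o => a (Y o)),
     L1 Pr (fun o => a (Y o) * D o ^+ 2) &
     \int[Pr]_o (a (Y o) * D o ^+ 2) = (t - s) * \int[Pr]_o a (Y o)].
  move=> ma a0 a1.
  have la : L1 Pr (fun o => a (Y o)).
    apply: L1_le lY; first exact: (measurableT_comp ma).
    by move=> o; rewrite ger0_norm.
  split => //.
    apply: L1_le lYD.
      apply: measurable_funM; [exact: (measurableT_comp ma)|exact: measurable_funX].
    by move=> o; rewrite !normrM ler_wpM2r// ger0_norm.
  apply/EFin_inj; rewrite EFinM -(fin_L1 la).
  have -> : (\int[Pr]_o (a (Y o) * D o ^+ 2))%:E =
      (\int[Pr]_o ((a (Y o))%:E * (D o ^+ 2)%:E))%E.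
    rewrite -fin_L1//; apply: L1_le lYD.
      apply: measurable_funM; [exact: (measurableT_comp ma)|exact: measurable_funX].
    by move=> o; rewrite !normrM ler_wpM2r// ger0_norm.
  rewrite (ge0_indep (g := fun x => (a x)%:E) (h := fun x => (x ^+ 2)%:E))//.
  - by rewrite increment_sqr muleC.
  - exact/measurable_EFinP.
  - by apply/measurable_EFinP; exact: measurable_funX.
  - by move=> x; rewrite lee_fin sqr_ge0.
have [lp1 lp2 ep] := key p mp p0 lp; have [ln1 ln2 en] := key n mn n0 ln.
rewrite (@eq_int _ _ _ Pr _ (fun o => p (Y o) * D o ^+ 2 - n (Y o) * D o ^+ 2)); last first.
  by move=> o; rewrite {1}(pn (Y o)) mulrBl.
rewrite [in RHS](@eq_int _ _ _ Pr _ (fun o => p (Y o) - n (Y o))); last first.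
  by move=> o; rewrite {1}(pn (Y o)).
by rewrite !RintegralB// ep en mulrBr.
Qed.

End fixed.
End Increments.

(** * The Ito integral *)

Section Tensor.
Context {d d' : measure_display} {T : measurableType d} {T' : measurableType d'}
  {R : realType}.
Variables (P : {sigma_finite_measure set T -> \bar R})
  (mu : {sigma_finite_measure set T' -> \bar R}).

Definition tens (c : T -> R) (g : T' -> R) (p : T * T') := c p.1 * g p.2.

Lemma measurable_tens c g : measurable_fun [set: T] c -> measurable_fun [set: T'] g ->
  measurable_fun [set: T * T'] (tens c g).
Proof.
move=> mc mg; apply: measurable_funM; first exact: (measurableT_comp mc).
exact: (measurableT_comp mg).
Qed.

Lemma L1_tens c g : L1 P c -> L1 mu g -> L1 (P \x mu)%E (tens c g) /\
  \int[(P \x mu)%E]_p tens c g p = (\int[P]_x c x) * (\int[mu]_x g x).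
Proof.
move=> lc lg; have mc := L1_meas lc; have mg := L1_meas lg.
have mt := measurable_tens mc mg.
have lt : L1 (P \x mu)%E (tens c g).
  apply/integrable12ltyP; first exact/measurable_EFinP.
  under eq_integral => x _.
    under eq_integral do rewrite /tens /= normrM EFinM.
    rewrite ge0_integralZl//; last by apply/measurable_EFinP; exact: measurableT_comp.
    over.
  have /integrableP[_ a] := lc; have /integrableP[_ b] := lg.
  rewrite ge0_integralZr//; last 2 first.
  - by apply/measurable_EFinP; exact: measurableT_comp.
  - exact: integral_ge0.
  apply: lte_mul_pinfty => //; first exact: integral_ge0.
  by rewrite ge0_fin_numE//; exact: integral_ge0.
split => //; apply/EFin_inj; rewrite -(fin_L1 lt) EFinM -(fin_L1 lc).
have := integral12_prod_meas1 lt; rewrite /fubini_F /= => <-.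
rewrite -[in RHS]integralZr//; apply: eq_integral => x _.
by rewrite -(fin_L1 lg) -integralZl.
Qed.

Lemma L2_tens c g : L2 P c -> L2 mu g -> L2 (P \x mu)%E (tens c g).
Proof.
move=> [mc lc] [mg lg]; split; first exact: measurable_tens.
have [+ _] := L1_tens lc lg; apply: L1_eq => p.
by rewrite /tens exprMn.
Qed.

Lemma ip_tens c g c' g' : L2 P c -> L2 mu g -> L2 P c' -> L2 mu g' ->
  ip (P \x mu)%E (tens c g) (tens c' g') = ip P c c' * ip mu g g'.
Proof.
move=> lc lg lc' lg'; have [_ <-] := L1_tens (L2M lc lc') (L2M lg lg').
by apply: eq_int => p; rewrite /tens mulrACA.
Qed.

Lemma nrm_tens c g : L2 P c -> L2 mu g ->
  nrm (P \x mu)%E (tens c g) = nrm P c * nrm mu g.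
Proof. by move=> lc lg; rewrite /nrm ip_tens// sqrtrM// ipff_ge0. Qed.

End Tensor.

Section Wrt.
Context {d : measure_display} {Omega : measurableType d} {R : realType}.
Variable G : set (set Omega).
Hypothesis sG : sigma_algebra setT G.

Lemma wrtP (f : Omega -> R) : measurable_wrt G f <->
  @measurable_fun _ _ (g_sigma_algebraType G) R setT f.
Proof.
have GE : <<s G >> = G by exact: sigma_algebra_id.
split=> [mf _ U mU|mf U mU].
  by rewrite setTI /measurable/= GE; exact: mf.
by have := mf measurableT U mU; rewrite setTI /measurable/= GE.
Qed.

Lemma wrtM (f g : Omega -> R) : measurable_wrt G f -> measurable_wrt G g ->
  measurable_wrt G (fun o => f o * g o).
Proof. by rewrite !wrtP; exact: measurable_funM. Qed.

Lemma wrtD (f g : Omega -> R) : measurable_wrt G f -> measurable_wrt G g ->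
  measurable_wrt G (fun o => f o + g o).
Proof. by rewrite !wrtP; exact: measurable_funD. Qed.

Lemma wrtB (f g : Omega -> R) : measurable_wrt G f -> measurable_wrt G g ->
  measurable_wrt G (fun o => f o - g o).
Proof. by rewrite !wrtP; exact: measurable_funB. Qed.

Lemma wrt_cst (c : R) : measurable_wrt G (fun=> c).
Proof. by rewrite wrtP; exact: measurable_cst. Qed.

Lemma wrt_sum (I : Type) (s : seq I) (f : I -> Omega -> R) :
  (forall i, measurable_wrt G (f i)) ->
  measurable_wrt G (fun o => \sum_(i <- s) f i o).
Proof. by move=> mf; rewrite wrtP; apply: measurable_sum => i; exact/wrtP. Qed.

Lemma wrt_limfun (f : nat -> Omega -> R) : (forall j, measurable_wrt G (f j)) ->
  measurable_wrt G (limfun f).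
Proof.
move=> mf; rewrite wrtP; apply: (@measurable_limfun _ (g_sigma_algebraType G)) => j.
exact/wrtP.
Qed.

End Wrt.

Section Telescope.
Context {R : realType}.

(** An increment of f over [a, b] refined along a grid p containing both ends.
    The sum runs over the whole grid with indicator coefficients, so that
    increments over different intervals become sums with the same range. It is
    used for the Wiener process and for indicators of intervals alike. *)
Lemma telescope_between (p : seq R) (f : R -> R) (a b : R) :
  sorted <%R p -> a \in p -> b \in p -> a <= b ->
  f b - f a = \sum_(k < (size p).-1)
    (((a <= p`_k) && (p`_k.+1 <= b))%:R * (f p`_k.+1 - f p`_k)).
Proof.
move=> sp ap bp ab.
set i := index a p; set j := index b p.
have ip : (i < size p)%N by rewrite index_mem.
have jp : (j < size p)%N by rewrite index_mem.
have ai : p`_i = a by rewrite nth_index.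
have bj : p`_j = b by rewrite nth_index.
have nthE k l : (k < size p)%N -> (l < size p)%N -> (p`_k <= p`_l) = (k <= l)%N.
  by move=> kp lp; rewrite (lt_sorted_leq_nth 0 sp)//.
have ij : (i <= j)%N by rewrite -nthE// ai bj.
have -> : f b - f a = \sum_(i <= k < j) (f p`_k.+1 - f p`_k).
  by rewrite telescope_sumr// ai bj.
rewrite -(big_mkord xpredT (fun k => ((a <= p`_k) && (p`_k.+1 <= b))%:R * (f p`_k.+1 - f p`_k))).
have jp' : (j <= (size p).-1)%N by rewrite -ltnS prednK// (leq_ltn_trans _ jp).
rewrite [RHS](big_cat_nat (leq0n i) (leq_trans ij jp'))/=.
rewrite [X in _ = _ + X](big_cat_nat ij jp')/=.
have kp k : (k < (size p).-1)%N -> (k.+1 < size p)%N.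
  by move=> h; rewrite -(prednK (leq_ltn_trans (leq0n _) jp)) ltnS.
rewrite [X in _ = X + _]big_nat_cond [X in _ = X + _]big1 ?add0r; last first.
  move=> k /andP[/andP[_ ki] _]; rewrite -ai nthE//; last by apply: ltn_trans ip.
  by rewrite leqNgt ki mul0r.
rewrite [X in _ = _ + X]big_nat_cond [X in _ = _ + X]big1 ?addr0; last first.
  move=> k /andP[/andP[jk ks] _]; rewrite -bj [X in _ && X]nthE//; last exact: kp.
  by rewrite ltnNge jk andbF mul0r.
apply: eq_big_nat => k /andP[ik kj].
have ks : (k.+1 < size p)%N by apply: leq_ltn_trans jp.
by rewrite -ai -bj !nthE// ?ik ?kj ?mul1r// ltnW.
Qed.

Lemma grid_lt (p : seq R) k : sorted <%R p -> (k.+1 < size p)%N -> p`_k < p`_k.+1.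
Proof.
by move=> sp kp; rewrite (lt_sorted_ltn_nth 0 sp)// inE ltnW.
Qed.

End Telescope.

Lemma nrm_le_int {d : measure_display} {T : measurableType d} {R : realType}
  (mu : {measure set T -> \bar R}) (f : T -> R) (eps : R) :
  L2 mu f -> 0 <= eps -> (\int[mu]_x ((f x) ^+ 2)%:E <= (eps ^+ 2)%:E)%E ->
  nrm mu f <= eps.
Proof.
move=> lf eps0; rewrite nrm2E// lee_fin ler_sqr ?nnegrE//; exact: nrm_ge0.
Qed.

Section IntervalIndicator.
Context {R : realType}.
Notation mu := (@lebesgue_measure R).

Definition itvf (a b : R) : measurableTypeR R -> R :=
  \1_(`[a, b[%classic : set (measurableTypeR R)).

Lemma itvfE a b (s : R) : itvf a b s = ((a <= s) && (s < b))%:R.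
Proof. by rewrite /itvf indicE mem_setE in_itv. Qed.

Lemma norm_mul_itvf a b (x s : R) : `|x * itvf a b s| <= `|x|.
Proof.
by rewrite normrM ler_piMr// itvfE; case: (_ && _); rewrite ?normr1 ?normr0.
Qed.

Lemma itvf_increment a b (s : R) : a <= b ->
  itvf a b s = (s < b)%R%:R - (s < a)%R%:R.
Proof.
move=> ab; rewrite itvfE; case: (leP a s) => [as_|sa] /=; first by rewrite subr0.
by rewrite (lt_le_trans sa ab) subrr.
Qed.

Lemma measurable_itvf a b : measurable_fun [set: measurableTypeR R] (itvf a b).
Proof. by apply: measurable_indic; exact: measurable_itv. Qed.

Lemma int_itvf a b : a <= b -> L1 mu (itvf a b) /\ \int[mu]_s itvf a b s = b - a.
Proof.
move=> ab.
have e : (\int[mu]_s (itvf a b s)%:E = (b - a)%:E)%E.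
  have mI : measurable (`[a, b[%classic : set (measurableTypeR R)) by exact: measurable_itv.
  rewrite /itvf integral_indic//.
  rewrite setIT; apply: etrans (lebesgue_measure_itv _) _; rewrite /= lte_fin.
  by case: ltP => [_|ba]; rewrite ?EFinB//; congr EFin; lra.
split; last by rewrite /Rintegral e.
apply/integrableP; split; first by apply/measurable_EFinP; exact: measurable_itvf.
rewrite (eq_integral (fun s => (itvf a b s)%:E)) ?e ?ltry// => s _.
by rewrite /= ger0_norm// itvfE.
Qed.

Lemma itvf_sqr a b (s : R) : itvf a b s ^+ 2 = itvf a b s.
Proof. by rewrite itvfE; case: (_ && _); rewrite ?expr1n// expr0n. Qed.

Lemma L2_itvf a b : L2 mu (itvf a b).
Proof.
split; first exact: measurable_itvf.
have [ab|ba] := leP a b.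
  by apply: L1_eq (int_itvf ab).1 => s; rewrite itvf_sqr.
apply: L1_eq (L1_0 mu) => s; rewrite itvf_sqr itvfE.
by case: (leP a s) => //= h; rewrite ltNge (le_trans (ltW ba) h).
Qed.

Lemma L1_itvf (f : measurableTypeR R -> R) a b : L1 mu f ->
  L1 mu (fun s => f s * itvf a b s).
Proof.
move=> lf; apply: L1_le (lf) => [|s]; last exact: norm_mul_itvf.
by apply: measurable_funM; [exact: L1_meas lf|exact: measurable_itvf].
Qed.

Lemma L2_itvfM (f : measurableTypeR R -> R) a b : L2 mu f ->
  L2 mu (fun s => f s * itvf a b s) /\ nrm mu (fun s => f s * itvf a b s) <= nrm mu f.
Proof.
move=> lf; have l : L2 mu (fun s => f s * itvf a b s).
  apply: L2_le (lf) => [|s]; last exact: norm_mul_itvf.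
  by apply: measurable_funM; [exact: L2_meas lf|exact: measurable_itvf].
by split => //; apply: nrm_mono => // s; exact: norm_mul_itvf.
Qed.

Lemma ip_itvf a b : a <= b -> ip mu (itvf a b) (itvf a b) = b - a.
Proof.
by move=> /int_itvf[_ <-]; apply: eq_int => s; rewrite -expr2 itvf_sqr.
Qed.

Lemma ip_itvf0 a b a' b' : b <= a' -> ip mu (itvf a b) (itvf a' b') = 0.
Proof.
move=> ba; rewrite /ip (@eq_int _ _ _ mu _ (fun=> 0)).
  by rewrite Rintegral_cst// mul0r.
move=> s; rewrite !itvfE; case: (ltP s b) => [sb|]; last by rewrite andbF mul0r.
by rewrite (leNgt a') (lt_le_trans sb ba) mulr0.
Qed.

End IntervalIndicator.

Section Elementary.
Context {d : measure_display} {Omega : measurableType d} {R : realType}.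
Variable Pr : probability Omega R.
Variable F : R -> set (set Omega).
Variable w : R -> Omega -> R.
Hypothesis hw : wiener_process Pr F w.
Notation mu := (@lebesgue_measure R).
Notation Pi := (Pr \x mu)%E.
Notation process := ((Omega * measurableTypeR R)%type -> R).

(** Elementary integrands, indexed together with their stochastic integral. The
    intervals may overlap, which makes stability under sums immediate; the price
    is that the integral is not obviously a function of the integrand, which
    elem_isometry repairs. Integrands live on Omega * R, so that one product
    measure serves for all horizons. *)
Inductive elem (a T : R) : process -> (Omega -> R) -> Prop :=
| elem_nil : elem a T (fun=> 0) (fun=> 0)
| elem_cons s t c S I : a <= s -> s <= t -> t <= T ->
    measurable_wrt (F s) c -> L2 Pr c -> elem a T S I ->
    elem a T (fun p => S p + tens c (itvf s t) p)
             (fun o => I o + c o * increment w s t o).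

Lemma sF t : 0 <= t -> sigma_algebra setT (F t).
Proof. exact: (filtration_sigma (wiener_filtration hw)). Qed.

Lemma wrt_mono s t (f : Omega -> R) : 0 <= s -> s <= t ->
  measurable_wrt (F s) f -> measurable_wrt (F t) f.
Proof.
move=> s0 st wf U mU; apply: (filtration_mono (wiener_filtration hw) s0 st).
exact: wf.
Qed.

Lemma wrt_increment s t : 0 <= s -> s <= t -> measurable_wrt (F t) (increment w s t).
Proof.
move=> s0 st; have t0 := le_trans s0 st; apply: wrtB; first exact: sF.
  exact: wiener_adapted hw _ t0.
by apply: (wrt_mono s0 st); exact: wiener_adapted hw _ s0.
Qed.

Lemma elem_widen a T a' T' S I : a' <= a -> T <= T' -> elem a T S I -> elem a' T' S I.
Proof.
move=> aa TT; elim=> [|s t c S' I' *]; first exact: elem_nil.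
by apply: elem_cons => //; [exact: le_trans aa _|exact: le_trans TT].
Qed.

Lemma elem_add a T S I S' I' : elem a T S I -> elem a T S' I' ->
  elem a T (fun p => S p + S' p) (fun o => I o + I' o).
Proof.
move=> e; elim=> [|s t c S1 I1 *].
  have -> : (fun p => S p + 0) = S by apply/funext => p; rewrite addr0.
  by have -> : (fun p => I p + 0) = I by apply/funext => p; rewrite addr0.
under eq_fun do rewrite addrA; under [X in elem _ _ _ X]eq_fun do rewrite addrA.
exact: elem_cons.
Qed.

Lemma elem_scale a T k S I : 0 <= a -> elem a T S I ->
  elem a T (fun p => k * S p) (fun o => k * I o).
Proof.
move=> a0; elim=> [|s t c S1 I1 as_ st tT wc lc e1 ih].
  under eq_fun do rewrite mulr0; under [X in elem _ _ _ X]eq_fun do rewrite mulr0.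
  exact: elem_nil.
have -> : (fun p => k * (S1 p + tens c (itvf s t) p)) =
    (fun p => k * S1 p + tens (fun o => k * c o) (itvf s t) p).
  by apply/funext => p; rewrite /tens; ring.
have -> : (fun o => k * (I1 o + c o * increment w s t o)) =
    (fun o => k * I1 o + (k * c o) * increment w s t o).
  by apply/funext => o; ring.
apply: elem_cons => //; last exact: L2Z.
have sFs := sF (le_trans a0 as_).
by apply: wrtM => //; exact: wrt_cst.
Qed.

Lemma elem_sub a T S I S' I' : 0 <= a -> elem a T S I -> elem a T S' I' ->
  elem a T (fun p => S p - S' p) (fun o => I o - I' o).
Proof.
move=> a0 e e'; have := elem_add e (elem_scale (-1) a0 e').
under eq_fun do rewrite mulN1r; under [X in elem _ _ _ X]eq_fun do rewrite mulN1r.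
by [].
Qed.

Definition grid (a T : R) (p : seq R) :=
  sorted <%R p /\ {in p, forall x, a <= x <= T}.

(** On every grid containing the end points of its intervals an elementary
    integrand regroups on the disjoint cells of the grid. The coefficient of a
    cell is known at its left end, since it only collects intervals that start
    no later. *)
Lemma elem_grid a T S I : 0 <= a -> elem a T S I ->
  exists2 p0 : seq R, {in p0, forall x, a <= x <= T} &
  forall p, grid a T p -> {subset p0 <= p} ->
  exists c : nat -> Omega -> R,
  [/\ forall k, (k.+1 < size p)%N -> measurable_wrt (F p`_k) (c k) /\ L2 Pr (c k),
      S = (fun q => \sum_(k < (size p).-1) tens (c k) (itvf p`_k p`_k.+1) q) &
      I = (fun o => \sum_(k < (size p).-1) c k o * increment w p`_k p`_k.+1 o)].
Proof.
move=> a0; elim=> [|s t c S1 I1 as_ st tT wc lc e1 [p1 p1T ih]].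
  exists [::] => // p cp _; exists (fun _ _ => 0); split.
  - move=> k kp; split; last exact: L2_0.
    apply: wrt_cst; apply: sF.
    have /andP[+ _] := cp.2 p`_k (mem_nth _ (ltnW kp)); exact: le_trans.
  - by apply/funext => q; rewrite big1// => k _; rewrite /tens mul0r.
  - by apply/funext => q; rewrite big1// => k _; rewrite mul0r.
exists [:: s, t & p1].
  move=> x; rewrite !inE => /or3P[/eqP->|/eqP->|]; last exact: p1T.
    by rewrite as_ (le_trans st tT).
  by rewrite tT (le_trans as_ st).
move=> p cp sub.
have sp : s \in p by apply: sub; rewrite inE eqxx.
have tp : t \in p by apply: sub; rewrite !inE eqxx orbT.
have [c1 [c1w -> ->]] : exists c : nat -> Omega -> R,
  [/\ forall k, (k.+1 < size p)%N -> measurable_wrt (F p`_k) (c k) /\ L2 Pr (c k),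
      S1 = (fun q => \sum_(k < (size p).-1) tens (c k) (itvf p`_k p`_k.+1) q) &
      I1 = (fun o => \sum_(k < (size p).-1) c k o * increment w p`_k p`_k.+1 o)].
  by apply: ih => // x xp; apply: sub; rewrite !inE xp !orbT.
exists (fun k o => c1 k o + ((s <= p`_k) && (p`_k.+1 <= t))%:R * c o); split.
- move=> k kp; have [w1 l1] := c1w k kp.
  split; last by apply: L2D => //; exact: L2Z.
  have pk0 : 0 <= p`_k.
    by have /andP[+ _] := cp.2 p`_k (mem_nth _ (ltnW kp)); exact: le_trans.
  have sFs := sF pk0.
  apply: wrtD => //; case: (leP s p`_k) => [spk|] /=.
    apply: wrtM => //; first exact: wrt_cst.
    by apply: wrt_mono spk wc; exact: le_trans as_.
  by move=> _; under eq_fun do rewrite mul0r; exact: wrt_cst.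
- apply/funext => q; rewrite [tens c _ _]/tens itvf_increment//.
  rewrite (telescope_between (fun b => ((q.2 : R) < b)%R%:R) cp.1 sp tp st).
  rewrite mulr_sumr -big_split/=; apply: eq_bigr => k _.
  rewrite /tens itvf_increment; first by ring.
  by apply/ltW/grid_lt; [exact: cp.1|rewrite -ltn_predRL].
- apply/funext => o.
  have -> : increment w s t o = w t o - w s o by [].
  rewrite (telescope_between (fun b => w b o) cp.1 sp tp st).
  rewrite mulr_sumr -big_split/=; apply: eq_bigr => k _.
  by rewrite /increment; ring.
Qed.

Lemma elem_on_grid a T S I : 0 <= a -> elem a T S I ->
  exists p (c : nat -> Omega -> R), grid a T p /\
  [/\ forall k, (k.+1 < size p)%N -> measurable_wrt (F p`_k) (c k) /\ L2 Pr (c k),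
      S = (fun q => \sum_(k < (size p).-1) tens (c k) (itvf p`_k p`_k.+1) q) &
      I = (fun o => \sum_(k < (size p).-1) c k o * increment w p`_k p`_k.+1 o)].
Proof.
move=> a0 /(elem_grid a0)[p0 p0T h].
have mp x : (x \in sort <=%R (undup p0)) = (x \in p0) by rewrite mem_sort mem_undup.
have cp : grid a T (sort <=%R (undup p0)).
  split; first by rewrite sort_lt_sorted undup_uniq.
  by move=> x; rewrite mp; exact: p0T.
have [|c hc] := h _ cp; first by move=> x; rewrite mp.
by exists (sort <=%R (undup p0)), c.
Qed.

Lemma elem_simple a T S I : 0 <= a -> elem a T S I ->
  exists2 SP, simple_adapted Pr F T SP &
    (forall s o, simple_val SP s o = S (o, s)) /\ (forall o, simple_int w SP o = I o).
Proof.
move=> a0 /(elem_on_grid a0)[p [c [cp [wc -> ->]]]].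
exists (SimpleProcess (size p).-1 (fun k => p`_k) c) => //.
move=> k /=; rewrite ltn_predRL => kp; have [wk lk] := wc k kp.
have /andP[ak kT] := cp.2 _ (mem_nth 0 (ltnW kp)).
have /andP[ak1 kT1] := cp.2 _ (mem_nth 0 kp).
split => //; first exact: le_trans ak.
  by apply/ltW/grid_lt => //; exact: cp.1.
exact: L2_lty.
Qed.

Lemma simple_elem T SP : 0 <= T -> simple_adapted Pr F T SP ->
  elem 0 T (fun p => simple_val SP p.2 p.1) (simple_int w SP).
Proof.
case: SP => n t c T0 /= ad.
rewrite /simple_val /simple_int /=.
suff h k : (k <= n)%N -> elem 0 T
    (fun p => \sum_(i < k) c i p.1 * \1_(`[t i, t i.+1[) p.2)
    (fun o => \sum_(i < k) c i o * increment w (t i) (t i.+1) o) by exact: h.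
elim: k => [_|k ih kn].
  under eq_fun do rewrite big_ord0.
  by under [X in elem _ _ _ X]eq_fun do rewrite big_ord0; exact: elem_nil.
under eq_fun do rewrite big_ord_recr /=.
under [X in elem _ _ _ X]eq_fun do rewrite big_ord_recr /=.
have [/= tk0 tk1 tkT wc lc] := ad k kn.
apply: elem_cons => //; last by apply: ih; exact: ltnW.
by apply: L2P => //; exact: (wrt_measurable hw tk0).
Qed.

Lemma L2_mul_increment s t c : 0 <= s -> s < t -> measurable_wrt (F s) c -> L2 Pr c ->
  L2 Pr (fun o => c o * increment w s t o).
Proof.
move=> s0 st wc [mc lc]; have mD := measurable_increment hw s0 (ltW st).
split; first exact: measurable_funM.
have := L1_mul_increment2 hw s0 st (wrtM (sF s0) wc wc) lc.
by apply: L1_eq => o; ring.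
Qed.

Section isometry.
Variables (a T : R) (S : process) (I : Omega -> R).
Hypotheses (a0 : 0 <= a) (e : elem a T S I).

(** On a grid, two different cells contribute nothing: the later increment is
    centred and independent of the other factors. The same cell contributes the
    second moment of the coefficient times the length of the cell. *)
Lemma elem_isometry : [/\ L2 Pi S, L2 Pr I & nrm Pi S = nrm Pr I].
Proof.
have [p [c [cp [wc -> ->]]]] := elem_on_grid a0 e.
set n := (size p).-1.
have kp k : (k < n)%N -> (k.+1 < size p)%N by rewrite -ltn_predRL.
have pk0 k : (k < n)%N -> 0 <= p`_k.
  move=> kn; have /andP[+ _] := cp.2 _ (mem_nth 0 (ltnW (kp _ kn))).
  exact: le_trans.
have pk1 k : (k < n)%N -> p`_k < p`_k.+1.
  by move=> kn; apply: grid_lt; [exact: cp.1|exact: kp].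
have lS (k : 'I_n) : L2 Pi (tens (c k) (itvf p`_k p`_k.+1)).
  by apply: L2_tens; [exact: (wc k (kp k _)).2|exact: L2_itvf].
have lI (k : 'I_n) : L2 Pr (fun o => c k o * increment w p`_k p`_k.+1 o).
  have [w1 l1] := wc k (kp k (ltn_ord k)).
  by apply: L2_mul_increment => //; [exact: pk0|exact: pk1].
split; [by apply: L2_sum|by apply: L2_sum|].
congr Num.sqrt; rewrite !ip_suml//; last 2 first.
- by apply: L2_sum.
- by apply: L2_sum.
apply: eq_bigr => k _; rewrite !ip_sumr//; apply: eq_bigr => l _.
have [wk lk] := wc k (kp k (ltn_ord k)).
have [wl ll] := wc l (kp l (ltn_ord l)).
rewrite ip_tens//; [|exact: L2_itvf|exact: L2_itvf].
have ord i j : (i < j)%N -> (j < n)%N -> p`_i.+1 <= p`_j.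
  move=> ij jn; have jp := ltnW (kp j jn).
  by rewrite (lt_sorted_leq_nth 0 cp.1)// inE// (leq_ltn_trans ij).
have cross i j : (i < j)%N -> (j < n)%N ->
    ip Pr (fun o => c i o * increment w p`_i p`_i.+1 o)
          (fun o => c j o * increment w p`_j p`_j.+1 o) = 0.
  move=> ij jn; have jn0 := ltn_trans ij jn.
  have [wi li] := wc i (kp i jn0); have [wj lj] := wc j (kp j jn).
  have ijp := ord i j ij jn.
  have pp := pk1 i jn0.
  have wI : measurable_wrt (F p`_j) (fun o => c i o * increment w p`_i p`_i.+1 o * c j o).
    apply: wrtM => //; first exact: sF (pk0 _ jn).
    apply: wrtM; first exact: sF (pk0 _ jn).
      by apply: wrt_mono wi; [exact: pk0|exact: le_trans (ltW pp) ijp].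
    apply: wrt_mono ijp _; first by apply: ltW; exact: le_lt_trans (pk0 i jn0) pp.
    by apply: wrt_increment; [exact: pk0|exact: ltW].
  rewrite -[RHS](mul_increment_mean0 hw (pk0 j jn) (pk1 j jn) wI).
    by apply: eq_int => o; ring.
  by apply: L2M => //; exact: (lI (Ordinal jn0)).
have [lek|ltk|eqk] := ltngtP k l.
- by rewrite ip_itvf0 ?mulr0 ?cross//; exact: ord.
- by rewrite ipC [ip mu _ _]ipC ip_itvf0 ?mulr0 1?ipC ?cross//; exact: ord.
- rewrite -eqk ip_itvf; last by apply/ltW/pk1.
  rewrite mulrC -(mul_increment_var hw (pk0 k _) (pk1 k _))//.
  + by rewrite /ip; apply: eq_int => o; ring.
  + by apply: wrtM => //; exact: sF (pk0 _ _).
  + exact: L2M.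
Qed.

End isometry.

(** A variable known at time a is known at the start of every interval, so the
    centred increments are independent of it. *)
Lemma elem_mean0 a T S I c : 0 <= a -> elem a T S I -> measurable_wrt (F a) c ->
  L2 Pr c -> ip Pr c I = 0.
Proof.
move=> a0 e wc lc; elim: e => [|s t c1 S1 I1 as_ st tT wc1 lc1 e1 ih].
  by rewrite /ip (@eq_int _ _ _ Pr _ (fun=> 0)) ?Rintegral_cst ?mul0r// => x; rewrite mulr0.
have s0 := le_trans a0 as_; have [_ lI1 _] := elem_isometry a0 e1.
move: st; rewrite le_eqVlt => /predU1P[<-|st].
  by rewrite -[RHS]ih; congr (ip Pr c _); apply/funext => o; rewrite /increment subrr mulr0 addr0.
rewrite ipDr//; last exact: L2_mul_increment.
rewrite ih add0r; have wcc : measurable_wrt (F s) (fun o => c o * c1 o).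
  by apply: wrtM => //; [exact: sF|exact: wrt_mono wc].
rewrite -[RHS](mul_increment_mean0 hw s0 st wcc (L2M lc lc1)).
by apply: eq_int => o; ring.
Qed.

Lemma elem_supp a T S I p : elem a T S I -> S p * itvf a T p.2 = S p.
Proof.
elim=> [|s t c S1 I1 as_ st tT wc lc e1 ih]; first by rewrite mul0r.
rewrite mulrDl ih /tens -mulrA; congr (_ + _ * _).
rewrite !itvfE; case: (leP s p.2) => //= [sp|_]; last by rewrite mul0r.
case: (ltP p.2 t) => /= [pt|_]; last by rewrite mul0r.
by rewrite (le_trans as_ sp) (lt_le_trans pt tT) mulr1.
Qed.

(** The closure of elem in L2, phrased by approximation within every eps; no
    approximating sequence has to be chosen until the very end. *)
Definition ito (a T : R) (H : process) (I : Omega -> R) : Prop :=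
  [/\ L2 Pi H, L2 Pr I & forall eps, 0 < eps -> exists S I',
    [/\ elem a T S I', nrm Pi (fun p => H p - S p) <= eps &
        nrm Pr (fun o => I o - I' o) <= eps]].

Section itotheory.
Variables (a : R).
Hypothesis a0 : 0 <= a.

Lemma ito_elem T S I : elem a T S I -> ito a T S I.
Proof.
move=> e; have [lS lI _] := elem_isometry a0 e; split => // eps eps0.
exists S, I; split => //.
  by rewrite (@nrm_eq _ _ _ Pi _ (fun=> 0)) ?nrm_0 ?ltW// => p; rewrite subrr.
by rewrite (@nrm_eq _ _ _ Pr _ (fun=> 0)) ?nrm_0 ?ltW// => p; rewrite subrr.
Qed.

Lemma ito_limit T H I : L2 Pi H -> L2 Pr I ->
  (forall eps, 0 < eps -> exists H' I', [/\ ito a T H' I',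
     nrm Pi (fun p => H p - H' p) <= eps & nrm Pr (fun o => I o - I' o) <= eps]) ->
  ito a T H I.
Proof.
move=> lH lI h; split => // eps eps0.
have e2 : 0 < eps / 2 by rewrite divr_gt0.
have [H' [I' [[lH' lI' h'] HH' II']]] := h _ e2.
have [S [J [e HS IJ]]] := h' _ e2; have [lS lJ _] := elem_isometry a0 e.
exists S, J; split => //; rewrite (splitr eps).
  by apply: le_trans (nrmB_le lH lH' lS) _; exact: lerD.
by apply: le_trans (nrmB_le lI lI' lJ) _; exact: lerD.
Qed.

Lemma ito_add T H I H' I' : ito a T H I -> ito a T H' I' ->
  ito a T (fun p => H p + H' p) (fun o => I o + I' o).
Proof.
move=> [lH lI h] [lH' lI' h']; split; [exact: L2D|exact: L2D|move=> eps eps0].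
have e2 : 0 < eps / 2 by rewrite divr_gt0.
have [S [J [e HS IJ]]] := h _ e2; have [S' [J' [e' HS' IJ']]] := h' _ e2.
have [lS lJ _] := elem_isometry a0 e; have [lS' lJ' _] := elem_isometry a0 e'.
exists (fun p => S p + S' p), (fun o => J o + J' o); split.
- exact: elem_add.
- rewrite (@nrm_eq _ _ _ Pi _ (fun p => (H p - S p) + (H' p - S' p))); last by move=> p; ring.
  rewrite (splitr eps); apply: le_trans (nrmD (L2B lH lS) (L2B lH' lS')) _.
  exact: lerD.
- rewrite (@nrm_eq _ _ _ Pr _ (fun p => (I p - J p) + (I' p - J' p))); last by move=> p; ring.
  rewrite (splitr eps); apply: le_trans (nrmD (L2B lI lJ) (L2B lI' lJ')) _.
  exact: lerD.
Qed.

Lemma ito_scale T k H I : ito a T H I -> ito a T (fun p => k * H p) (fun o => k * I o).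
Proof.
move=> [lH lI h]; split; [exact: L2Z|exact: L2Z|move=> eps eps0].
have k0 : 0 < `|k| + 1 by rewrite ltr_wpDl.
have e2 : 0 < eps / (`|k| + 1) by rewrite divr_gt0.
have [S [J [e HS IJ]]] := h _ e2; have [lS lJ _] := elem_isometry a0 e.
have kk x : 0 <= x -> x <= eps / (`|k| + 1) -> `|k| * x <= eps.
  move=> x0 xe; apply: (@le_trans _ _ ((`|k| + 1) * x)).
    by rewrite ler_wpM2r// lerDl.
  by rewrite mulrC -ler_pdivlMr.
exists (fun p => k * S p), (fun o => k * J o); split.
- exact: elem_scale.
- rewrite (@nrm_eq _ _ _ Pi _ (fun p => k * (H p - S p))); last by move=> p; ring.
  by rewrite nrmZ; [apply: kk => //; exact: nrm_ge0|exact: L2B].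
- rewrite (@nrm_eq _ _ _ Pr _ (fun p => k * (I p - J p))); last by move=> p; ring.
  by rewrite nrmZ; [apply: kk => //; exact: nrm_ge0|exact: L2B].
Qed.

Lemma ito_sub T H I H' I' : ito a T H I -> ito a T H' I' ->
  ito a T (fun p => H p - H' p) (fun o => I o - I' o).
Proof.
move=> h /(ito_scale (-1)) h'; have := ito_add h h'.
under eq_fun do rewrite mulN1r.
by under [X in ito _ _ _ X]eq_fun do rewrite mulN1r.
Qed.

Lemma ito_sum T (J : Type) (s : seq J) (H : J -> process) (I : J -> Omega -> R) :
  (forall j, ito a T (H j) (I j)) ->
  ito a T (fun p => \sum_(j <- s) H j p) (fun o => \sum_(j <- s) I j o).
Proof.
move=> h; elim: s => [|j s ih].
  under eq_fun do rewrite big_nil.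
  by under [X in ito _ _ _ X]eq_fun do rewrite big_nil; apply: ito_elem; exact: elem_nil.
under eq_fun do rewrite big_cons.
by under [X in ito _ _ _ X]eq_fun do rewrite big_cons; apply: ito_add.
Qed.

(** Both norms are within eps of those of an elementary pair, where they are
    equal. *)
Lemma ito_isometry T H I : ito a T H I -> nrm Pi H = nrm Pr I.
Proof.
move=> [lH lI h]; apply/eqP; rewrite -subr_eq0 -normr_le0.
apply/ler_addgt0Pr => eps eps0; rewrite add0r.
have e2 : 0 < eps / 2 by rewrite divr_gt0.
have [S [J [e HS IJ]]] := h _ e2; have [lS lJ SJ] := elem_isometry a0 e.
have h1 := nrm_le lH lS; have h2 := nrm_le lS lH; rewrite nrmBC in h2.
have h3 := nrm_le lI lJ; have h4 := nrm_le lJ lI; rewrite nrmBC in h4.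
by rewrite ler_norml; apply/andP; split; lra.
Qed.

(** Polarization of the isometry applied to the sum and to the difference. *)
Lemma ito_ip T H I H' I' : ito a T H I -> ito a T H' I' -> ip Pi H H' = ip Pr I I'.
Proof.
move=> h h'; have := ito_isometry (ito_add h h').
have [lH lI _] := h; have [lH' lI' _] := h'.
move/(congr1 (fun x => x ^+ 2)); rewrite !nrm2.
rewrite !ipDl ?ipDr//; try exact: L2D.
have := ito_isometry h; have := ito_isometry h'.
move=> /(congr1 (fun x => x ^+ 2)) + /(congr1 (fun x => x ^+ 2)); rewrite !nrm2.
by rewrite [ip Pi H' H]ipC [ip Pr I' I]ipC; lra.
Qed.

Lemma ito_unique T H I H' I' : ito a T H I -> ito a T H' I' ->
  nrm Pi (fun p => H p - H' p) = 0 -> {ae Pr, forall o, I o = I' o}.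
Proof.
move=> h h' e; have hh := ito_sub h h'.
have [_ lI _] := h; have [_ lI' _] := h'.
have := nrm0_ae (L2B lI lI'); rewrite -(ito_isometry hh) => /(_ e).
by apply: filterS => o /eqP; rewrite subr_eq0 => /eqP.
Qed.

(** By elem_mean0 and the Cauchy-Schwarz inequality the inner product is smaller
    than every positive number. *)
Lemma ito_mean0 T H I c : ito a T H I -> measurable_wrt (F a) c -> L2 Pr c ->
  ip Pr c I = 0.
Proof.
move=> [lH lI h] wc lc; apply/eqP; rewrite -normr_le0.
apply/ler_addgt0Pr => eps eps0; rewrite add0r.
have k0 : 0 < nrm Pr c + 1 by rewrite ltr_wpDl// nrm_ge0.
have e2 : 0 < eps / (nrm Pr c + 1) by rewrite divr_gt0.
have [S [J [e HS IJ]]] := h _ e2; have [lS lJ SJ] := elem_isometry a0 e.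
have E : ip Pr c I = ip Pr c (fun o => I o - J o).
  by rewrite ipBr// (elem_mean0 a0 e)// subr0.
have b : nrm Pr c * nrm Pr (fun o => I o - J o) <= eps.
  apply: (@le_trans _ _ ((nrm Pr c + 1) * nrm Pr (fun o => I o - J o))).
    by rewrite ler_wpM2r ?nrm_ge0// lerDl.
  by rewrite mulrC -ler_pdivlMr.
have lIJ := L2B lI lJ.
rewrite ler_norml; apply/andP; split; rewrite E; last first.
  exact: le_trans (cauchy_schwarz lc lIJ) b.
rewrite lerNl -mulN1r -ipZr//; apply: le_trans (cauchy_schwarz lc (L2Z (-1) lIJ)) _.
by rewrite nrmZ// normrN1 mul1r.
Qed.

End itotheory.

Lemma ito_widen a T a' T' H I : a' <= a -> T <= T' -> ito a T H I -> ito a' T' H I.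
Proof.
move=> aa TT [lH lI h]; split => // eps /h[S [J [e HS IJ]]].
by exists S, J; split => //; exact: elem_widen e.
Qed.

(** Integrands for ito are functions on all of Omega * R; this one agrees with H
    before T and vanishes outside [0, T[. *)
Definition cut (T : R) (H : R -> Omega -> R) : process :=
  fun p => H p.2 p.1 * itvf 0 T p.2.

Lemma measurable_cut T (H : R -> Omega -> R) :
  measurable_fun ((`[0, T[ : set (measurableTypeR R)) `*` setT)
        (fun p : measurableTypeR R * Omega => H p.1 p.2) ->
  measurable_fun [set: (Omega * measurableTypeR R)%type] (cut T H).
Proof.
have mI : measurable (`[0, T[%classic : set (measurableTypeR R)) by exact: measurable_itv.
move=> /(measurable_restrictT _ (measurableX mI measurableT)).1 mH.
have := measurableT_comp mH (@measurable_swap _ _ Omega (measurableTypeR R)).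
congr (measurable_fun _ _); apply/funext => -[x s] /=.
rewrite /cut patchE itvfE /=; case: ifPn => [|].
  by rewrite inE/= => -[+ _]; rewrite in_itv/= => ->; rewrite mulr1.
rewrite notin_setE/= in_itv/=; case: (_ && _) => [[]//|_].
by rewrite mulr0.
Qed.

Lemma nested_int (G : process) : measurable_fun [set: (Omega * measurableTypeR R)%type] G ->
  (\int[Pr]_o \int[mu]_s ((G (o, s)) ^+ 2)%:E = \int[Pi]_p ((G p) ^+ 2)%:E)%E.
Proof.
move=> mG; rewrite fubini_tonelli1//.
  by apply/measurable_EFinP; exact: measurable_funX.
by move=> p; rewrite lee_fin sqr_ge0.
Qed.

Lemma nested_cut T H S I : elem 0 T S I ->
  measurable_fun [set: (Omega * measurableTypeR R)%type] (cut T H) ->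
  (\int[Pr]_o \int[mu]_(s in `[0%R, T[) ((H s o - S (o, s)) ^+ 2)%:E =
   \int[Pi]_p ((cut T H p - S p) ^+ 2)%:E)%E.
Proof.
move=> e mH; have [[mS _] _ _] := elem_isometry (lexx 0) e.
rewrite -nested_int; last exact: measurable_funB.
apply: eq_integral => o _; rewrite integral_mkcond; apply: eq_integral => s _.
have := elem_supp (o, s) e; rewrite patchE /cut /= itvfE mem_setE in_itv/=.
case: (_ && _); first by rewrite !mulr1.
by rewrite mulr0 => <-; rewrite mulr0 subrr expr0n.
Qed.

(** The two integrals agree: here the convergent sequence of simple processes
    supplies an approximation for each eps, with Fubini turning nested integrals
    into integrals over the product. *)
Lemma is_ito_ito T H I : 0 <= T -> is_ito_integral Pr F w T H I -> ito 0 T (cut T H) I.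
Proof.
move=> T0 [mH mI [S [aS cS cI]]].
have mc := measurable_cut mH.
have e j := simple_elem T0 (aS j).
have near0 (u : nat -> \bar R) (eps : R) : 0 < eps -> u @ \oo --> 0%E ->
    \forall n \near \oo, (u n <= (eps ^+ 2)%:E)%E.
  move=> eps0 /fine_cvgP[uf u0].
  have : \forall n \near \oo, fine (u n) < eps ^+ 2.
    have /cvgrPdist_lt/(_ (eps ^+ 2)) := u0; rewrite exprn_gt0// => /(_ isT).
    by apply: filterS => n; rewrite sub0r normrN /= => h; exact: le_lt_trans (ler_norm _) h.
  by apply: filterS2 uf => n fn lt; rewrite -(fineK fn) lee_fin ltW.
have appr eps : 0 < eps -> exists j,
    [/\ L2 Pi (fun p => cut T H p - simple_val (S j) p.2 p.1),
        nrm Pi (fun p => cut T H p - simple_val (S j) p.2 p.1) <= eps,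
        L2 Pr (fun o => I o - simple_int w (S j) o) &
        nrm Pr (fun o => I o - simple_int w (S j) o) <= eps].
  move=> eps0; have [N _ hN] := filterI (near0 _ _ eps0 cS) (near0 _ _ eps0 cI).
  have [h1 h2] := hN N (leqnn N); exists N.
  have [[mS _] [mJ _] _] := elem_isometry (lexx 0) (e N).
  have h1' := nested_cut (e N) mc; rewrite /= in h1' h1; rewrite {}h1' in h1.
  have l1 : L2 Pi (fun p => cut T H p - simple_val (S N) p.2 p.1).
    by apply: L2P; [exact: measurable_funB|exact: le_lt_trans h1 (ltry _)].
  have l2 : L2 Pr (fun o => I o - simple_int w (S N) o).
    by apply: L2P; [exact: measurable_funB|exact: le_lt_trans h2 (ltry _)].
  by split => //; apply: nrm_le_int => //; exact: ltW.
have [j [l1 _ l2 _]] := appr 1 ltr01.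
have [lS lJ _] := elem_isometry (lexx 0) (e j).
split.
- have := L2D l1 lS; congr (L2 Pi _); apply/funext => p; ring.
- have := L2D l2 lJ; congr (L2 Pr _); apply/funext => p; ring.
- move=> eps /appr[k [_ h1 _ h2]].
  by exists (fun p => simple_val (S k) p.2 p.1), (simple_int w (S k)).
Qed.

(** Conversely an approximation for each eps = 1 / (j + 1), regrouped on a grid,
    gives the sequence of simple processes. *)
Lemma ito_is_ito T H I : 0 <= T ->
  measurable_fun ((`[0, T[ : set (measurableTypeR R)) `*` setT)
        (fun p : measurableTypeR R * Omega => H p.1 p.2) ->
  ito 0 T (cut T H) I -> is_ito_integral Pr F w T H I.
Proof.
move=> T0 mH [lH lI h]; split => //; first exact: L2_meas lI.
have mc := measurable_cut mH.
have ex j : exists SP, [/\ simple_adapted Pr F T SP,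
   (\int[Pr]_o \int[mu]_(s in `[0%R, T[) ((H s o - simple_val SP s o) ^+ 2)%:E
       <= (harmonic j : R)%:E)%E &
   (\int[Pr]_o ((I o - simple_int w SP o) ^+ 2)%:E <= (harmonic j : R)%:E)%E].
  have [S [J [e h1 h2]]] := h (harmonic j) (harmonic_gt0 j).
  have [lS lJ _] := elem_isometry (lexx 0) e.
  have [SP aSP [vS iS]] := elem_simple (lexx 0) e; exists SP.
  have sq x : 0 <= x -> x <= harmonic j -> x ^+ 2 <= harmonic j.
    move=> x0 xj; apply: (@le_trans _ _ x) => //.
    rewrite expr2 ler_piMl// (le_trans xj)//.
    by rewrite /harmonic/= invf_le1 ?ler1n ?ltr0n.
  split => //.
    under eq_integral do under eq_integral do rewrite vS.
    rewrite (nested_cut e mc) nrm2E ?lee_fin; last exact: L2B.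
    by apply: sq => //; exact: nrm_ge0.
  under eq_integral do rewrite iS.
  rewrite nrm2E ?lee_fin; last exact: L2B.
  by apply: sq => //; exact: nrm_ge0.
have [S hS] := choice ex; exists S.
have hc : (fun j => (harmonic j : R)%:E) @ \oo --> 0%E.
  by apply: cvg_EFin; [near=> n|exact: cvg_harmonic].
split; first by move=> j; have [] := hS j.
- apply: (@squeeze_cvge _ _ _ _ (fun=> 0%E)); [|exact: cvg_cst|exact: hc].
  near=> j; have [_ -> _] := hS j; rewrite andbT.
  by apply: integral_ge0 => o _; apply: integral_ge0 => s _; rewrite lee_fin sqr_ge0.
- apply: (@squeeze_cvge _ _ _ _ (fun=> 0%E)); [|exact: cvg_cst|exact: hc].
  near=> j; have [_ _ ->] := hS j; rewrite andbT.
  by apply: integral_ge0 => o _; rewrite lee_fin sqr_ge0.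
Unshelve. all: by end_near. Qed.

End Elementary.

(** * Step functions and measurable versions *)

Lemma dominated_nrm {d : measure_display} {T : measurableType d} {R : realType}
  (mu : {measure set T -> \bar R}) (f : nat -> T -> R) (g : T -> R) (eps : R) :
  (forall n, measurable_fun [set: T] (f n)) -> L2 mu g ->
  (forall n x, `|f n x| <= `|g x|) ->
  (forall x, (fun n => f n x) @ \oo --> (0 : R)) -> 0 < eps ->
  \forall n \near \oo, nrm mu (f n) <= eps.
Proof.
move=> mf lg fg f0 eps0.
have lf n : L2 mu (f n) by apply: L2_le lg => //; exact: fg.
have [] := @dominated_convergence _ _ R mu setT measurableT
  (fun n x => (f n x ^+ 2)%:E) (fun=> 0%E) (fun x => (g x ^+ 2)%:E).
- by move=> n; apply/measurable_EFinP; exact: measurable_funX.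
- exact: measurable_cst.
- apply: aeW => x _; apply: cvg_EFin; first by near=> n.
  rewrite (_ : 0 = (0 : R) ^+ 2); last by rewrite expr0n.
  apply: (@cvg_comp _ _ _ _ (fun y => y ^+ 2) _ (nbhs (0 : R))); first exact: f0.
  exact: exprn_continuous.
- exact: lg.2.
- apply: aeW => x n _; rewrite /= lee_fin ger0_norm ?sqr_ge0//.
  by rewrite -[leLHS]real_normK ?num_real// -[leRHS]real_normK ?num_real// ler_sqr ?nnegrE.
move=> _ _; rewrite integral0 => /fine_cvgP[uf u0].
have : \forall n \near \oo, fine (\int[mu]_x (f n x ^+ 2)%:E)%E < eps ^+ 2.
  have /cvgrPdist_lt/(_ (eps ^+ 2)) := u0; rewrite exprn_gt0// => /(_ isT).
  by apply: filterS => n; rewrite sub0r normrN /= => h; exact: le_lt_trans (ler_norm _) h.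
apply: filterS => n h; apply: nrm_le_int => //; first exact: ltW.
by rewrite (nrm2E (lf n)); move: h; rewrite (nrm2E (lf n)) lee_fin => /ltW.
Unshelve. all: by end_near. Qed.

Section StepDensity.
Context {R : realType}.
Notation mu := (@lebesgue_measure R).
Variables (a b : R).
Hypothesis ab : a < b.

Definition knot (n k : nat) : R := a + k%:R * ((b - a) / n%:R).
Definition stepfun (n : nat) (c : nat -> R) : measurableTypeR R -> R :=
  fun s => \sum_(k < n) c k * itvf (knot n k) (knot n k.+1) s.

Lemma knot0 n : knot n 0 = a. Proof. by rewrite /knot mul0r addr0. Qed.

Lemma knotn n : (0 < n)%N -> knot n n = b.
Proof.
move=> n0; rewrite /knot mulrC divfK ?pnatr_eq0 -?lt0n// addrC subrK.
by [].
Qed.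

Lemma knot_le n k l : (0 < n)%N -> (k <= l)%N -> knot n k <= knot n l.
Proof.
move=> n0 kl; rewrite /knot lerD2l ler_pM2r ?ler_nat// divr_gt0 ?ltr0n//.
by rewrite subr_gt0.
Qed.

Lemma L2_stepfun n c : L2 mu (stepfun n c).
Proof. by apply: L2_sum => k _; apply: L2Z; exact: L2_itvf. Qed.

Lemma stepfun_out n c (s : R) : (0 < n)%N -> ~~ (a <= s < b) -> stepfun n c s = 0.
Proof.
move=> n0 sab; rewrite /stepfun big1// => k _; rewrite itvfE.
case: (boolP (_ && _)) => /=; last by rewrite mulr0.
move=> /andP[ks sk]; exfalso; move/negP: sab; apply; apply/andP; split.
  by apply: le_trans ks; rewrite -(knot0 n); exact: knot_le.
by apply: lt_le_trans sk _; rewrite -[leRHS](knotn n0); exact: knot_le.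
Qed.

Lemma stepfun_in n c (s : R) : (0 < n)%N -> a <= s < b ->
  exists k, [/\ (k < n)%N, knot n k <= s < knot n k.+1 & stepfun n c s = c k].
Proof.
move=> n0 /andP[as_ sb].
have h0 : 0 < (b - a) / n%:R by rewrite divr_gt0 ?subr_gt0 ?ltr0n.
pose k := Num.truncn ((s - a) / ((b - a) / n%:R)).
have /truncn_itv : 0 <= (s - a) / ((b - a) / n%:R) by rewrite divr_ge0 ?subr_ge0// ltW.
rewrite -/k ler_pdivlMr// ltr_pdivrMr// => /andP[h1 h2].
have ks : knot n k <= s < knot n k.+1 by rewrite /knot; apply/andP; split; lra.
have kn : (k < n)%N.
  rewrite ltnNge; apply/negP => nk.
  have := knot_le n0 nk; rewrite knotn// => h; have /andP[] := ks; lra.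
exists k; split => //; rewrite /stepfun (bigD1 (Ordinal kn))//= itvfE ks mulr1.
rewrite big1 ?addr0// => l lk; rewrite itvfE; case: (boolP (_ && _)) => /=; last by rewrite mulr0.
move=> /andP[l1 l2]; exfalso; have /andP[k1 k2] := ks.
have [lk'|kl|e] := ltngtP l k.
- by have := knot_le n0 lk'; lra.
- by have := knot_le n0 kl; lra.
- by move/eqP: lk; apply; apply/val_inj.
Qed.

(** Sampling a bounded continuous function at the left ends of the cells
    converges pointwise, so by dominated convergence in norm. *)
Lemma stepfun_cont (phi : R -> R) (M eps : R) : continuous phi ->
  (forall s, `|phi s| <= M) -> 0 < eps ->
  exists n c, (0 < n)%N /\
    nrm mu (fun s : measurableTypeR R => phi s * itvf a b s - stepfun n c s) <= eps.
Proof.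
move=> cphi phiM eps0.
pose c n k := phi (knot n.+1 k).
pose f n (s : measurableTypeR R) := phi s * itvf a b s - stepfun n.+1 (c n) s.
have mphi : measurable_fun [set: measurableTypeR R] phi by exact: continuous_measurable_fun.
have M0 : 0 <= M by apply: le_trans (phiM 0).
have : \forall n \near \oo, nrm mu (f n) <= eps.
  apply: (@dominated_nrm _ _ _ _ _ (fun s => 2 * M * itvf a b s)) => //.
  - move=> n; apply: measurable_funB; last by have [] := L2_stepfun n.+1 (c n).
    by apply: measurable_funM => //; exact: measurable_itvf.
  - by apply: L2Z; exact: L2_itvf.
  - move=> n s; rewrite /f [X in _ <= `|_ * X|]itvfE; case: (boolP (_ && _)) => /= sab.
      have [k [kn ks ->]] := stepfun_in (c n) (ltn0Sn n) sab.
      rewrite itvfE sab !mulr1 (ger0_norm (mulr_ge0 _ _))//.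
      apply: le_trans (ler_normB _ _) _; rewrite /c.
      by have := phiM s; have := phiM (knot n.+1 k); lra.
    by rewrite itvfE (negbTE sab) stepfun_out// !mulr0 subr0.
  - move=> s; rewrite /f; have [sab|sab] := boolP (a <= s < b); last first.
      under eq_cvg do rewrite itvfE (negbTE sab) stepfun_out// mulr0 subr0.
      exact: cvg_cst.
    apply/cvgrPdist_le => /= e e0.
    have /cvgrPdist_le/(_ e e0) := cphi s; move=> [/= r r0 hr].
    have : \forall n \near \oo, (b - a) / n.+1%:R < r.
      near=> n; rewrite ltr_pdivrMr ?ltr0n// mulrC -ltr_pdivrMr//.
      apply: (@lt_trans _ _ n%:R); last by rewrite ltr_nat.
      by near: n; exact: nbhs_infty_gtr.
    apply: filterS => n hn; rewrite sub0r normrN itvfE sab mulr1.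
    have [k [kn /andP[k1 k2] ->]] := stepfun_in (c n) (ltn0Sn n) sab.
    rewrite /c; apply: hr; rewrite /ball_/=.
    have kE : knot n.+1 k.+1 = knot n.+1 k + (b - a) / n.+1%:R.
      by rewrite /knot -addn1 natrD mulrDl mul1r addrA.
    rewrite ger0_norm ?subr_ge0// ltrBlDr; apply: lt_trans k2 _.
    by rewrite kE addrC ltrD2r.
move=> [N _ /(_ N (leqnn N))] h; exists N.+1, (c N); split => //.
Unshelve. all: by end_near. Qed.

(** Three approximations: truncate g at a level M; approximate the truncation in
    mean by a continuous function, truncated at the same level; sample the
    latter. The second error, bounded by 2 M, is small in norm because its
    square is at most 2 M times its absolute value. *)
Lemma step_dense (g : measurableTypeR R -> R) (eps : R) : L2 mu g ->
  (forall s, g s * itvf a b s = g s) -> 0 < eps ->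
  exists n c, (0 < n)%N /\ nrm mu (fun s => g s - stepfun n c s) <= eps.
Proof.
move=> lg gsupp eps0; have mg := L2_meas lg.
pose tr (M x : R) := Num.max (- M) (Num.min M x).
have trle (M x : R) : 0 <= M -> `|tr M x| <= M.
  by move=> M0; rewrite ler_norml /tr le_max lexx/= ge_max ge_min lexx; lra.
have trid (M x : R) : `|x| <= M -> tr M x = x.
  by rewrite ler_norml /tr => /andP[h1 h2]; rewrite min_r// max_r.
have trx (M x : R) : 0 <= M -> `|x - tr M x| <= `|x|.
  move=> M0; rewrite /tr; case: (leP M x) => h.
    by rewrite max_r; [rewrite !ger0_norm; lra|lra].
  by case: (leP (- M) x) => h'; [rewrite subrr normr0|rewrite !ler0_norm; lra].
have trlip (M x y : R) : 0 <= M -> `|tr M x - tr M y| <= `|x - y|.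
  move=> M0; have /andP[] : - `|x - y| <= x - y <= `|x - y| by rewrite -ler_norml.
  move: (normr_ge0 (x - y)); move: `|x - y| => D D0 h1 h2; rewrite ler_norml /tr.
  by case: (leP M x) => h3; case: (leP M y) => h4; rewrite !maxEle;
    do ?case: ifPn; rewrite -?ltNge => *; lra.
have mtr M : measurable_fun [set: R] (tr M).
  by apply: measurable_maxr => //; exact: measurable_minr.
have e3 : 0 < eps / 3 by rewrite divr_gt0.
have : \forall n \near \oo, nrm mu (fun s => g s - tr n%:R (g s)) <= eps / 3.
  apply: (@dominated_nrm _ _ _ _ _ g) => //.
  - move=> n; apply: measurable_funB => //; exact: (measurableT_comp (mtr _)).
  - by move=> n s; exact: trx.
  - move=> s; apply: (@cvg_near_cst _ _ 0).
    have := @nbhs_infty_ger R (`|g s|); apply: filterS => n hn.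
    by rewrite trid ?subrr.
move=> [M1 _ /(_ M1 (leqnn M1))] /= hM1.
pose M : R := M1%:R; have M0 : 0 <= M by [].
pose gM s := tr M (g s).
have lgM : L2 mu gM.
  apply: L2_le lg; first exact: (measurableT_comp (mtr M)).
  move=> s; rewrite /gM; have := trlip M (g s) 0 M0.
  by rewrite [tr M 0]trid ?normr0// !subr0.
have gMsupp s : gM s * itvf a b s = gM s.
  rewrite /gM -{2}gsupp itvfE; case: (_ && _); rewrite ?mulr1 // !mulr0.
  by rewrite trid ?normr0.
have lgM1 : L1 mu gM.
  apply: (L1_eq _ (L2M lgM (L2_itvf a b))) => s; exact: gMsupp.
pose E : set (measurableTypeR R) := `[a, b]%classic.
have mE : measurable E by exact: measurable_itv.
have [] := @approximation_continuous_integrable R E gM mE.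
- by apply: le_lt_trans (_ : (_ <= (b - a)%:E)%E) (ltry _);
   rewrite (_ : _ E = (b - a)%:E)//; apply: etrans (lebesgue_measure_itv _) _; rewrite /= lte_fin ab EFinB.
- by apply: integrableS lgM1.
move=> h [ch ih /fine_cvgP[hf h0]].
have d0 : 0 < (eps / 3) ^+ 2 / (2 * M + 1).
  by rewrite divr_gt0 ?exprn_gt0//; lra.
have [N hN] : exists N, (\int[mu]_(s in E) `|(gM s - h N s)%:E| <=
    ((eps / 3) ^+ 2 / (2 * M + 1))%:E)%E.
  have /cvgrPdist_lt/(_ _ d0) h1 := h0.
  have [N _ /(_ N (leqnn N))[/= f1 f2]] := filterI hf h1; exists N.
  rewrite -(fineK f1) lee_fin; move: f2; rewrite sub0r normrN => f2.
  by apply: ltW; exact: le_lt_trans (ler_norm _) f2.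
pose phi s := tr M (h N s).
have cphi : continuous phi.
  move=> s; apply: (@continuous_comp _ _ _ (h N) (tr M)); first exact: ch.
  by apply: continuous_max; [exact: cvg_cst|apply: continuous_min; [exact: cvg_cst|exact: cvg_id]].
have [n [c [n0 hc]]] := stepfun_cont cphi (fun s => trle M (h N s) M0) e3.
have mphi : measurable_fun [set: measurableTypeR R] phi by exact: continuous_measurable_fun.
exists n, c; split=> //.
have lphi : L2 mu (fun s : measurableTypeR R => phi s * itvf a b s).
  apply: (@L2_le _ _ _ _ _ (fun s => M * itvf a b s)).
  - by apply: measurable_funM => //; exact: measurable_itvf.
  - move=> s; rewrite !normrM; apply: ler_wpM2r => //.
    by rewrite (ger0_norm M0); exact: trle.
  - by apply: L2Z; exact: L2_itvf.
have lst := L2_stepfun n c.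
have -> : eps = eps / 3 + (eps / 3 + eps / 3) by field.
apply: le_trans (nrmB_le lg lgM lst) _; apply: lerD; first exact: hM1.
apply: le_trans (nrmB_le lgM lphi lst) _; apply: lerD; last exact: hc.
have mgh : measurable_fun E (fun s => `|(gM s - h N s)%:E|%E).
  apply: measurableT_comp => //; apply/measurable_EFinP; apply: measurable_funTS.
  apply: measurable_funB; first exact: L2_meas lgM.
  by apply: continuous_measurable_fun; exact: ch.
apply: nrm_le_int; [exact: L2B|exact: ltW|].
apply: (@le_trans _ _ (\int[mu]_(s in E) ((2 * M)%:E * `|(gM s - h N s)%:E|))%E).
  rewrite [leRHS]integral_mkcond; apply: ge0_le_integral => //.
  - by move=> s _; rewrite lee_fin sqr_ge0.
  - by apply/measurable_EFinP; apply: measurable_funX; exact: L2_meas (L2B lgM lphi).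
  - by have /(measurable_restrictT _ mE) := measurable_funeM (2 * M)%:E mgh.
  - move=> s _; rewrite patchE; case: ifPn => sE; last first.
      rewrite -[gM s]gMsupp -mulrBl itvfE.
      have -> : (a <= s) && ((s : R) < b) = false.
        apply/negbTE; apply: contra sE => /andP[h1 h2]; rewrite inE /E/= in_itv/=.
        by rewrite h1 ltW.
      by rewrite mulr0 expr0n.
    rewrite -EFinM lee_fin -[X in (X - _) ^+ 2]gMsupp -mulrBl exprMn itvf_sqr itvfE.
    have b1 : (gM s - phi s) ^+ 2 <= 2 * M * `|gM s - h N s|.
      have := trlip M (tr M (g s)) (h N s) M0.
      rewrite (trid M (tr M (g s))) ?trle// -/(gM s) -/(phi s) => hl.
      rewrite -[leLHS]real_normK ?num_real// expr2; apply: ler_pM => //.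
      apply: le_trans (ler_normB _ _) _.
      by have := trle M (g s) M0; have := trle M (h N s) M0; rewrite /gM /phi; lra.
    case: (_ && _); rewrite ?mulr1// mulr0 mulr_ge0// mulr_ge0//.
rewrite ge0_integralZl//; last by rewrite lee_fin mulr_ge0.
apply: le_trans (lee_wpmul2l _ hN) _; first by rewrite lee_fin mulr_ge0.
rewrite -EFinM lee_fin mulrA ler_pdivrMr; last by lra.
have : 0 <= (eps / 3) ^+ 2 by exact: sqr_ge0.
by move: ((eps / 3) ^+ 2) => e e0; nra.
Qed.

End StepDensity.

Lemma geom_small {R : realType} (C eps : R) : 0 < eps -> exists j, C / 2 ^+ j <= eps.
Proof.
move=> eps0; have : (fun j => C * (2^-1 : R) ^+ j) @ \oo --> (C * 0 : R).
  by apply: cvgMr; apply: cvg_expr; rewrite ger0_norm// invf_lt1// ltr1n.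
move=> /cvgrPdist_lt/(_ eps eps0)[N _ /(_ N (leqnn N))].
rewrite /= mulr0 sub0r normrN => hN; exists N; apply: ltW.
by rewrite -exprVn; exact: le_lt_trans (ler_norm _) hN.
Qed.

Section Versions.
Context {d : measure_display} {Omega : measurableType d} {R : realType}.
Variable Pr : probability Omega R.
Variable F : R -> set (set Omega).
Variable w : R -> Omega -> R.
Hypothesis hw : wiener_process Pr F w.
Notation mu := (@lebesgue_measure R).
Notation Pi := (Pr \x mu)%E.
Notation process := ((Omega * measurableTypeR R)%type -> R).

(** The mesh is 4 ^- j because the norm of a Wiener increment is the square root
    of its duration: consecutive approximations then differ by at most 2 ^- j,
    the rate that riesz_fischer asks for. *)
Definition qgrid (j : nat) (t : R) : R := (Num.truncn (t * 4 ^+ j))%:R / 4 ^+ j.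

Let p4 j : 0 < (4 : R) ^+ j. Proof. exact: exprn_gt0. Qed.

Lemma qgrid_ge0 j t : 0 <= qgrid j t.
Proof. by rewrite divr_ge0// ltW. Qed.

Lemma qgrid_le j t : 0 <= t -> qgrid j t <= t.
Proof. by move=> t0; rewrite ler_pdivrMr// truncn_le mulr_ge0// ltW. Qed.

Lemma qgrid_gt j t : 0 <= t -> t - qgrid j t <= (4 ^+ j)^-1.
Proof.
move=> t0; have /truncn_itv/andP[_ h] : 0 <= t * 4 ^+ j by rewrite mulr_ge0// ltW.
rewrite lerBlDr -[X in _ <= X + _]mul1r -mulrDl ler_pdivlMr//.
by move: h; rewrite -addn1 natrD => h; lra.
Qed.

Lemma qgrid_mono j t : 0 <= t -> qgrid j t <= qgrid j.+1 t.
Proof.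
move=> t0; rewrite ler_pdivrMr// mulrAC ler_pdivlMr// exprS mulrA.
rewrite ler_pM2r// -[4]/(4%:R) -natrM ler_nat.
rewrite truncn_ge_nat; last by rewrite !mulr_ge0// mulr_ge0// ltW.
have h : (Num.truncn (t * 4 ^+ j))%:R <= t * 4 ^+ j.
  by rewrite truncn_le mulr_ge0 ?(ltW (p4 _)).
by rewrite natrM mulrCA mulrC ler_pM2l.
Qed.

Lemma L2_w t : 0 <= t -> L2 Pr (w t).
Proof.
move=> t0; have mt := measurable_w hw t0.
have l0 : L2 Pr (increment w 0 t).
  move: t0; rewrite le_eqVlt => /predU1P[<-|t0]; last exact: (L2_increment hw (lexx 0) t0).
  by under [X in L2 _ X]eq_fun do rewrite /increment subrr; exact: L2_0.
by apply: ae_L2 l0 => //; apply: filterS (wiener0 hw) => o w0; rewrite /increment w0 subr0.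
Qed.

Lemma nrm_w s t : 0 <= s -> s <= t -> nrm Pr (fun o => w t o - w s o) = Num.sqrt (t - s).
Proof.
move=> s0; rewrite le_eqVlt => /predU1P[<-|st].
  rewrite subrr sqrtr0 -[RHS](nrm_0 Pr); apply: nrm_eq => o; exact: subrr.
have lI := L2_increment hw s0 st; have := nrm2E lI.
rewrite (increment_sqr hw s0 st) => -[->].
by rewrite sqrtr_sqr ger0_norm// nrm_ge0.
Qed.

(** A version of the Wiener process that is adapted and jointly measurable
    everywhere. The paths of w are continuous only almost surely, so w itself
    need not be jointly measurable. *)
Definition wv (t : R) : Omega -> R := limfun (fun j => w (qgrid j t)).

Lemma wv_wrt t : 0 <= t -> measurable_wrt (F t) (wv t).
Proof.
move=> t0; apply: wrt_limfun; first exact: (sF hw).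
move=> j; apply: (wrt_mono hw (qgrid_ge0 j t) (qgrid_le j t0)).
exact: wiener_adapted hw _ (qgrid_ge0 j t).
Qed.

Let sqrt4 j : Num.sqrt ((4 ^+ j : R)^-1) = 1 / 2 ^+ j.
Proof.
have -> : (4 : R) = 2 ^+ 2 by rewrite expr2 -natrM.
by rewrite sqrtrV ?exprn_ge0// exprAC sqrtr_sqr ger0_norm ?exprn_ge0// div1r.
Qed.

Lemma wv_ae t : 0 <= t -> {ae Pr, forall o, wv t o = w t o}.
Proof.
move=> t0; pose f j := w (qgrid j t).
have lf j : L2 Pr (f j) by apply: L2_w; exact: qgrid_ge0.
have f1 j : nrm Pr (fun o => f j.+1 o - f j o) <= 1 / 2 ^+ j.
  rewrite nrm_w ?qgrid_ge0 ?qgrid_mono// -sqrt4 ler_wsqrtr//.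
  apply: le_trans (qgrid_gt j t0); rewrite lerD2r; exact: qgrid_le.
have [lF hF] := riesz_fischer lf f1.
have lw := L2_w t0.
suff /eqP : nrm Pr (fun o => wv t o - w t o) = 0.
  move=> /eqP /(nrm0_ae (L2B lF lw)); apply: filterS => o /eqP.
  by rewrite subr_eq0 => /eqP.
apply/eqP; rewrite -normr_le0 ger0_norm ?nrm_ge0//.
apply/ler_addgt0Pr => eps eps0; rewrite add0r.
have h j : nrm Pr (fun o => wv t o - w t o) <= 3 / 2 ^+ j.
  apply: le_trans (nrmB_le lF (lf j) lw) _.
  have -> : 3 / 2 ^+ j = 2 * 1 / 2 ^+ j + 1 / 2 ^+ j :> R by field; rewrite expf_neq0.
  apply: lerD; first exact: hF.
  rewrite nrmBC nrm_w ?qgrid_ge0 ?qgrid_le// -sqrt4 ler_wsqrtr//.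
  exact: qgrid_gt.
have [j hj] := geom_small 3 eps0.
exact: le_trans (h j) hj.
Qed.

(** Each approximation depends on time through the countably many values of the
    grid only. *)
Lemma measurable_wv :
  measurable_fun [set: (Omega * measurableTypeR R)%type] (fun p => wv p.2 p.1).
Proof.
apply: (@measurable_limfun _ (Omega * measurableTypeR R)%type R
  (fun j p => w (qgrid j p.2) p.1)) => j _ U mU; rewrite setTI.
pose A k : set (measurableTypeR R) := [set s | Num.truncn ((s : R) * 4 ^+ j) = k].
have mA k : measurable (A k).
  have -> : A k = `]-oo, k.+1%:R / 4 ^+ j[%classic `&`
     (if k == 0%N then setT else `[k%:R / 4 ^+ j, +oo[%classic).
    apply/seteqP; split => s.
      rewrite /A/= in_itv/= ltr_pdivlMr// => e; split.
        by rewrite ltNge -truncn_gt_nat e ltnn.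
      case: eqP => // /eqP k0; rewrite /= in_itv/= andbT ler_pdivrMr//.
      by rewrite -(prednK (n := k)) ?lt0n// -truncn_gt_nat e prednK// lt0n.
    rewrite /A/= in_itv/= ltr_pdivlMr// => -[h1 h2].
    apply/eqP; rewrite eqn_leq leqNgt truncn_gt_nat -ltNge h1/=.
    move: h2; case: eqP => [->//|/eqP k0].
    rewrite /= in_itv/= andbT ler_pdivrMr//.
    by rewrite -(prednK (n := k)) ?lt0n// -truncn_gt_nat.
  apply: measurableI; first exact: measurable_itv.
  by case: ifP => // _; exact: measurable_itv.
have -> : (fun p : Omega * measurableTypeR R => w (qgrid j p.2) p.1) @^-1` U =
    \bigcup_k ((w (k%:R / 4 ^+ j) @^-1` U) `*` A k).
  apply/seteqP; split => [[x s] /= h|[x s] [k _ /= [h]]].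
    by exists (Num.truncn ((s : R) * 4 ^+ j)).
  by rewrite /A/= /qgrid => ->.
apply: bigcupT_measurable => k; apply: measurableX => //.
have k0 : 0 <= k%:R / 4 ^+ j :> R by rewrite divr_ge0// ltW.
by have := measurable_w hw k0 measurableT mU; rewrite setTI.
Qed.

Lemma elem_sum a T n (S : nat -> process) (I : nat -> Omega -> R) :
  (forall k, elem Pr F w a T (S k) (I k)) ->
  elem Pr F w a T (fun p => \sum_(k < n) S k p) (fun o => \sum_(k < n) I k o).
Proof.
move=> h; elim: n => [|n ih].
  under eq_fun do rewrite big_ord0.
  by under [X in elem _ _ _ _ _ _ X]eq_fun do rewrite big_ord0; exact: elem_nil.
under eq_fun do rewrite big_ord_recr/=.
by under [X in elem _ _ _ _ _ _ X]eq_fun do rewrite big_ord_recr/=; apply: elem_add.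
Qed.

Lemma elem_one a T s t c : a <= s -> s <= t -> t <= T ->
  measurable_wrt (F s) c -> L2 Pr c ->
  elem Pr F w a T (tens c (itvf s t)) (fun o => c o * increment w s t o).
Proof.
move=> as_ st tT wc lc; have := elem_cons as_ st tT wc lc (elem_nil Pr F w a T).
under eq_fun do rewrite add0r.
by under [X in elem _ _ _ _ _ _ X -> _]eq_fun do rewrite add0r.
Qed.

(** For xi known at time a and g deterministic, a version of t |-> xi times the
    integral of g dw over [a, t]. The same step functions approximating g serve
    for all t, which makes the limit jointly measurable. *)
Section wiener_integral.
Variables (a b : R) (g : measurableTypeR R -> R) (xi : Omega -> R).
Hypotheses (a0 : 0 <= a) (ab : a < b).
Hypotheses (lg : L2 mu g) (gsupp : forall s, g s * itvf a b s = g s).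
Hypotheses (wxi : measurable_wrt (F a) xi) (lxi : L2 Pr xi).

Let ex j : exists nc : nat * (nat -> R), (0 < nc.1)%N /\
  nrm mu (fun s => g s - stepfun a b nc.1 nc.2 s) <= 1 / 2 ^+ j.
Proof.
have e0 : 0 < 1 / (2 : R) ^+ j by rewrite divr_gt0// exprn_gt0.
by have [n [c [n0 h]]] := step_dense ab lg gsupp e0; exists (n, c).
Qed.

Let st j : nat * (nat -> R) := projT1 (cid (ex j)).
Let n j := (st j).1.
Let c j := (st j).2.
Let n0 j : (0 < n j)%N. Proof. by have [] := projT2 (cid (ex j)). Qed.
Let gj j := stepfun a b (n j) (c j).
Let gj1 j : nrm mu (fun s => g s - gj j s) <= 1 / 2 ^+ j.
Proof. by have [] := projT2 (cid (ex j)). Qed.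
Let lgj j : L2 mu (gj j). Proof. exact: L2_stepfun. Qed.

Let p j k := knot a b (n j) k.
Let pa j k : a <= p j k.
Proof. by rewrite -(knot0 a b (n j)); exact: knot_le. Qed.
Let pp j k : p j k <= p j k.+1.
Proof. exact: knot_le. Qed.

Let Vj j t o := xi o * \sum_(k < n j) c j k *
  (wv (Num.min (p j k.+1) t) o - wv (Num.min (p j k) t) o).

Definition wint t : Omega -> R := limfun (fun j => Vj j t).

Let min0 j k t : a <= t -> 0 <= Num.min (p j k) t.
Proof. by move=> at_; rewrite (le_trans a0)// le_min pa. Qed.

Let wVj j t : a <= t -> measurable_wrt (F t) (Vj j t).
Proof.
move=> at_; have t0 := le_trans a0 at_.
apply: wrtM; first exact: (sF hw).
  exact: (wrt_mono hw a0 at_ wxi).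
apply: wrt_sum; first exact: (sF hw); move=> k.
apply: wrtM; first exact: (sF hw).
  by apply: wrt_cst; exact: (sF hw).
have mt l : measurable_wrt (F t) (wv (Num.min (p j l) t)).
  apply: (wrt_mono hw (min0 j l at_)); first by rewrite ge_min lexx orbT.
  by apply: wv_wrt; exact: min0.
by apply: wrtB; first exact: (sF hw).
Qed.

Let mVj j : measurable_fun [set: (Omega * measurableTypeR R)%type] (fun q => Vj j q.2 q.1).
Proof.
apply: measurable_funM.
  exact: (measurableT_comp (wrt_measurable hw a0 wxi)).
apply: measurable_sum => k; apply: measurable_funM => //.
have mt l : measurable_fun [set: (Omega * measurableTypeR R)%type]
    (fun q : Omega * measurableTypeR R => wv (Num.min (p j l) q.2) q.1).
  have mq : measurable_fun [set: (Omega * measurableTypeR R)%type]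
      (fun q : Omega * measurableTypeR R =>
         (q.1, Num.min (p j l) (q.2 : R)) : Omega * measurableTypeR R).
    by apply: measurable_fun_pair => //; exact: measurable_minr.
  exact: (measurableT_comp measurable_wv mq).
exact: measurable_funB.
Qed.

Lemma wint_wrt t : a <= t -> measurable_wrt (F t) (wint t).
Proof.
move=> at_; apply: wrt_limfun => [|j]; last exact: wVj.
exact: (sF hw (le_trans a0 at_)).
Qed.

Lemma measurable_wint :
  measurable_fun [set: (Omega * measurableTypeR R)%type] (fun q => wint q.2 q.1).
Proof.
exact: (@measurable_limfun _ (Omega * measurableTypeR R)%type R (fun j q => Vj j q.2 q.1)).
Qed.

Let itvf_min s t u : a <= s -> s <= t -> a <= u ->
  forall r, itvf s t r * itvf a u r = itvf (Num.min s u) (Num.min t u) r.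
Proof.
move=> as_ st' au r; rewrite !itvfE -natrM mulnb lt_min ge_min.
congr (nat_of_bool _)%:R; case: (leP s r) => //= sr.
  by rewrite (le_trans as_ sr).
by case: (leP u r) => //= ur; rewrite andbF.
Qed.

Let elemVj j t : a <= t -> exists2 I,
  elem Pr F w a t (tens xi (fun s => gj j s * itvf a t s)) I &
  {ae Pr, forall o, Vj j t o = I o}.
Proof.
move=> at_.
exists (fun o => \sum_(k < n j) (c j k * xi o) *
   increment w (Num.min (p j k) t) (Num.min (p j k.+1) t) o).
  have -> : tens xi (fun s => gj j s * itvf a t s) = (fun q => \sum_(k < n j)
      tens (fun o => c j k * xi o) (itvf (Num.min (p j k) t) (Num.min (p j k.+1) t)) q).
    apply/funext => q; rewrite /tens /gj /stepfun mulr_suml mulr_sumr.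
    by apply: eq_bigr => k _; rewrite -itvf_min//; rewrite /p; ring.
  apply: (@elem_sum a t (n j)
    (fun k => tens (fun o => c j k * xi o) (itvf (Num.min (p j k) t) (Num.min (p j k.+1) t)))
    (fun k o => c j k * xi o * increment w (Num.min (p j k) t) (Num.min (p j k.+1) t) o)) => k.
  apply: elem_one.
  - by rewrite le_min pa.
  - rewrite le_min !ge_min pp lexx orbT //=.
  - by rewrite ge_min lexx orbT.
  - apply: wrtM; first exact: (sF hw (min0 j k at_)).
      by apply: wrt_cst; exact: (sF hw (min0 j k at_)).
    by apply: (wrt_mono hw a0 _ wxi); rewrite le_min pa.
  - exact: L2Z.
have ae k : {ae Pr, forall o, wv (Num.min (p j k) t) o = w (Num.min (p j k) t) o}.
  by apply: wv_ae; exact: min0.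
have aeall : {ae Pr, forall o k, wv (Num.min (p j k) t) o = w (Num.min (p j k) t) o}.
  by apply/ae_foralln => k; exact: ae.
apply: filterS aeall => o h; rewrite /Vj mulr_sumr; apply: eq_bigr => k _.
by rewrite !h /increment; ring.
Qed.

Let lVj j t : a <= t -> L2 Pr (Vj j t).
Proof.
move=> at_; have [I e aeI] := elemVj j at_; have [_ lI _] := elem_isometry hw a0 e.
apply: (ae_L2 _ _ lI); first exact: (wrt_measurable hw (le_trans a0 at_) (wVj j at_)).
by apply: filterS aeI => o ->.
Qed.

Let C := 2 * nrm Pr xi.

Let Vj1 t j : a <= t -> nrm Pr (fun o => Vj j.+1 t o - Vj j t o) <= C / 2 ^+ j.
Proof.
move=> at_; have [I e aeI] := elemVj j at_; have [J f aeJ] := elemVj j.+1 at_.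
have [_ lI _] := elem_isometry hw a0 e; have [_ lJ _] := elem_isometry hw a0 f.
rewrite (ae_nrm (L2B (lVj j.+1 at_) (lVj j at_)) (L2B lJ lI)); last first.
  by apply: filterS2 aeI aeJ => o -> ->.
have [_ _ <-] := elem_isometry hw a0 (elem_sub hw a0 f e).
rewrite (@nrm_eq _ _ _ Pi _ (tens xi (fun s => (gj j.+1 s - gj j s) * itvf a t s))); last first.
  by move=> q; rewrite /tens; ring.
have [lc nc] := L2_itvfM a t (L2B (lgj j.+1) (lgj j)).
have CE : C / 2 ^+ j = nrm Pr xi * (2 / 2 ^+ j) by rewrite /C; ring.
rewrite nrm_tens// CE; apply: ler_wpM2l; first exact: nrm_ge0.
apply: le_trans nc _; apply: le_trans (nrmB_le (lgj _) lg (lgj _)) _.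
rewrite nrmBC; apply: le_trans (lerD (gj1 _) (gj1 _)) _.
have h : 1 / (2 : R) ^+ j.+1 <= 1 / 2 ^+ j.
  rewrite !div1r lef_pV2 ?posrE ?exprn_gt0// exprS ler_peMl ?exprn_ge0//.
  by rewrite ler1n.
by apply: le_trans (lerD h (lexx _)) _; rewrite div1r; lra.
Qed.

(** By the isometry the integrals of the step functions form a sequence with
    geometric increments, uniformly in t, so riesz_fischer identifies the
    pointwise limit with the limit in L2. *)
Lemma wint_ito t : a <= t ->
  ito Pr F w a t (tens xi (fun s => g s * itvf a t s)) (wint t).
Proof.
move=> at_; have [lF hF] := riesz_fischer (fun j => lVj j at_) (fun j => Vj1 j at_).
apply: (ito_limit hw a0) => //; first by apply: L2_tens => //; have [] := L2_itvfM a t lg.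
move=> eps eps0; have [j hj] := geom_small (2 * C) eps0.
have [I e aeI] := elemVj j at_; have [_ lI _] := elem_isometry hw a0 e.
exists (tens xi (fun s => gj j s * itvf a t s)), I; split; first exact: ito_elem.
- rewrite (@nrm_eq _ _ _ Pi _ (tens xi (fun s => (g s - gj j s) * itvf a t s))); last first.
    by move=> q; rewrite /tens; ring.
  have [lc nc] := L2_itvfM a t (L2B lg (lgj j)).
  rewrite nrm_tens//; apply: le_trans hj.
  apply: le_trans (ler_wpM2l (nrm_ge0 _ _) (le_trans nc (gj1 j))) _.
  rewrite mul1r ler_pM2r ?invr_gt0 ?exprn_gt0// /C.
  by have := nrm_ge0 Pr xi; lra.
- rewrite -(ae_nrm (L2B lF (lVj j at_))); first exact: le_trans (hF j) hj.
    exact: L2B.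
  by apply: filterS aeI => o ->.
Qed.

End wiener_integral.
End Versions.

(** * The matrix exponential and continuous matrix functions *)

Section MatrixExponential.
Context {R : realType}.

Lemma cvg_mx_entries (T : Type) (G : set_system T) {FF : Filter G} m n
    (u : T -> 'M[R]_(m, n)) (L : 'M[R]_(m, n)) :
  (forall i j, (fun k => u k i j) @ G --> L i j) -> u @ G --> L.
Proof.
move=> h; apply/cvg_ballP => e e0.
have : \forall k \near G, forall i j, ball (L i j) e (u k i j).
  apply: filter_forall => i; apply: filter_forall => j.
  by have /cvg_ballP/(_ e e0) := h i j.
by apply: filterS => k hk; split.
Qed.

Lemma cvg_bigsum (T : Type) (G : set_system T) {FF : Filter G} (I : Type) (s : seq I)
    (f : I -> T -> R) (l : I -> R) : (forall i, f i @ G --> l i) ->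
  (fun x => \sum_(i <- s) f i x) @ G --> \sum_(i <- s) l i.
Proof.
move=> h; elim: s => [|i s ih].
  by rewrite big_nil; under eq_fun do rewrite big_nil; exact: cvg_cst.
by rewrite big_cons; under eq_fun do rewrite big_cons; exact: cvgD.
Qed.

Section power_bound.
Context {n : nat}.
Implicit Types A : 'M[R]_n.

Definition mxsum A : R := \sum_i \sum_j `|A i j|.

Lemma mxsum_ge0 A : 0 <= mxsum A.
Proof. by do 2 apply: sumr_ge0 => ? _. Qed.

Lemma mxsum_row A i : \sum_j `|A i j| <= mxsum A.
Proof.
by rewrite /mxsum [leRHS](bigD1 i)//= lerDl; do 2 apply: sumr_ge0 => ? _.
Qed.

Lemma exprmxS A k : A ^+ k.+1 = A *m A ^+ k.
Proof. by rewrite exprS. Qed.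

Lemma mx_pow_bound A k i j : `|(A ^+ k) i j| <= mxsum A ^+ k.
Proof.
elim: k i j => [|k ih] i j.
  by rewrite !expr0 mxE; case: (i == j); rewrite ?normr1// normr0.
rewrite exprmxS mxE exprS; apply: le_trans (ler_norm_sum _ _ _) _.
apply: (@le_trans _ _ (\sum_l `|A i l| * mxsum A ^+ k)).
  by apply: ler_sum => l _; rewrite normrM ler_wpM2l.
by rewrite -mulr_suml ler_wpM2r ?exprn_ge0 ?mxsum_ge0 ?mxsum_row.
Qed.

Lemma exprmxZ A t k : (t *: A) ^+ k = t ^+ k *: A ^+ k.
Proof.
elim: k => [|k ih]; first by rewrite !expr0 scale1r.
by rewrite !exprmxS ih -scalemxAl -scalemxAr scalerA -exprS.
Qed.

End power_bound.

(** The exponential generating function of a. The entries of t |-> expmx (t *: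
    A) have this form, which reduces their calculus to that of real power
    series; differentiation is the shift of the coefficients. *)
Definition egf (a : nat -> R) (t : R) : R := limn (pseries (fun k => a k / k`!%:R) t).

Definition geom_bounded (a : nat -> R) := exists M C, 0 <= C /\ forall k, `|a k| <= M * C ^+ k.

Lemma geom_bounded_shift a : geom_bounded a -> geom_bounded (fun k => a k.+1).
Proof.
move=> [M [C [C0 h]]]; exists (M * C), C; split => // k.
by rewrite -mulrA -exprS.
Qed.

Lemma is_cvg_egf a t : geom_bounded a -> cvgn (pseries (fun k => a k / k`!%:R) t).
Proof.
move=> [M [C [C0 h]]]; apply: normed_cvg.
have ce := @is_cvg_series_exp_coeff R (C * `|t|).
apply: (@series_le_cvg _ _ (fun k => M * exp_coeff (C * `|t|) k)) => //.
- by move=> k; rewrite /= normr_ge0.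
- move=> k; rewrite mulr_ge0 ?exp_coeff_ge0// ?mulr_ge0//.
  by have := h 0%N; rewrite expr0 mulr1; apply: le_trans.
- move=> k; rewrite /= !normrM normfV [`|k`!%:R|]ger0_norm// normrX.
  rewrite /exp_coeff/= exprMn.
  rewrite mulrAC [X in _ <= X]mulrA ler_wpM2r ?invr_ge0//.
  by rewrite mulrA ler_wpM2r// exprn_ge0.
- exact: is_cvg_seriesZ.
Qed.

Lemma egf_diffs (a : nat -> R) :
  pseries_diffs (fun k => a k / k`!%:R) = (fun k => a k.+1 / k`!%:R).
Proof.
apply/funext => k; rewrite /pseries_diffs factS natrM.
have k1 : (k.+1%:R : R) != 0 by rewrite pnatr_eq0.
have k2 : (k`!%:R : R) != 0 by rewrite pnatr_eq0 -lt0n fact_gt0.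
move: (k.+1%:R) (k`!%:R) k1 k2 => x y x0 y0.
by field; rewrite x0 y0.
Qed.

Lemma is_derive_egf a t : geom_bounded a ->
  is_derive t (1 : R) (egf a) (egf (fun k => a k.+1) t).
Proof.
move=> ba; have b1 := geom_bounded_shift ba; have b2 := geom_bounded_shift b1.
rewrite /egf -(egf_diffs a); apply: (@pseries_snd_diffs _ _ (`|t| + 1)).
- exact: is_cvg_egf.
- by rewrite egf_diffs; exact: is_cvg_egf.
- by rewrite !egf_diffs; exact: is_cvg_egf.
- by rewrite [X in _ < X]ger0_norm ?ltrDl// addr_ge0.
Qed.

Lemma egf0 a : egf a 0 = a 0%N.
Proof.
rewrite /egf; apply/cvg_lim => //.
rewrite -cvg_shiftS; apply: cvg_near_cst; near=> n.
rewrite /pseries/series/= big_nat_recl//= expr0 mulr1 fact0 divr1 big1 ?addr0// => k _.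
by rewrite expr0n mulr0.
Unshelve. all: by end_near. Qed.

Context {n : nat}.
Variable A : 'M[R]_n.

Lemma pow_geom i j : geom_bounded (fun k => (A ^+ k) i j).
Proof.
exists 1, (mxsum A); split; first exact: mxsum_ge0.
by move=> k; rewrite mul1r mx_pow_bound.
Qed.

Lemma expmxE t i j : expmx (t *: A) i j = egf (fun k => (A ^+ k) i j) t.
Proof.
pose L : 'M[R]_n := \matrix_(i, j) egf (fun k => (A ^+ k) i j) t.
suff -> : expmx (t *: A) = L by rewrite mxE.
apply/cvg_lim; first exact: norm_hausdorff.
apply: cvg_mx_entries => {}i {}j; rewrite mxE.
rewrite (_ : (fun k => _) = pseries (fun k => (A ^+ k) i j / k`!%:R) t).
  exact: is_cvg_egf (pow_geom i j).
apply/funext => k; rewrite /series /pseries /= summxE; apply: eq_bigr => l _.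
by rewrite exprmxZ !mxE /=; ring.
Qed.

Lemma egf_sum m (c : 'I_m -> R) (a : 'I_m -> nat -> R) t :
  (forall l, geom_bounded (a l)) ->
  egf (fun k => \sum_l c l * a l k) t = \sum_l c l * egf (a l) t.
Proof.
move=> h; apply/cvg_lim => //.
rewrite (_ : pseries _ t = (fun n => \sum_l c l * pseries (fun k => a l k / k`!%:R) t n)).
  by apply: cvg_bigsum => l; apply: cvgMr; exact: is_cvg_egf.
apply/funext => k; rewrite /pseries /series /=.
under [RHS]eq_bigr do rewrite mulr_sumr.
rewrite exchange_big /=; apply: eq_bigr => i _.
by rewrite !mulr_suml; apply: eq_bigr => l _; ring.
Qed.

Lemma egf_shiftl t i j : egf (fun k => (A ^+ k.+1) i j) t = (A *m expmx (t *: A)) i j.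
Proof.
rewrite mxE; under [RHS]eq_bigr do rewrite expmxE.
rewrite -egf_sum; last by move=> l; exact: pow_geom.
by congr egf; apply/funext => k; rewrite exprmxS mxE.
Qed.

Lemma egf_shiftr t i j : egf (fun k => (A ^+ k.+1) i j) t = (expmx (t *: A) *m A) i j.
Proof.
rewrite mxE; under [RHS]eq_bigr do rewrite expmxE mulrC.
rewrite -egf_sum; last by move=> l; exact: pow_geom.
congr egf; apply/funext => k; rewrite exprSr mxE.
by apply: eq_bigr => l _; rewrite mulrC.
Qed.

Lemma expmx_comm t : A *m expmx (t *: A) = expmx (t *: A) *m A.
Proof. by apply/matrixP => i j; rewrite -egf_shiftl egf_shiftr. Qed.

Lemma is_derive_expmx t i j : is_derive t (1 : R) (fun t => expmx (t *: A) i j)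
  ((A *m expmx (t *: A)) i j).
Proof.
rewrite -egf_shiftl (_ : (fun t => _) = egf (fun k => (A ^+ k) i j)).
  exact: is_derive_egf (pow_geom i j).
by apply/funext => s; rewrite expmxE.
Qed.

Lemma expmx0 : expmx (0 *: A) = 1%:M.
Proof. by apply/matrixP => i j; rewrite expmxE egf0 expr0. Qed.

(** The left-hand side has zero derivative in u, because A commutes with its
    exponential, and its value at u = 0 is the right-hand side. *)
Lemma expmx_prod c u : expmx ((c - u) *: A) *m expmx (u *: A) = expmx (c *: A).
Proof.
apply/matrixP => i j.
pose phi u := (expmx ((c - u) *: A) *m expmx (u *: A)) i j.
suff e : phi u = phi 0 by move: e; rewrite /phi subr0 expmx0 mulmx1.
apply: is_derive_0_is_cst => {}u.
rewrite /phi (_ : (fun u => _) = (\sum_l (fun u => expmx ((c - u) *: A) i l * expmx (u *: A) l j))); last first.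
  by apply/funext => v; rewrite mxE fct_sumE.
have d1 l : is_derive u (1 : R) (fun u => expmx ((c - u) *: A) i l)
    (- (A *m expmx ((c - u) *: A)) i l).
  have := is_derive_expmx (c - u) i l => dd.
  rewrite (_ : (fun u => _) = (fun t => expmx (t *: A) i l) \o (fun u => c - u))//.
  have dg : is_derive u (1 : R) (fun u : R => c - u) (-1).
    have := @is_deriveB R R R (cst c) id u (1 : R) _ _ (is_derive_cst _ _ _) (is_derive_id _ _).
    by rewrite sub0r.
  have := @is_derive1_comp R (fun t => expmx (t *: A) i l) (fun u => c - u) u _ _ dd dg.
  by rewrite mulrN1.
have d2 l := is_derive_expmx u l j.
apply: is_derive_eq.
rewrite /GRing.scale/=.
have -> : \sum_l (expmx ((c - u) *: A) i l * (A *m expmx (u *: A)) l j +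
   expmx (u *: A) l j * - (A *m expmx ((c - u) *: A)) i l) =
   (expmx ((c - u) *: A) *m (A *m expmx (u *: A)) - (A *m expmx ((c - u) *: A)) *m expmx (u *: A)) i j.
  have mE (X Y : 'M[R]_n) : (X *m Y) i j = \sum_l X i l * Y l j by rewrite mxE.
  rewrite [RHS]mxE [X in _ = _ + X]mxE !mE -sumrB.
  by apply: eq_bigr => l _; ring.
by rewrite mulmxA -(expmx_comm (c - u)) subrr mxE.
Qed.

Lemma expmxD s t : expmx ((s + t) *: A) = expmx (s *: A) *m expmx (t *: A).
Proof. by rewrite -(expmx_prod (s + t) t) addrK. Qed.

Lemma continuous_expmx i j : continuous (fun t : R => expmx (t *: A) i j).
Proof.
move=> t; apply: differentiable_continuous; apply/derivable1_diffP.
by case: (is_derive_expmx t i j).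
Qed.

End MatrixExponential.

Lemma expmx_tr {R : realType} n (A : 'M[R]_n) t :
  expmx (t *: A^T) = (expmx (t *: A))^T.
Proof.
have trX k : (A^T) ^+ k = (A ^+ k)^T.
  elim: k => [|k ih]; first by rewrite !expr0 trmx1.
  by rewrite exprmxS ih exprSr trmx_mul.
apply/matrixP => i j; rewrite mxE !expmxE; congr (egf _ t).
by apply/funext => k; rewrite trX mxE.
Qed.

Section Continuity.
Context {R : realType}.
Notation mu := (@lebesgue_measure R).
Implicit Types f : R -> R.

Lemma cts_bounded f a b : continuous f -> exists2 M, 0 <= M &
  forall s, a <= s <= b -> `|f s| <= M.
Proof.
move=> cf; have [ab|ba] := leP a b; last first.
  by exists 0 => // s /andP[as_ sb]; have := le_trans as_ sb; rewrite leNgt ba.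
have cn : continuous (fun s => `|f s|).
  by move=> s; apply: (@continuous_comp _ _ _ f Num.norm); [exact: cf|exact: norm_continuous].
have [c _ hc] := @EVT_max R (fun s => `|f s|) a b ab (continuous_subspaceT cn).
by exists `|f c| => // s sab; apply: hc; rewrite in_itv.
Qed.

Lemma cts_meas f : continuous f -> measurable_fun [set: measurableTypeR R] f.
Proof. exact: continuous_measurable_fun. Qed.

(** On the support of g a continuous function is bounded. *)
Lemma ctsM_itvf f a b (g : measurableTypeR R -> R) : continuous f -> L2 mu g ->
  (forall s, g s * itvf a b s = g s) ->
  L2 mu (fun s => f s * g s).
Proof.
move=> cf lg gs; have [M M0 fM] := cts_bounded a b cf.
apply: (@L2_le _ _ _ _ _ (fun s => M * g s)); last exact: L2Z.
  by apply: measurable_funM; [exact: cts_meas|exact: L2_meas lg].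
move=> s; rewrite -gs itvfE; case: (boolP (_ && _)) => /= h; last by rewrite !mulr0 normr0.
rewrite mulr1 !normrM ler_wpM2r// [leRHS]ger0_norm// fM//.
by have /andP[-> /ltW] := h.
Qed.

Lemma L2_cts f a b : continuous f -> L2 mu (fun s => f s * itvf a b s).
Proof.
move=> cf; apply: (@ctsM_itvf f a b) => //; first exact: L2_itvf.
by move=> s; rewrite -expr2 itvf_sqr.
Qed.

Lemma L1_cts f a b : continuous f -> L1 mu (fun s => f s * itvf a b s).
Proof.
move=> cf; apply: L1_eq (L2M (L2_cts a b cf) (L2_itvf a b)) => s.
by rewrite -mulrA -expr2 itvf_sqr.
Qed.

Lemma int_itvf_itv a b (f : measurableTypeR R -> R) :
  \int[mu]_s (f s * itvf a b s) = \int[mu]_(s in `[a, b[) f s.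
Proof.
rewrite [RHS]Rintegral_mkcond; apply: eq_int => s.
rewrite patchE itvfE mem_setE in_itv/=.
by case: (_ && _); rewrite ?mulr1// mulr0.
Qed.

Lemma int_ftc f (G : R -> R) a b : a <= b -> continuous f ->
  (forall s, is_derive s (1 : R) G (f s)) ->
  \int[mu]_s (f s * itvf a b s) = G b - G a.
Proof.
rewrite le_eqVlt => /predU1P[<- cf dG|ab cf dG].
  rewrite subrr (@eq_int _ _ _ _ _ (fun=> 0)) ?Rintegral_cst ?mul0r//.
  by move=> s; rewrite itvfE le_eqVlt; case: (ltgtP a s); rewrite /= ?andbF ?mulr0.
have cG : continuous G.
  by move=> s; apply: differentiable_continuous; apply/derivable1_diffP; case: (dG s).
rewrite int_itvf_itv Rintegral_itv_bndo_bndc; last first.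
  have := L1_cts a b cf; rewrite /L1.
  have -> : EFin \o (fun s => f s * itvf a b s) = (EFin \o f) \_ (`[a, b[%classic).
    apply/funext => s; rewrite /= patchE itvfE mem_setE in_itv/=.
    by case: (_ && _); rewrite ?mulr1// mulr0.
  have mI : measurable (`[a, b[%classic : set (measurableTypeR R)) by exact: measurable_itv.
  by move=> /(integrable_restrict _ mI measurableT); rewrite setTI.
rewrite /Rintegral (@continuous_FTC2 R f G a b ab)//.
- exact: continuous_subspaceT.
- split; first by move=> s _; case: (dG s).
  + by apply: cvg_at_right_filter; exact: cG.
  + by apply: cvg_at_left_filter; exact: cG.
- by move=> s _; rewrite derive1E; case: (dG s).
Qed.

Section matrixvalued.

Definition ctsmx m n (G : R -> 'M[R]_(m, n)) := forall i j, continuous (fun s => G s i j).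

Lemma ctsmx_cst m' n' (C : 'M[R]_(m', n')) : ctsmx (fun=> C).
Proof. by move=> i j s; exact: cvg_cst. Qed.

Lemma ctsmxM m' n' p' (G : R -> 'M[R]_(m', n')) (H : R -> 'M[R]_(n', p')) :
  ctsmx G -> ctsmx H -> ctsmx (fun s => G s *m H s).
Proof.
move=> cG cH i j; rewrite (_ : (fun s => _) = (fun s => \sum_k G s i k * H s k j)); first move=> s.
  apply: cvg_bigsum => k; apply: cvgM; [exact: cG|exact: cH].
by apply/funext => u; rewrite mxE.
Qed.

Lemma ctsmxD m' n' (G H : R -> 'M[R]_(m', n')) :
  ctsmx G -> ctsmx H -> ctsmx (fun s => G s + H s).
Proof.
move=> cG cH i j; rewrite (_ : (fun s => _) = (fun s => G s i j + H s i j)); first move=> s.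
  by apply: cvgD; [exact: cG|exact: cH].
by apply/funext => u; rewrite mxE.
Qed.

Lemma ctsmxZ m' n' c (G : R -> 'M[R]_(m', n')) :
  ctsmx G -> ctsmx (fun s => c *: G s).
Proof.
move=> cG i j; rewrite (_ : (fun s => _) = (fun s => c * G s i j)); first move=> s.
  by apply: cvgM; [exact: cvg_cst|exact: cG].
by apply/funext => u; rewrite mxE.
Qed.

Lemma ctsmx_tr m' n' (G : R -> 'M[R]_(m', n')) : ctsmx G -> ctsmx (fun s => (G s)^T).
Proof.
move=> cG i j; rewrite (_ : (fun s => _) = (fun s => G s j i)); first move=> s.
  by exact: cG.
by apply/funext => u; rewrite mxE.
Qed.

Lemma ctsmx_comp m' n' (G : R -> 'M[R]_(m', n')) (f : R -> R) :
  ctsmx G -> continuous f -> ctsmx (fun s => G (f s)).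
Proof.
move=> cG cf i j s; apply: (@continuous_comp _ _ _ f (fun s => G s i j)); first exact: cf.
exact: cG.
Qed.

Lemma continuous_bigprod (I : Type) (s : seq I) (f : I -> R -> R) :
  (forall i, continuous (f i)) -> continuous (fun x => \prod_(i <- s) f i x).
Proof.
move=> h; elim: s => [|i s ih].
  rewrite (_ : (fun x => _) = (fun=> 1)); first by move=> x; exact: cvg_cst.
  by apply/funext => x; rewrite big_nil.
rewrite (_ : (fun x => _) = (fun x => f i x * \prod_(j <- s) f j x)).
  by move=> x; apply: cvgM; [exact: h|exact: ih].
by apply/funext => x; rewrite big_cons.
Qed.

Lemma continuous_det n' (G : R -> 'M[R]_n') : ctsmx G -> continuous (fun s => \det (G s)).
Proof.
move=> cG s; rewrite /determinant; apply: cvg_bigsum => sg.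
apply: cvgM; first exact: cvg_cst.
by apply: continuous_bigprod => i; exact: cG.
Qed.

(** Cramer rule: the entries of the inverse are rational functions of the
    entries. *)
Lemma ctsmx_inv n' (G : R -> 'M[R]_n') : ctsmx G -> (forall s, G s \in unitmx) ->
  ctsmx (fun s => invmx (G s)).
Proof.
move=> cG uG i j.
have E u : invmx (G u) i j = (\det (G u))^-1 * cofactor (G u) j i.
  by rewrite /invmx uG !mxE.
rewrite (_ : (fun s => _) = (fun u => (\det (G u))^-1 * cofactor (G u) j i)); last first.
  by apply/funext => u; exact: E.
move=> s; apply: cvgM.
  apply: cvgV; last exact: continuous_det.
  by have := uG s; rewrite unitmxE unitfE.
apply: cvgM; first exact: cvg_cst.
apply: continuous_det => k l.
rewrite (_ : (fun s => _) = (fun s => G s (lift j k) (lift i l))); first exact: cG.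
by apply/funext => u; rewrite !mxE.
Qed.

Lemma ctsmx_expmx n' (A : 'M[R]_n') : ctsmx (fun s => expmx (s *: A)).
Proof. by move=> i j; exact: continuous_expmx. Qed.

End matrixvalued.
End Continuity.

(** * Deterministic and stochastic Fubini theorems *)

Lemma measurable_int_param {d d' : measure_display} {T : measurableType d}
  {T' : measurableType d'} {R : realType} (P : {sigma_finite_measure set T -> \bar R})
  (f : T * T' -> R) : measurable_fun [set: T * T'] f ->
  measurable_fun [set: T'] (fun y => \int[P]_x (f (x, y))%:E)%E.
Proof.
move=> mf; have mEf : measurable_fun [set: T * T'] (EFin \o f) by exact/measurable_EFinP.
under eq_fun do rewrite integralE.
apply: emeasurable_funB.
- have := @measurable_fun_fubini_tonelli_G _ _ T T' R P ((EFin \o f)^\+)%E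
    (measurable_funepos mEf) (fun p => funepos_ge0 _ p).
  congr (measurable_fun _ _); apply/funext => y; apply: eq_integral => x _.
  by rewrite !funeposE.
- have := @measurable_fun_fubini_tonelli_G _ _ T T' R P ((EFin \o f)^\-)%E
    (measurable_funeneg mEf) (fun p => funeneg_ge0 _ p).
  congr (measurable_fun _ _); apply/funext => y; apply: eq_integral => x _.
  by rewrite !funenegE.
Qed.

Lemma intZl {d} {T : measurableType d} {R : realType}
  (mu : {measure set T -> \bar R}) (c : R) (f : T -> R) : L1 mu f ->
  \int[mu]_x (c * f x) = c * \int[mu]_x f x.
Proof. by move=> lf; rewrite RintegralZl. Qed.

Section PartialIntegral.
Context {d d' : measure_display} {T : measurableType d} {T' : measurableType d'}
  {R : realType}.
Variables (P : probability T R) (mu : {sigma_finite_measure set T' -> \bar R}).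
Notation Pi := (P \x mu)%E.
Variables (Q : T * T' -> R) (b : T' -> R).
Hypotheses (lQ : L2 Pi Q) (lb : L2 mu b).

Definition partial_int (x : T) : R := \int[mu]_y (b y * Q (x, y)).

Let lbQ : L1 Pi (fun p => b p.2 * Q p).
Proof.
have := L2M (L2_tens (L2_cst P 1) lb) lQ; apply: L1_eq => p.
by rewrite /tens mul1r.
Qed.

Let mR : measurable_fun [set: T] partial_int.
Proof.
apply: measurableT_comp; first exact: fine_measurable.
exact: (measurable_fubini_F lbQ).
Qed.

Lemma ae_section_L2 : {ae P, forall x, L2 mu (fun y => Q (x, y))}.
Proof.
have := ae_integrable1 lQ.2; apply: filterS => x h; split => //.
by have [mQ _] := lQ; exact: (measurableT_comp mQ (measurable_pair1 x)).
Qed.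

Lemma L2_partial : L2 P partial_int.
Proof.
apply: L2P => //; have [mQ l2Q] := lQ.
apply: (@le_lt_trans _ _ (\int[P]_x ((nrm mu b ^+ 2)%:E * \int[mu]_y ((Q (x, y)) ^+ 2)%:E))%E).
  apply: ae_ge0_le_integral => //.
  - by move=> x _; rewrite lee_fin sqr_ge0.
  - by apply/measurable_EFinP; apply: measurable_funX.
  - by move=> x _; rewrite mule_ge0 ?lee_fin ?sqr_ge0//; apply: integral_ge0 => y _; rewrite lee_fin sqr_ge0.
  - apply: measurable_funeM.
    apply: (@measurable_fun_fubini_tonelli_F _ _ _ _ _ _ (fun p => ((Q p) ^+ 2)%:E)) => //.
    + by apply/measurable_EFinP; exact: measurable_funX.
    + by move=> p; rewrite lee_fin sqr_ge0.
  - apply: filterS ae_section_L2 => x lx _; rewrite (nrm2E lx) -EFinM lee_fin.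
    rewrite -exprMn -[leLHS]real_normK ?num_real// ler_sqr ?nnegrE ?mulr_ge0 ?nrm_ge0//.
    rewrite ler_norml; apply/andP; split; last exact: cauchy_schwarz.
    rewrite lerNl -[X in _ <= X * _]mul1r -normrN1 -nrmZ//.
    apply: le_trans (cauchy_schwarz (L2Z (-1) lb) lx).
    by rewrite ipZl// mulN1r.
rewrite ge0_integralZl//; first last.
- by rewrite lee_fin sqr_ge0.
- by move=> x _; apply: integral_ge0 => y _; rewrite lee_fin sqr_ge0.
- apply: (@measurable_fun_fubini_tonelli_F _ _ _ _ _ _ (fun p => ((Q p) ^+ 2)%:E)) => //.
  + by apply/measurable_EFinP; exact: measurable_funX.
  + by move=> p; rewrite lee_fin sqr_ge0.
have -> : (\int[P]_x \int[mu]_y ((Q (x, y)) ^+ 2)%:E = \int[Pi]_p ((Q p) ^+ 2)%:E)%E.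
  rewrite fubini_tonelli1//.
  - by apply/measurable_EFinP; exact: measurable_funX.
  - by move=> p; rewrite lee_fin sqr_ge0.
by rewrite (nrm2E lQ) -EFinM ltry.
Qed.

Lemma ip_partial Z : L2 P Z -> ip P partial_int Z = ip Pi Q (tens Z b).
Proof.
move=> lZ; have lf : L1 Pi (fun p => Q p * tens Z b p) by apply: L2M => //; exact: L2_tens.
apply/EFin_inj; rewrite /ip -(fin_L1 lf) -(fin_L1 (L2M L2_partial lZ)).
have := integral12_prod_meas1 lf; rewrite /fubini_F /= => <-.
apply: ae_eq_integral => //.
- by apply/measurable_EFinP; apply: measurable_funM => //; exact: L2_meas lZ.
- exact: (measurable_fubini_F lf).
- apply: filterS ae_section_L2 => x lx _.
  rewrite [RHS](fin_L1 (f := fun y => Q (x, y) * tens Z b (x, y))); last first.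
    by apply: L1_eq (L1Z (Z x) (L2M lb lx)) => y; rewrite /tens /=; ring.
  congr EFin; rewrite /partial_int -RintegralZr//; last exact: (L2M lb lx).
  by apply: eq_int => y; rewrite /tens/=; ring.
Qed.

(** Pairing with Z turns the integral over y of a family of random variables
    into the integral of a family of numbers. *)
Lemma ip_partial2 Z : L2 P Z ->
  ip P partial_int Z = \int[mu]_y (b y * ip P (fun x => Q (x, y)) Z).
Proof.
move=> lZ; rewrite ip_partial//; have lf : L1 Pi (fun p => Q p * tens Z b p).
  by apply: L2M => //; exact: L2_tens.
have e := integral21_prod_meas1 lf; rewrite /fubini_G /= in e.
rewrite /ip /Rintegral; congr fine; rewrite -e.
have [mQ _] := lQ; have mZ := L2_meas lZ.
apply: ae_eq_integral => //.
- exact: (measurable_fubini_G lf).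
- apply/measurable_EFinP; apply: measurable_funM; first exact: L2_meas lb.
  apply: measurableT_comp; first exact: fine_measurable.
  apply: (@measurable_int_param _ _ T T' R P (fun p => Q p * Z p.1)).
  by apply: measurable_funM => //; exact: (measurableT_comp mZ).
have ae2 := ae_integrable2 lf.
have := ae_integrable2 lQ.2; apply: filterS2 ae2 => y h1 h2 _.
have lQy : L2 P (fun x => Q (x, y)).
  by split => //; exact: (measurableT_comp mQ (measurable_pair2 y)).
rewrite -/(Rintegral P setT (fun x => Q (x, y) * Z x)) -RintegralZl//; last exact: L2M.
rewrite -fin_L1; last exact: (L1Z (b y) (L2M lQy lZ)).
by apply: eq_integral => x _; rewrite /tens/=; congr EFin; ring.
Qed.

End PartialIntegral.

Lemma itvf_swap {R : realType} (a t r s : R) : r <> s ->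
  itvf a t s * itvf a s r = itvf a t r * itvf r t s.
Proof.
move=> /eqP rs; rewrite !itvfE; case: (ltgtP r s) rs => // rs _.
- case: (leP a r) => ar; rewrite ?(le_trans ar (ltW rs)) /=; last by rewrite mul0r mulr0.
  case: (ltP s t) => st; last by rewrite mul0r mulr0.
  by rewrite (lt_trans rs st) mulr1.
- by rewrite andbF !mulr0.
Qed.

Section TriangleFubini.
Context {R : realType}.
Notation mu := (@lebesgue_measure R).
Variables (f G : R -> R) (h : measurableTypeR R -> R) (a t : R).
Hypotheses (cf : continuous f) (dG : forall s, is_derive s (1 : R) G (f s)).
Hypothesis lh : L1 mu h.

Let k (p : measurableTypeR R * measurableTypeR R) : R :=
  (f p.1 * itvf a t p.1) * (h p.2 * itvf a p.1 p.2).

Let mk : measurable_fun [set: (measurableTypeR R * measurableTypeR R)%type] k.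
Proof.
have mf := cts_meas cf; have mh := L1_meas lh.
apply: measurable_funM; apply: measurable_funM.
- exact: (measurableT_comp mf).
- exact: (measurableT_comp (measurable_itvf a t)).
- exact: (measurableT_comp mh).
- have m1 : measurable_fun [set: (measurableTypeR R * measurableTypeR R)%type]
      (fun p : measurableTypeR R * measurableTypeR R => p.1 : R) by exact: measurable_fst.
  have m2 : measurable_fun [set: (measurableTypeR R * measurableTypeR R)%type]
      (fun p : measurableTypeR R * measurableTypeR R => p.2 : R) by exact: measurable_snd.
  rewrite (_ : (fun p => _) = (fun p : measurableTypeR R * measurableTypeR R =>
    if (a <= p.2) && ((p.2 : R) < p.1) then 1 else 0 : R)).
    apply: measurable_fun_ifT => //; apply: measurable_and.
      exact: measurable_fun_ler.
    exact: measurable_fun_ltr.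
  by apply/funext => -[x y] /=; rewrite itvfE; case: (_ && _).
Qed.

Let lk : L1 (mu \x mu)%E k.
Proof.
have [l _] := L1_tens (L1_cts a t cf) lh.
apply: L1_le l => // p; rewrite /k /tens !normrM ler_wpM2l ?mulr_ge0//.
by rewrite ler_piMr// itvfE; case: (_ && _); rewrite ?normr1 ?normr0.
Qed.

Let kint s : (\int[mu]_r (k (s, r))%:E)%E =
  (f s * itvf a t s * \int[mu]_r (h r * itvf a s r))%:E.
Proof.
have l := L1Z (f s * itvf a t s) (L1_itvf a s lh).
by rewrite [LHS](fin_L1 l); congr EFin; exact: (intZl _ (L1_itvf a s lh)).
Qed.

(** Exchange of the integrals over a <= r < s < t; for fixed r the integral of f
    over [r, t[ is G t - G r. *)
Lemma triangle_fubini :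
  \int[mu]_s (f s * itvf a t s * \int[mu]_r (h r * itvf a s r)) =
  \int[mu]_r (h r * ((G t - G r) * itvf a t r)).
Proof.
rewrite {1 3}/Rintegral; congr fine.
have e := Fubini lk.
transitivity (\int[mu]_s \int[mu]_r (k (s, r))%:E)%E.
  by apply: eq_integral => s _; rewrite kint.
rewrite e; apply: eq_integral => r _.
rewrite fin_L1; last first.
  rewrite /k /=.
  apply: L1_le (L1Z (h r) (L1_cts a t cf)).
    by exact: (measurableT_comp mk (measurable_pair2 r)).
  move=> s; have -> : f s * itvf a t s * (h r * itvf a s r) =
    h r * (f s * itvf a t s) * itvf a s r by ring.
  exact: norm_mul_itvf.
congr EFin.
have lfr : L1 mu (fun s => f s * itvf r t s) by exact: L1_cts.
transitivity (\int[mu]_s (h r * itvf a t r * (f s * itvf r t s))).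
  apply: ae_int.
  - by exact: (measurableT_comp mk (measurable_pair2 r)).
  - exact: L1_meas (L1Z _ lfr).
  - exists [set r]; split; [exact: measurable_set1|exact: lebesgue_measure_set1|].
    move=> s /= h1; apply: contrapT => sr; apply: h1.
    have e1 : itvf a t s * itvf a s r = itvf a t r * itvf r t s by apply: itvf_swap => rs; apply: sr; rewrite rs.
    by rewrite /k /= mulrACA e1; ring.
rewrite (intZl _ lfr).
case: (boolP (a <= r < t)) => h1; rewrite itvfE.
  have /andP[_ /ltW rt] := h1; have e2 := int_ftc rt cf dG.
  by rewrite h1 mulr1 (mulr1 (G t - G r)) -e2.
by rewrite (negbTE h1) !mulr0 mul0r.
Qed.

Lemma triangle_fubini_L1 :
  L1 mu (fun s => f s * itvf a t s * \int[mu]_r (h r * itvf a s r)).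
Proof.
have l := integrable_fubini_F lk.
rewrite /L1 (_ : (EFin \o _) = fubini_F mu (EFin \o k))//.
by apply/funext => s; rewrite /fubini_F /= kint.
Qed.

End TriangleFubini.

Section StochasticFubini.
Context {d : measure_display} {Omega : measurableType d} {R : realType}.
Variable Pr : probability Omega R.
Variable F : R -> set (set Omega).
Variable w : R -> Omega -> R.
Hypothesis hw : wiener_process Pr F w.
Notation mu := (@lebesgue_measure R).
Notation Pi := (Pr \x mu)%E.

(** The properties of wint on which everything later relies. *)
Record is_wint (a : R) (g : measurableTypeR R -> R) (xi : Omega -> R)
    (V : R -> Omega -> R) : Prop := IsWint {
  is_wint_wrt : forall t, a <= t -> measurable_wrt (F t) (V t);
  is_wint_meas : measurable_fun [set: (Omega * measurableTypeR R)%type] (fun q => V q.2 q.1);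
  is_wint_ito : forall t, a <= t ->
    ito Pr F w a t (tens xi (fun s => g s * itvf a t s)) (V t) }.

Lemma wint_exists a b g xi : 0 <= a -> a < b -> L2 mu g ->
  (forall s, g s * itvf a b s = g s) -> measurable_wrt (F a) xi -> L2 Pr xi ->
  exists V, is_wint a g xi V.
Proof.
move=> a0 ab lg gs wxi lxi; exists (wint w xi ab lg gs); split.
- by move=> t; exact: (wint_wrt hw).
- exact: (measurable_wint hw a0).
- by move=> t; exact: (wint_ito hw).
Qed.

Section fubini.
Variables (a t : R) (g : measurableTypeR R -> R) (xi : Omega -> R) (V : R -> Omega -> R).
Hypotheses (a0 : 0 <= a) (at_ : a <= t) (lg : L2 mu g) (lxi : L2 Pr xi).
Hypothesis hV : is_wint a g xi V.

Let U (p : Omega * measurableTypeR R) := V p.2 p.1 * itvf a t p.2.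

Let lgs s : L2 mu (fun r => g r * itvf a s r) /\ nrm mu (fun r => g r * itvf a s r) <= nrm mu g.
Proof. exact: L2_itvfM. Qed.

(** The isometry bounds the second moments of V uniformly in time. *)
Lemma L2_path : L2 Pi U.
Proof.
have mU : measurable_fun [set: (Omega * measurableTypeR R)%type] U.
  apply: measurable_funM; first exact: (is_wint_meas hV).
  exact: (measurableT_comp (measurable_itvf a t)).
apply: L2P => //; rewrite fubini_tonelli2//; first last.
- by move=> p; rewrite lee_fin sqr_ge0.
- by apply/measurable_EFinP; exact: measurable_funX.
pose C := (nrm Pr xi * nrm mu g) ^+ 2.
apply: (@le_lt_trans _ _ (\int[mu]_s (C * itvf a t s)%:E)%E).
  apply: ge0_le_integral => //.
  - by move=> s _; apply: integral_ge0 => o _; rewrite lee_fin sqr_ge0.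
  - apply: (@measurable_fun_fubini_tonelli_G _ _ _ _ _ _ (fun p => ((U p) ^+ 2)%:E)).
      by apply/measurable_EFinP; exact: measurable_funX.
    by move=> p; rewrite lee_fin sqr_ge0.
  - by apply/measurable_EFinP; apply: measurable_funM => //; exact: measurable_itvf.
  - move=> s _; rewrite /fubini_G /U /= itvfE; case: (boolP (_ && _)) => /= h; last first.
      rewrite mulr0 integral0_eq// => o _; rewrite mulr0 expr0n//.
    have /andP[as_ _] := h.
    have hs := is_wint_ito hV as_; have [_ lV _] := hs.
    under eq_integral do rewrite mulr1.
    rewrite (nrm2E lV) lee_fin mulr1 /C ler_sqr ?nnegrE ?mulr_ge0 ?nrm_ge0//.
    rewrite -(ito_isometry hw a0 hs) nrm_tens//; last by have [] := lgs s.
    by apply: ler_wpM2l; [exact: nrm_ge0|have [] := lgs s].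
have [li _] := int_itvf at_.
by rewrite (fin_L1 (L1Z C li)) ltry.
Qed.

Variables (f G : R -> R).
Hypotheses (cf : continuous f) (dG : forall s, is_derive s (1 : R) G (f s)).

Let b (s : measurableTypeR R) := f s * itvf a t s.
Let lb : L2 mu b. Proof. exact: L2_cts. Qed.

Let Rt := partial_int mu U b.

Variable Y : Omega -> R.
Hypothesis hY : ito Pr F w a t (tens xi (fun s => g s * ((G t - G s) * itvf a t s))) Y.

Let lGg : L2 mu (fun s => g s * ((G t - G s) * itvf a t s)).
Proof.
have cG : continuous G.
  by move=> s; apply: differentiable_continuous; apply/derivable1_diffP; case: (dG s).
have [l _] := lgs t.
have cGt : continuous (fun s => G t - G s) by move=> s; apply: cvgB; [exact: cvg_cst|exact: cG].
have := ctsM_itvf cGt l; move=> /(_ a t).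
have -> : (fun s => (G t - G s) * (g s * itvf a t s)) = (fun s => g s * ((G t - G s) * itvf a t s)).
  by apply/funext => s; ring.
by apply=> s; rewrite -mulrA -expr2 itvf_sqr.
Qed.

Let lY : L2 Pr Y. Proof. by have [] := hY. Qed.
Let lR : L2 Pr Rt. Proof. exact: L2_partial L2_path lb. Qed.

Let ipR Z : L2 Pr Z -> ip Pr Rt Z = \int[mu]_s (b s * ip Pr (V s) Z).
Proof.
move=> lZ; rewrite /Rt (ip_partial2 L2_path lb lZ); apply: eq_int => s.
rewrite /b /U/= itvfE; case: (_ && _); rewrite ?mulr0 ?mul0r// mulr1.
by congr (_ * _); apply: eq_int => o; rewrite mulr1.
Qed.

(** Against an Ito integral Z both sides become, by the isometry, integrals of
    deterministic functions, where triangle_fubini applies. *)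
Let dual g' Z : L2 mu g' -> ito Pr F w a t (tens xi g') Z -> ip Pr Rt Z = ip Pr Y Z.
Proof.
move=> lg' hZ; have [_ lZ _] := hZ.
rewrite ipR// -(ito_ip hw a0 hY hZ) ip_tens//.
have lgg : L1 mu (fun r => g r * g' r) by exact: L2M.
transitivity (ip Pr xi xi * \int[mu]_s (f s * itvf a t s * \int[mu]_r (g r * g' r * itvf a s r))).
  rewrite -intZl; last exact: triangle_fubini_L1.
  apply: eq_int => s; rewrite /b itvfE; case: (boolP (_ && _)) => h; last by rewrite !(mulr0, mul0r).
  have /andP[as_ st] := h.
  have hs := ito_widen (lexx a) (ltW st) (is_wint_ito hV as_).
  rewrite -(ito_ip hw a0 hs hZ) ip_tens//; last by have [] := lgs s.
  rewrite mulrCA; congr (_ * (_ * _)); apply: eq_int => r; ring.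
congr (_ * _); rewrite (triangle_fubini a t cf dG lgg).
by apply: eq_int => r; ring.
Qed.

(** Let D be the difference of the two sides. It is orthogonal to every Ito
    integral of xi times a deterministic function (dual). The right-hand side is
    such an integral and the left-hand side is a time integral of such
    integrals, so D is orthogonal to itself. *)
Lemma stochastic_fubini :
  {ae Pr, forall o, \int[mu]_s (f s * itvf a t s * V s o) = Y o}.
Proof.
have lD := L2B lR lY.
have D0 : nrm Pr (fun o => Rt o - Y o) = 0.
  apply/eqP; rewrite sqrtr_eq0 ipBl//.
  have -> : ip Pr Y (fun o => Rt o - Y o) = 0.
    rewrite ipBr// [ip Pr Y Rt]ipC (dual lGg hY); exact: subrr.
  rewrite ipR// (@eq_int _ _ _ mu _ (fun=> 0)).
    by rewrite Rintegral_cst// mul0r subr0.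
  move=> s; rewrite /b itvfE; case: (boolP (_ && _)) => h; last by rewrite mulr0 mul0r.
  have /andP[as_ st] := h.
  have hs := ito_widen (lexx a) (ltW st) (is_wint_ito hV as_).
  have [_ lV _] := hs; have [lgs' _] := lgs s.
  by rewrite ipBr// [ip Pr _ Rt]ipC [ip Pr _ Y]ipC (dual lgs' hs) subrr mulr0.
have := nrm0_ae lD D0; apply: filterS => o /eqP; rewrite subr_eq0 => /eqP <-.
apply: eq_int => s; rewrite /b /U /=.
by rewrite [in RHS]mulrACA -expr2 itvf_sqr; ring.
Qed.

End fubini.
End StochasticFubini.

(** * Uniqueness of trajectories *)

Section Integrals.
Context {d : measure_display} {T : measurableType d} {R : realType}.
Variable mu : {measure set T -> \bar R}.
Implicit Types f g : T -> R.

Lemma intD f g : L1 mu f -> L1 mu g ->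
  \int[mu]_x (f x + g x) = \int[mu]_x f x + \int[mu]_x g x.
Proof. by move=> lf lg; rewrite RintegralD. Qed.

Lemma intB f g : L1 mu f -> L1 mu g ->
  \int[mu]_x (f x - g x) = \int[mu]_x f x - \int[mu]_x g x.
Proof. by move=> lf lg; rewrite RintegralB. Qed.

Lemma L1B f g : L1 mu f -> L1 mu g -> L1 mu (fun x => f x - g x).
Proof. by move=> lf lg; exact: (integrableB _ lf lg). Qed.

Lemma L1_norm f : L1 mu f -> L1 mu (fun x => `|f x|).
Proof.
move=> lf; apply: (@L1_le _ _ _ _ _ f) => //; last by move=> x; rewrite normr_id.
by apply: measurableT_comp => //; exact: L1_meas lf.
Qed.

Lemma le_int f g : L1 mu f -> L1 mu g -> (forall x, f x <= g x) ->
  \int[mu]_x f x <= \int[mu]_x g x.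
Proof. by move=> lf lg fg; apply: le_Rintegral. Qed.

Lemma int_ge0 f : (forall x, 0 <= f x) -> 0 <= \int[mu]_x f x.
Proof. by move=> f0; apply: Rintegral_ge0. Qed.

Lemma norm_int_le f : L1 mu f -> `|\int[mu]_x f x| <= \int[mu]_x `|f x|.
Proof. by move=> lf; apply: le_normr_Rintegral. Qed.

Lemma ae_le_int f g : L1 mu f -> L1 mu g -> {ae mu, forall x, f x <= g x} ->
  \int[mu]_x f x <= \int[mu]_x g x.
Proof.
move=> lf lg fg; have mf := L1_meas lf; have mg := L1_meas lg.
have mm : measurable_fun [set: T] (fun x => Num.max (f x) (g x)).
  exact: measurable_maxr.
have e : {ae mu, forall x, g x = Num.max (f x) (g x)}.
  by apply: filterS fg => x h; rewrite max_r.
rewrite (ae_int mg mm e); apply: le_int => //; first exact: ae_L1 lg.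
by move=> x; rewrite le_max lexx.
Qed.

End Integrals.

Lemma ae_and {d} {T : measurableType d} {R : realType} (mu : {measure set T -> \bar R})
  (P Q : T -> Prop) : {ae mu, forall x, P x} -> {ae mu, forall x, Q x} ->
  {ae mu, forall x, P x /\ Q x}.
Proof. by move=> hP hQ; apply: filterS2 hP hQ. Qed.

(** Together, ae_prod1 and ae_prod2 exchange two almost-everywhere quantifiers.
    They need h to be jointly measurable, which is why joint measurability of
    the processes is tracked throughout. *)
Section AlmostEverySection.
Context {d1 d2 : measure_display} {T1 : measurableType d1} {T2 : measurableType d2}
  {R : realType}.
Variables (m1 : {sigma_finite_measure set T1 -> \bar R})
  (m2 : {sigma_finite_measure set T2 -> \bar R}).
Variable h : T1 * T2 -> R.
Hypothesis mh : measurable_fun [set: (T1 * T2)%type] h.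

Let ma : measurable_fun [set: (T1 * T2)%type] (fun p => (`|h p|)%:E).
Proof. by apply/measurable_EFinP; apply: measurableT_comp. Qed.

Let a0 p : (0 <= (`|h p|)%:E)%E. Proof. by rewrite lee_fin. Qed.

Let abs0 d (T : measurableType d) (m : {measure set T -> \bar R}) (f : T -> R) :
  measurable_fun [set: T] f ->
  {ae m, forall x, f x = 0} <-> (\int[m]_x (`|f x|)%:E = 0)%E.
Proof.
move=> mf; have := @ae_eq_integral_abs _ _ _ m setT measurableT (EFin \o f).
case; first exact/measurable_EFinP.
move=> h1 h2; split => [fe|/h1].
  by apply: h2; apply: filterS fe => x e _; rewrite /= e.
by apply: filterS => x /(_ I) [].
Qed.

Let eabs0 d (T : measurableType d) (m : {measure set T -> \bar R}) (f : T -> \bar R) :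
  measurable_fun [set: T] f -> (forall x, 0 <= f x)%E ->
  {ae m, forall x, f x = 0%E} <-> (\int[m]_x f x = 0)%E.
Proof.
move=> mf f0; have := @ae_eq_integral_abs _ _ _ m setT measurableT f mf.
rewrite (eq_integral f); last by move=> x _; rewrite gee0_abs.
case=> h1 h2; split => [fe|/h1].
  by apply: h2; apply: filterS fe => x e _.
by apply: filterS => x /(_ I).
Qed.

Lemma ae_prod1 : {ae m1, forall x, {ae m2, forall y, h (x, y) = 0}} <->
  {ae (m1 \x m2)%E, forall p, h p = 0}.
Proof.
apply: iff_trans (iff_sym (abs0 _ mh)).
rewrite fubini_tonelli1// -eabs0//; first last.
- by move=> x; apply: integral_ge0.
- exact: measurable_fun_fubini_tonelli_F.
by split; apply: filterS => x /abs0; apply; exact: (measurableT_comp mh (measurable_pair1 x)).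
Qed.

Lemma ae_prod2 : {ae m2, forall y, {ae m1, forall x, h (x, y) = 0}} <->
  {ae (m1 \x m2)%E, forall p, h p = 0}.
Proof.
apply: iff_trans (iff_sym (abs0 _ mh)).
rewrite fubini_tonelli2// -eabs0//; first last.
- by move=> x; apply: integral_ge0.
- exact: measurable_fun_fubini_tonelli_G.
by split; apply: filterS => x /abs0; apply; exact: (measurableT_comp mh (measurable_pair2 x)).
Qed.

End AlmostEverySection.

Section Gronwall.
Context {R : realType}.
Notation mu := (@lebesgue_measure R).

Lemma itvf_split a b c (s : R) : a <= b -> b <= c ->
  itvf a c s = itvf a b s + itvf b c s.
Proof.
move=> ab bc; rewrite !itvf_increment//; last exact: le_trans bc.
by ring.
Qed.

Lemma itvf_ge0 a b (s : R) : 0 <= itvf a b s.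
Proof. by rewrite itvfE ler0n. Qed.

(** Let Phi b be the integral of phi over [0, b[. If Phi vanishes at a and c (b
    - a) < 1, then Phi b <= c (b - a) Phi b forces Phi b = 0; finitely many such
    steps reach T. Only integrability of phi enters, as the paths of the
    solutions are not known to be continuous. *)
Lemma gronwall0 (phi : measurableTypeR R -> R) c T : 0 <= T -> 0 <= c ->
  L1 mu phi -> (forall s, 0 <= phi s) ->
  {ae mu, forall s, phi s <= c * (\int[mu]_r (phi r * itvf 0 s r)) * itvf 0 T s} ->
  \int[mu]_s phi s = 0.
Proof.
move=> T0 c0 l p0 ineq; pose Phi b := \int[mu]_r (phi r * itvf 0 b r).
have Phi0 b : 0 <= Phi b by apply: int_ge0 => s; rewrite mulr_ge0 ?itvf_ge0.
have step a b : 0 <= a -> a <= b -> c * (b - a) < 1 -> Phi a = 0 -> Phi b = 0.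
  move=> a0 ab cab Pa.
  have : Phi b <= c * Phi b * (b - a).
    rewrite {1}/Phi (@eq_int _ _ _ mu _ (fun s => phi s * itvf 0 a s + phi s * itvf a b s)); last first.
      by move=> s; rewrite (itvf_split s a0 ab) mulrDr.
    rewrite intD ?L1_itvf// -/(Phi a) Pa add0r.
    have [li <-] := int_itvf ab; rewrite -intZl//.
    apply: ae_le_int; [exact: L1_itvf|exact: L1Z|].
    apply: filterS ineq => s hs; rewrite itvfE; case: (boolP (_ && _)) => h; last by rewrite !mulr0.
    rewrite !mulr1; apply: le_trans hs _; rewrite itvfE.
    apply: (@le_trans _ _ (c * Phi s)).
      by rewrite -/(Phi s) ler_piMr ?(mulr_ge0 c0 (Phi0 s))//; case: (_ && _); rewrite ?ler01 ?lexx.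
    rewrite ler_wpM2l//; apply: le_int; [exact: L1_itvf|exact: L1_itvf|] => r.
    rewrite ler_wpM2l// !itvfE ler_nat; case: (leP 0 r) => //= r0.
    have /andP[_ sb] := h.
    by case: (ltP r s) => //= rs; rewrite (lt_trans rs sb).
  rewrite mulrAC => h; apply: le_anti; rewrite Phi0 andbT.
  have : (1 - c * (b - a)) * Phi b <= 0 by rewrite mulrBl mul1r subr_le0.
  by rewrite pmulr_rle0// subr_gt0.
have PhiT : Phi T = 0.
  have cT0 : 0 <= c * T by exact: mulr_ge0.
  (* M equal steps have length less than 1 / c. *)
  pose M := (Num.truncn (c * T)).+1.
  have cM : c * T < M%:R by exact: truncnS_gt.
  have M0 : 0 < M%:R :> R by rewrite ltr0n.
  pose dlt := T / M%:R.
  have d0 : 0 <= dlt by rewrite divr_ge0// ler0n.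
  have -> : T = M%:R * dlt by rewrite /dlt mulrC divfK// gt_eqF.
  suff H (k : nat) : Phi (k%:R * dlt) = 0 by exact: H.
  elim: k => [|k ih].
    rewrite mul0r /Phi (@eq_int _ _ _ mu _ (fun=> 0)) => [|s].
      by rewrite Rintegral_cst// mul0r.
    by rewrite itvfE; case: (leP 0 s); rewrite /= mulr0.
  apply: (step (k%:R * dlt)) => //.
  - by rewrite mulr_ge0// ler0n.
  - by rewrite ler_wpM2r// ler_nat.
  - by rewrite -mulrBl -natrB// subSnn mul1r /dlt mulrA ltr_pdivrMr// mul1r.
rewrite -[RHS]PhiT; apply: ae_int; [exact: L1_meas l|exact: L1_meas (L1_itvf 0 T l)|].
apply: filterS ineq => s hs; rewrite itvfE; case: (boolP (_ && _)) => h; first by rewrite mulr1.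
by rewrite mulr0; apply: le_anti; rewrite p0 andbT; move: hs; rewrite itvfE (negbTE h) mulr0.
Qed.

Lemma L1_itv a b (f : measurableTypeR R -> R) :
  mu.-integrable `[a, b[ (EFin \o f) <-> L1 mu (fun s => f s * itvf a b s).
Proof.
have mI : measurable (`[a, b[%classic : set (measurableTypeR R)) by exact: measurable_itv.
have -> : L1 mu (fun s => f s * itvf a b s) =
   mu.-integrable setT ((EFin \o f) \_ (`[a, b[%classic : set (measurableTypeR R))).
  congr (integrable _ _ _); apply/funext => s.
  rewrite /= patchE itvfE mem_setE in_itv/=.
  by case: (_ && _); rewrite ?mulr1 ?mulr0.
exact: integrable_mkcond.
Qed.

Lemma measurable_itvf2 a : measurable_fun [set: (measurableTypeR R * measurableTypeR R)%type]
  (fun p : measurableTypeR R * measurableTypeR R => itvf a p.2 p.1).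
Proof.
have m1 : measurable_fun [set: (measurableTypeR R * measurableTypeR R)%type]
    (fun p : measurableTypeR R * measurableTypeR R => p.1 : R) by exact: measurable_fst.
have m2 : measurable_fun [set: (measurableTypeR R * measurableTypeR R)%type]
    (fun p : measurableTypeR R * measurableTypeR R => p.2 : R) by exact: measurable_snd.
rewrite (_ : (fun p => _) = (fun p : measurableTypeR R * measurableTypeR R =>
  if (a <= p.1) && ((p.1 : R) < p.2) then 1 else 0 : R)).
  apply: measurable_fun_ifT => //; apply: measurable_and.
    exact: measurable_fun_ler.
  exact: measurable_fun_ltr.
by apply/funext => -[x y] /=; rewrite itvfE; case: (_ && _).
Qed.

End Gronwall.

Section Uniqueness.
Context {d : measure_display} {Omega : measurableType d} {R : realType}.
Variable Pr : probability Omega R.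
Variable F : R -> set (set Omega).
Variable w : R -> Omega -> R.
Hypothesis hw : wiener_process Pr F w.
Notation mu := (@lebesgue_measure R).
Notation Pi := (Pr \x mu)%E.
Context {n m : nat}.
Variables (A : 'M[R]_n) (B : 'M[R]_(n, m)) (sigma T : R) (x : 'cV[R]_n).
Variables (u u' : R -> Omega -> 'cV[R]_m) (X X' : R -> Omega -> 'cV[R]_n).
Hypotheses (T0 : 0 <= T).
Hypotheses (hX : state_solution Pr F w A B sigma T x u X)
  (hX' : state_solution Pr F w A B sigma T x u' X').
Hypothesis hu : {ae mu, forall t, t \in `[0, T[ -> {ae Pr, forall o, u t o = u' t o}}.

Let aectrl : {ae (mu : {sigma_finite_measure set (measurableTypeR R) -> \bar R}),
  forall t : measurableTypeR R, (t : R) \in `[0, T[ -> {ae Pr, forall o, u t o = u' t o}}.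
Proof. exact: hu. Qed.

Let mT : measurable ((`[0%R, T[ : set (measurableTypeR R)) `*` [set: Omega]).
Proof. by apply: measurableX => //; exact: measurable_itv. Qed.

Let meas_ctrl v Y : state_solution Pr F w A B sigma T x v Y -> forall i,
  measurable_fun ((`[0, T[ : set (measurableTypeR R)) `*` setT)
        (fun p : measurableTypeR R * Omega => (B *m v p.1 p.2) i 0).
Proof.
move=> h i; have [|I [hI _]] := state_equation h (t := T); first by rewrite T0 lexx.
by have [] := hI i.
Qed.

Let meas_drift v Y : state_solution Pr F w A B sigma T x v Y -> forall i,
  measurable_fun ((`[0, T[ : set (measurableTypeR R)) `*` setT)
        (fun p : measurableTypeR R * Omega => (A *m Y p.1 p.2 + B *m v p.1 p.2) i 0).
Proof.
move=> h i.
rewrite (_ : (fun p => _) = (fun p : measurableTypeR R * Omega =>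
  \sum_j A i j * Y p.1 p.2 j 0 + (B *m v p.1 p.2) i 0)); last first.
  by apply/funext => p; rewrite !mxE.
apply: measurable_funD; last exact: meas_ctrl h i.
apply: measurable_sum => j; apply: measurable_funM => //.
apply: measurable_funS (state_measurable h j).
- by apply: measurableX => //; exact: measurable_itv.
- by move=> [s o] /= []; rewrite !in_itv/= => /andP[-> /ltW ->].
Qed.

Let dctrl i : Omega * measurableTypeR R -> R :=
  fun p => cut T (fun s o => (B *m u s o) i 0) p - cut T (fun s o => (B *m u' s o) i 0) p.

Let dctrl0 i : {ae Pi, forall p, dctrl i p = 0}.
Proof.
have md : measurable_fun [set: (Omega * measurableTypeR R)%type] (dctrl i).
  by apply: measurable_funB; apply: measurable_cut; [exact: (meas_ctrl hX)|exact: (meas_ctrl hX')].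
apply/(ae_prod2 Pr mu md); apply: filterS aectrl => s hs.
have [sT|sT] := boolP (s \in `[0, T[).
  by apply: filterS (hs sT) => o e; rewrite /dctrl /cut /= e subrr.
by apply: filterE => o; move: sT; rewrite /dctrl /cut /= itvfE in_itv/= => /negbTE ->; rewrite !mulr0 subrr.
Qed.

(** The controls agree, hence so do the two integrands in L2, and the isometry
    makes the noises agree at each fixed time. *)
Let noise_eq t I I' i : 0 <= t <= T ->
  is_ito_integral Pr F w t (fun s o => (B *m u s o) i 0) I ->
  is_ito_integral Pr F w t (fun s o => (B *m u' s o) i 0) I' ->
  {ae Pr, forall o, I o = I' o}.
Proof.
move=> /andP[t0 tT] hI hI'.
have iI := is_ito_ito hw t0 hI; have iI' := is_ito_ito hw t0 hI'.
apply: (ito_unique hw (lexx 0) iI iI').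
have [lI _ _] := iI; have [lI' _ _] := iI'.
apply: nrm_ae0; first exact: L2B.
apply: filterS (dctrl0 i) => -[y s]; rewrite /dctrl /cut /= !itvfE.
case: (leP 0 s) => s0 /=; last by rewrite !mulr0 subrr.
case: (ltP s t) => st; last by rewrite !mulr0 subrr.
by rewrite (lt_le_trans st tT).
Qed.

Let psi i : Omega * measurableTypeR R -> R :=
  fun p => cut T (fun s o => (A *m X s o + B *m u s o) i 0) p -
           cut T (fun s o => (A *m X' s o + B *m u' s o) i 0) p.

Let mpsi i : measurable_fun [set: (Omega * measurableTypeR R)%type] (psi i).
Proof.
by apply: measurable_funB; apply: measurable_cut; [exact: (meas_drift hX)|exact: (meas_drift hX')].
Qed.

Let lpsi : {ae Pr, forall o, forall i, L1 mu (fun s => psi i (o, s))}.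
Proof.
apply: filterS2 (state_drift hX) (state_drift hX') => o h h' i.
by apply: L1B; [have := h i|have := h' i]; move=> /L1_itv.
Qed.

Let psi_itv o i t : 0 <= t <= T -> L1 mu (fun s => psi i (o, s)) ->
  forall s, psi i (o, s) * itvf 0 t s =
    (A *m X s o + B *m u s o) i 0 * itvf 0 t s - (A *m X' s o + B *m u' s o) i 0 * itvf 0 t s.
Proof.
move=> /andP[t0 tT] l s; rewrite /psi /cut /= !itvfE.
case: (leP 0 s) => s0 /=; last by rewrite !mulr0 subrr.
case: (ltP s t) => st; last by rewrite !mulr0 subrr.
by rewrite (lt_le_trans st tT) !mulr1.
Qed.

Let state_diff t : 0 <= t <= T -> {ae Pr, forall o, forall i,
  X t o i 0 - X' t o i 0 = \int[mu]_s (psi i (o, s) * itvf 0 t s)}.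
Proof.
move=> ht; have [I [hI eI]] := state_equation hX ht.
have [I' [hI' eI']] := state_equation hX' ht.
have eII : {ae Pr, forall o, forall i, I o i 0 = I' o i 0}.
  by apply: filter_forall => i; exact: noise_eq ht (hI i) (hI' i).
have h1 := ae_and eI eI'; have h2 := ae_and (state_drift hX) (state_drift hX').
have h3 := ae_and eII (ae_and lpsi h2).
apply: filterS2 h1 h3 => o [e e'] [eo [l [ld ld']]] i; rewrite e e' eo.
rewrite (@eq_int _ _ _ mu _ _ (psi_itv ht (l i))).
have cutl (v : R -> Omega -> 'cV[R]_m) (Y : R -> Omega -> 'cV[R]_n) : mu.-integrable `[0, T[ (fun s => ((A *m Y s o + B *m v s o) i 0)%:E) ->
    L1 mu (fun s => (A *m Y s o + B *m v s o) i 0 * itvf 0 t s).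
  move=> /L1_itv /(@L1_itvf _ _ 0 t); apply: L1_eq => s; rewrite -mulrA; congr (_ * _).
  have /andP[_ tT] := ht; rewrite !itvfE; case: (leP 0 s) => s0 /=; last by rewrite mulr0.
  by case: (ltP s t) => st; rewrite ?mulr0// (lt_le_trans st tT) mulr1.
by rewrite intB; [|exact: cutl (ld i)|exact: cutl (ld' i)]; rewrite !int_itvf_itv; ring.
Qed.

Let phi (p : Omega * measurableTypeR R) : R := \sum_i `|psi i p|.

Let mphi : measurable_fun [set: (Omega * measurableTypeR R)%type] phi.
Proof. by apply: measurable_sum => i; apply: measurableT_comp. Qed.

Let lphi o : (forall i, L1 mu (fun s => psi i (o, s))) -> L1 mu (fun s => phi (o, s)).
Proof. by move=> l; apply: L1_sum => i _; exact: L1_norm. Qed.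

Let int_psi_le o i t : (forall i, L1 mu (fun s => psi i (o, s))) ->
  `|\int[mu]_s (psi i (o, s) * itvf 0 t s)| <= \int[mu]_s (phi (o, s) * itvf 0 t s).
Proof.
move=> l; apply: le_trans (norm_int_le (L1_itvf 0 t (l i))) _.
apply: le_int; [exact: L1_norm (L1_itvf 0 t (l i))|exact: L1_itvf (lphi l)|] => s.
rewrite normrM (ger0_norm (itvf_ge0 _ _ _)) ler_wpM2r ?itvf_ge0// /phi.
by rewrite (bigD1 i)//= lerDl sumr_ge0.
Qed.

Let bound (p : Omega * measurableTypeR R) : R :=
  mxsum A * (\int[mu]_r (phi (p.1, r) * itvf 0 p.2 r)) * itvf 0 T p.2.

Let mbound : measurable_fun [set: (Omega * measurableTypeR R)%type] bound.
Proof.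
apply: measurable_funM; last exact: (measurableT_comp (measurable_itvf 0 T)).
apply: measurable_funM => //.
apply: measurableT_comp; first exact: fine_measurable.
pose f (q : measurableTypeR R * (Omega * measurableTypeR R)) := phi (q.2.1, q.1) * itvf 0 q.2.2 q.1.
apply: (@measurable_int_param _ _ _ _ R mu f).
apply: measurable_funM.
  apply: (measurableT_comp mphi); apply: measurable_fun_pair => //.
  exact: (measurableT_comp measurable_fst measurable_snd).
apply: (measurableT_comp (measurable_itvf2 0) (g := fun q => (q.1, q.2.2))).
apply: measurable_fun_pair => //.
exact: (measurableT_comp measurable_snd measurable_snd).
Qed.

(** The difference of the two equations holds almost surely at each time; joint
    measurability exchanges the quantifiers, so that almost every path satisfies
    the integral inequality at almost every time. *)
Let phi_bound : {ae Pr, forall o, {ae mu, forall s, phi (o, s) <= bound (o, s)}}.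
Proof.
pose h p := Num.max 0 (phi p - bound p).
have mh : measurable_fun [set: (Omega * measurableTypeR R)%type] h.
  by apply: measurable_maxr => //; exact: measurable_funB.
suff : {ae Pr, forall o, {ae mu, forall s, h (o, s) = 0}}.
  apply: filterS => o; apply: filterS => s; rewrite /h => e.
  by rewrite -subr_le0 -[leRHS]e le_max lexx orbT.
apply/(ae_prod1 Pr mu mh)/(ae_prod2 Pr mu mh); apply: filterS aectrl => s hs.
have [sT|sT] := boolP (s \in `[0, T[); last first.
  apply: filterE => o; rewrite /h /bound /phi /psi /cut /= itvfE.
  move: sT; rewrite in_itv/= => /negbTE ->; rewrite mulr0 subr0 big1 ?maxxx// => i _.
  by rewrite !mulr0 subrr normr0.
have sT' : 0 <= s <= T by move: sT; rewrite in_itv/= => /andP[-> /ltW].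
apply: filterS2 (ae_and (hs sT) lpsi) (state_diff sT') => o [eu l] dX.
have i1 : itvf 0 T s = 1 by rewrite itvfE; move: sT; rewrite in_itv/= => ->.
rewrite /h max_l// subr_le0 /bound /= i1 mulr1.
set b := \int[mu]_r _.
apply: (@le_trans _ _ (\sum_i \sum_j `|A i j| * b)); last first.
  by rewrite /mxsum mulr_suml ler_sum// => i _; rewrite mulr_suml.
apply: ler_sum => i _.
have -> : psi i (o, s) = \sum_j A i j * (X s o j 0 - X' s o j 0).
  rewrite /psi /cut /= i1 !mulr1 eu !mxE opprD addrACA subrr addr0 -sumrB.
  by apply: eq_bigr => j _; rewrite mulrBr.
apply: le_trans (ler_norm_sum _ _ _) _; apply: ler_sum => j _.
rewrite normrM ler_wpM2l// dX; exact: int_psi_le.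
Qed.

(** The noises cancel, so the difference of two solutions satisfies path by path
    a homogeneous linear integral equation, to which gronwall0 applies. *)
Lemma state_solution_unique t : 0 <= t <= T -> {ae Pr, forall o, X t o = X' t o}.
Proof.
move=> ht; apply: filterS2 (ae_and phi_bound lpsi) (state_diff ht) => o [pb l] dX.
have lp := lphi l; have p0 s : 0 <= phi (o, s) by apply: sumr_ge0.
have i0 := gronwall0 T0 (mxsum_ge0 A) lp p0 pb.
apply/matrixP => i j; rewrite ord1; apply/eqP; rewrite -subr_eq0 -normr_eq0.
rewrite normr_eq0 -normr_le0 dX; apply: le_trans (int_psi_le i t l) _; rewrite -[leRHS]i0.
apply: le_int => //; first exact: L1_itvf.
by move=> s; rewrite itvfE ler_piMr//; case: (_ && _).
Qed.

End Uniqueness.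

(** * The state over one sampling period *)

Section OnePeriod.
Context {d : measure_display} {Omega : measurableType d} {R : realType}.
Variable Pr : probability Omega R.
Variable F : R -> set (set Omega).
Variable w : R -> Omega -> R.
Hypothesis hw : wiener_process Pr F w.
Notation mu := (@lebesgue_measure R).
Notation Pi := (Pr \x mu)%E.

Lemma ito_ext a T H H' I I' : ito Pr F w a T H I -> (forall p, H p = H' p) ->
  (forall o, I o = I' o) -> ito Pr F w a T H' I'.
Proof. by move=> h /funext <- /funext <-. Qed.

Lemma measurable_time (f : measurableTypeR R -> R) :
  measurable_fun [set: measurableTypeR R] f ->
  measurable_fun [set: (Omega * measurableTypeR R)%type]
    (fun q : Omega * measurableTypeR R => f q.2).
Proof. by move=> mf; exact: (measurableT_comp mf). Qed.

Context {n : nat}.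
Variables (A : 'M[R]_n) (sigma a b : R).
Hypotheses (a0 : 0 <= a) (ab : a < b).
Variables (xi : 'I_n -> Omega -> R) (kap : measurableTypeR R -> 'M[R]_n).
Hypotheses (wxi : forall j, measurable_wrt (F a) (xi j)) (lxi : forall j, L2 Pr (xi j)).
Hypotheses (lkap : forall i j, L2 mu (fun s => kap s i j))
  (skap : forall i j s, kap s i j * itvf a b s = kap s i j).

Let E (t : R) := expmx (t *: A).

Let E_inv t : E t *m E (- t) = 1%:M.
Proof. by rewrite /E -expmxD subrr expmx0. Qed.

Let cE i j : continuous (fun t => E t i j). Proof. exact: continuous_expmx. Qed.

Let cEN i j : continuous (fun t => E (- t) i j).
Proof. by move=> t; apply: (@continuous_comp _ _ _ -%R (fun t => E t i j)); [exact: opp_continuous|exact: cE]. Qed.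

Let cAE i j : continuous (fun t => (A *m E t) i j).
Proof. by apply: ctsmxM; [exact: ctsmx_cst|exact: ctsmx_expmx]. Qed.

Let h l j (s : measurableTypeR R) := (E (- (s : R)) *m kap s) l j.
Let hh i l j (s : measurableTypeR R) := E s i l * h l j s.

Let sh l j s : h l j s * itvf a b s = h l j s.
Proof. by rewrite /h !mxE mulr_suml; apply: eq_bigr => k _; rewrite -mulrA skap. Qed.

Let lh l j : L2 mu (h l j).
Proof.
have -> : h l j = (fun s : measurableTypeR R => \sum_k E (- (s : R)) l k * kap s k j).
  by apply/funext => s; rewrite /h mxE.
by apply: L2_sum => k _; apply: (@ctsM_itvf _ _ a b).
Qed.

Let shh i l j s : hh i l j s * itvf a b s = hh i l j s.
Proof. by rewrite /hh -mulrA sh. Qed.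

Let lhh i l j : L2 mu (hh i l j).
Proof. by apply: (@ctsM_itvf _ _ a b). Qed.

Let sum_hh i j s : \sum_l hh i l j s = kap s i j.
Proof.
transitivity ((E s *m (E (- (s : R)) *m kap s)) i j); first by rewrite [RHS]mxE.
by rewrite mulmxA E_inv mul1mx.
Qed.

Let L2L1 f : L2 mu f -> (forall s, f s * itvf a b s = f s) -> L1 mu f.
Proof. by move=> lf sf; apply: (L1_eq sf); exact: (L2M lf (L2_itvf a b)). Qed.

Let lh1 l j : L1 mu (h l j). Proof. exact: (L2L1 (lh l j) (@sh l j)). Qed.
Let lhh1 i l j : L1 mu (hh i l j). Proof. exact: (L2L1 (lhh i l j) (@shh i l j)). Qed.

Variables (V : 'I_n -> 'I_n -> R -> Omega -> R)
  (W : 'I_n -> 'I_n -> 'I_n -> R -> Omega -> R).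
Hypotheses (hV : forall l j, is_wint Pr F w a (h l j) (xi j) (V l j))
  (hW : forall i l j, is_wint Pr F w a (hh i l j) (xi j) (W i l j)).

Definition drift_coef l j (t : R) : R := \int[mu]_r (h l j r * itvf a t r).
Let D := drift_coef.

Let z l j t o := (E (- a) l j + D l j t) * xi j o + sigma * V l j t o.
Let Z l t o := \sum_j z l j t o.
(** Variation of constants: with h = exp (- A s) kap, the state at time t is exp
    (A t) applied to exp (- A a) xi plus the integral of h xi against ds + sigma
    dw over [a, t]; V l j is the Ito integral of h l j times xi j. *)
Definition period_path t o : 'cV[R]_n := \col_i \sum_l E t i l * Z l t o.
Definition period_noise i t o := \sum_j \sum_l W i l j t o.
Let Y := period_path.
Let J := period_noise.

Lemma period_wrt t i : a <= t -> measurable_wrt (F t) (fun o => Y t o i 0).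
Proof.
move=> at_; have t0 := le_trans a0 at_; have s0 := sF hw t0.
rewrite (_ : (fun o => _) = (fun o => \sum_l E t i l * Z l t o)); last first.
  by apply/funext => o; rewrite mxE.
apply: wrt_sum => // l; apply: wrtM => //; first exact: wrt_cst.
apply: wrt_sum => // j; apply: wrtD => //; apply: wrtM => //; try exact: wrt_cst.
- exact: (wrt_mono hw a0 at_).
- exact: (is_wint_wrt (hV l j)).
Qed.

Lemma period_measurable i :
  measurable_fun [set: (Omega * measurableTypeR R)%type] (fun q => Y q.2 q.1 i 0).
Proof.
rewrite (_ : (fun o => _) = (fun q : Omega * measurableTypeR R =>
    \sum_l E q.2 i l * \sum_j ((E (- a) l j + D l j q.2) * xi j q.1 + sigma * V l j q.2 q.1))); last first.
  by apply/funext => o; rewrite mxE.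
apply: measurable_sum => l; apply: measurable_funM.
  apply: (@measurable_time (fun t : measurableTypeR R => E t i l)); exact: cts_meas.
apply: measurable_sum => j; apply: measurable_funD; apply: measurable_funM => //.
- apply: measurable_funD => //.
  suff mD : measurable_fun [set: measurableTypeR R] (D l j).
    exact: (measurable_time mD).
  apply: measurableT_comp; first exact: fine_measurable.
  apply: (@measurable_int_param _ _ _ _ R mu (fun p => h l j p.1 * itvf a p.2 p.1)).
  apply: measurable_funM; last exact: measurable_itvf2.
  exact: (measurableT_comp (L2_meas (lh l j)) (@measurable_fst _ _ (measurableTypeR R) (measurableTypeR R))).
- exact: (measurableT_comp (L2_meas (lxi j)) (@measurable_fst _ _ Omega (measurableTypeR R))).
- exact: is_wint_meas (hV l j).
Qed.

Let drift_term i l j o (s : measurableTypeR R) := (A *m E s) i l * z l j s o.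

Let drift_sum i t o (s : measurableTypeR R) :
  (A *m Y s o + kap s *m \col_j xi j o) i 0 * itvf a t s =
  \sum_l \sum_j (drift_term i l j o s * itvf a t s) + \sum_j xi j o * (kap s i j * itvf a t s).
Proof.
rewrite [X in X * _]mxE mulrDl; congr (_ + _); last first.
  by rewrite mxE mulr_suml; apply: eq_bigr => j _; rewrite mxE; ring.
have -> : (A *m Y s o) i 0 = \sum_l (A *m E s) i l * Z l s o.
  transitivity ((A *m (E s *m \col_l Z l s o)) i 0).
    by congr ((_ *m _) _ _); apply/matrixP => p q; rewrite !mxE; apply: eq_bigr => l _; rewrite mxE.
  by rewrite mulmxA [LHS]mxE; apply: eq_bigr => l _; rewrite [X in _ * X]mxE.
rewrite mulr_suml; apply: eq_bigr => l _; rewrite /Z mulr_sumr mulr_suml.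
by apply: eq_bigr.
Qed.

(** The drift of the formula integrates an exponential against integrals of h;
    triangle_fubini handles the time integral and stochastic_fubini the noise.
    Both produce the difference of the exponentials at the two ends, whose
    second part is the integral of hh. *)
Let drift_int i l j t : a <= t -> t <= b -> {ae Pr, forall o,
  L1 mu (fun s => drift_term i l j o s * itvf a t s) /\
  \int[mu]_s (drift_term i l j o s * itvf a t s) =
    (E t i l - E a i l) * E (- a) l j * xi j o
    + (E t i l * D l j t - \int[mu]_s (hh i l j s * itvf a t s)) * xi j o
    + sigma * (E t i l * V l j t o - W i l j t o)}.
Proof.
move=> at_ tb; pose f s := (A *m E s) i l; pose G s := E s i l.
have cf : continuous f by exact: cAE.
have dG s : is_derive s (1 : R) G (f s) by exact: is_derive_expmx.
have sub_itv (g : measurableTypeR R -> R) s : g s * itvf a b s = g s -> g s * itvf a t s * itvf a b s = g s * itvf a t s.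
  by move=> e; rewrite mulrAC e.
have hY : ito Pr F w a t (tens (xi j) (fun s => h l j s * ((G t - G s) * itvf a t s)))
    (fun o => E t i l * V l j t o - W i l j t o).
  have h1 := ito_scale hw a0 (E t i l) (is_wint_ito (hV l j) at_).
  have h2 := is_wint_ito (hW i l j) at_.
  apply: ito_ext (ito_sub hw a0 h1 h2) _ _ => // p.
  by rewrite /tens /hh /G /=; ring.
have V1 := stochastic_fubini hw a0 at_ (lh l j) (lxi j) (hV l j) cf dG hY.
have lU := L2_path hw a0 at_ (lh l j) (lxi j) (hV l j).
have V2 := ae_section_L2 lU.
apply: filterS2 V1 V2 => o e1 l2 /=.
have L1a : L1 mu (fun s => f s * itvf a t s) by exact: L1_cts.
have L1b := @triangle_fubini_L1 _ f (h l j) a t cf (lh1 l j).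
have L1c : L1 mu (fun s => f s * itvf a t s * V l j s o).
  have := ctsM_itvf cf l2; move=> /(_ a t) /=.
  move=> H; have {}H : L2 mu (fun s => f s * (V l j s o * itvf a t s)).
    by apply: H => s; rewrite -mulrA -expr2 itvf_sqr.
  apply: (L1_eq _ (L2M H (L2_itvf a t))) => s.
  rewrite -[in RHS](itvf_sqr a t s); ring.
have L1a' := L1Z (E (- a) l j * xi j o) L1a.
have L1b' := L1Z (xi j o) L1b; have L1c' := L1Z sigma L1c.
have eT s : drift_term i l j o s * itvf a t s =
  E (- a) l j * xi j o * (f s * itvf a t s) +
  xi j o * (f s * itvf a t s * \int[mu]_r (h l j r * itvf a s r)) +
  sigma * (f s * itvf a t s * V l j s o).
  by rewrite /drift_term /z /D /drift_coef /f; ring.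
have L1d := L1D (L1D L1a' L1b') L1c'.
split; first by apply: (L1_eq _ L1d) => s; rewrite eT.
rewrite (@eq_int _ _ _ mu _ _ eT) intD//; last exact: L1D.
rewrite intD// !intZl// e1 (int_ftc at_ cf dG) (triangle_fubini a t cf dG (lh1 l j)).
have -> : \int[mu]_r (h l j r * ((G t - G r) * itvf a t r)) =
   E t i l * D l j t - \int[mu]_s (hh i l j s * itvf a t s).
  rewrite /D /drift_coef -intZl; last exact: L1_itvf.
  rewrite -intB; first by apply: eq_int => r; rewrite /hh /G; ring.
    exact: L1Z (L1_itvf a t (lh1 l j)).
  exact: L1_itvf.
by rewrite /G; ring.
Qed.

(** Summed over the indices, the factors exp (A s) and exp (- A s) in hh
    collapse to kap, and what remains of the exponentials at time a is the
    initial state. *)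
Lemma period_drift t : a <= t -> t <= b -> {ae Pr, forall o, forall i,
  L1 mu (fun s => (A *m Y s o + kap s *m \col_j xi j o) i 0 * itvf a t s) /\
  Y t o i 0 = xi i o + \int[mu]_s ((A *m Y s o + kap s *m \col_j xi j o) i 0 * itvf a t s)
    + sigma * J i t o}.
Proof.
move=> at_ tb; apply: filter_forall => i.
have T1 : {ae Pr, forall o, forall l j,
  L1 mu (fun s => drift_term i l j o s * itvf a t s) /\
  \int[mu]_s (drift_term i l j o s * itvf a t s) =
    (E t i l - E a i l) * E (- a) l j * xi j o
    + (E t i l * D l j t - \int[mu]_s (hh i l j s * itvf a t s)) * xi j o
    + sigma * (E t i l * V l j t o - W i l j t o)}.
  by apply: filter_forall => l; apply: filter_forall => j; exact: drift_int.
apply: filterS T1 => o T1.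
have lk j : L1 mu (fun s => kap s i j * itvf a t s).
  by apply: L1_itvf; apply: L2L1.
have S1 l : L1 mu (fun s => \sum_j (drift_term i l j o s * itvf a t s)).
  by apply: L1_sum => j _; have [] := T1 l j.
have S2 : L1 mu (fun s => \sum_l \sum_j (drift_term i l j o s * itvf a t s)).
  by apply: L1_sum => l _.
have S3 : L1 mu (fun s => \sum_j xi j o * (kap s i j * itvf a t s)).
  by apply: L1_sum => j _; exact: L1Z.
split; first by apply: L1_eq (L1D S2 S3) => s; rewrite -drift_sum.
rewrite (@eq_int _ _ _ mu _ _ (drift_sum i t o)) intD// int_sum//.
rewrite (eq_bigr (fun l => \sum_j
    ((E t i l - E a i l) * E (- a) l j * xi j o
    + (E t i l * D l j t - \int[mu]_s (hh i l j s * itvf a t s)) * xi j o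
    + sigma * (E t i l * V l j t o - W i l j t o)))); last first.
  move=> l _; rewrite int_sum; last by move=> j _; have [] := T1 l j.
  by apply: eq_bigr => j _; have [] := T1 l j.
rewrite int_sum; last by move=> j _; exact: L1Z.
rewrite (eq_bigr (fun j => \sum_l xi j o * \int[mu]_s (hh i l j s * itvf a t s))
  (F1 := fun j => \int[mu]_s (xi j o * (kap s i j * itvf a t s)))); last first.
  move=> j _; rewrite intZl// -mulr_sumr; congr (_ * _); rewrite -int_sum; last first.
    by move=> l _; exact: L1_itvf.
  by apply: eq_int => s; rewrite -mulr_suml sum_hh.
have -> : xi i o = \sum_j \sum_l E a i l * E (- a) l j * xi j o.
  rewrite (eq_bigr (fun j => (1%:M : 'M[R]_n) i j * xi j o)).
    rewrite (bigD1 i)//= mxE eqxx mul1r big1 ?addr0// => j ji.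
    by rewrite mxE eq_sym (negbTE ji) mul0r.
  by move=> j _; rewrite -mulr_suml -(E_inv a) [in RHS]mxE.
have -> : \sum_j \sum_l E a i l * E (- a) l j * xi j o =
  \sum_l \sum_j E a i l * E (- a) l j * xi j o by exact: exchange_big.
have -> : \sum_j \sum_l xi j o * \int[mu]_s (hh i l j s * itvf a t s) =
  \sum_l \sum_j xi j o * \int[mu]_s (hh i l j s * itvf a t s) by exact: exchange_big.
have -> : sigma * J i t o = \sum_l \sum_j sigma * W i l j t o.
  rewrite /J /period_noise exchange_big mulr_sumr; apply: eq_bigr => l _.
  by rewrite mulr_sumr.
have -> : Y t o i 0 = \sum_l \sum_j E t i l * z l j t o.
  by rewrite mxE; apply: eq_bigr => l _; rewrite mulr_sumr.
rewrite -!big_split; apply: eq_bigr => l _; rewrite -!big_split; apply: eq_bigr => j _ /=.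
by rewrite /z; ring.
Qed.

Lemma period_ito i t : a <= t ->
  ito Pr F w a t (fun p => \sum_j xi j p.1 * (kap p.2 i j * itvf a t p.2)) (J i t).
Proof.
move=> at_; have := ito_sum hw a0 (index_enum 'I_n) (fun j =>
  ito_sum hw a0 (index_enum 'I_n) (fun l => is_wint_ito (hW i l j) at_)).
move=> H; apply: ito_ext H _ _ => // p; apply: eq_bigr => j _.
by rewrite -sum_hh mulr_suml mulr_sumr.
Qed.

Definition period_gain i j (s : measurableTypeR R) := (E (b - s) *m kap s) i j.
Definition period_mean i j := E (b - a) i j + \int[mu]_s period_gain i j s.
Let Gam := period_gain.
Let U i j o := \sum_l E b i l * V l j b o.

Let GamE i j s : Gam i j s = \sum_l E b i l * h l j s.
Proof. by rewrite /Gam /period_gain {1}/E expmxD -/(E _) -mulmxA mxE. Qed.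

Let lGam i j : L2 mu (Gam i j).
Proof.
have -> : Gam i j = (fun s => \sum_l E b i l * h l j s) by apply/funext => s; exact: GamE.
by apply: L2_sum => l _; exact: L2Z.
Qed.

Let hU i j : ito Pr F w a b (tens (xi j) (Gam i j)) (U i j).
Proof.
have := ito_sum hw a0 (index_enum 'I_n) (fun l =>
  ito_scale hw a0 (E b i l) (is_wint_ito (hV l j) (ltW ab))).
move=> H; apply: ito_ext H _ _ => // p; rewrite /tens GamE mulr_sumr.
by apply: eq_bigr => l _; rewrite sh; ring.
Qed.

Let lU i j : L2 Pr (U i j). Proof. by have [] := hU i j. Qed.

Let period_end i o : Y b o i 0 = \sum_j (period_mean i j * xi j o + sigma * U i j o).
Proof.
transitivity (\sum_l \sum_j E b i l * z l j b o).
  by rewrite mxE; apply: eq_bigr => l _; rewrite mulr_sumr.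
rewrite exchange_big; apply: eq_bigr => j _.
have -> : period_mean i j = \sum_l E b i l * (E (- a) l j + D l j b).
  rewrite /period_mean {1}/E expmxD -/(E _) mxE.
  rewrite (@eq_int _ _ _ mu _ _ (GamE i j)) int_sum => [|l _]; last exact: L1Z.
  rewrite -big_split; apply: eq_bigr => l _ /=; rewrite intZl// mulrDr /D /drift_coef.
  by congr (_ + _ * _); apply: eq_int => s; rewrite sh.
by rewrite mulr_suml mulr_sumr -big_split; apply: eq_bigr => l _; rewrite /z/=; ring.
Qed.

Lemma L2_period_end i : L2 Pr (fun o => Y b o i 0).
Proof.
have -> : (fun o => Y b o i 0) =
  (fun o => \sum_j (period_mean i j * xi j o + sigma * U i j o)).
  by apply/funext => o; exact: period_end.
by apply: L2_sum => j _; apply: L2D; exact: L2Z.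
Qed.

(** At the end of the period the state is linear in xi plus Ito integrals, which
    are uncorrelated with xi as the latter is known at time a; the isometry
    gives their covariance. *)
Lemma period_moments i i' :
  ip Pr (fun o => Y b o i 0) (fun o => Y b o i' 0) =
  \sum_j \sum_j' (period_mean i j * period_mean i' j'
    + sigma ^+ 2 * ip mu (Gam i j) (Gam i' j')) * ip Pr (xi j) (xi j').
Proof.
have lf k j : L2 Pr (fun o => period_mean k j * xi j o + sigma * U k j o).
  by apply: L2D; exact: L2Z.
rewrite [LHS](_ : _ = ip Pr (fun o => \sum_j (period_mean i j * xi j o + sigma * U i j o))
  (fun o => \sum_j (period_mean i' j * xi j o + sigma * U i' j o))); last first.
  by apply: eq_int => o; rewrite !period_end.
rewrite ip_suml//; last by apply: L2_sum.
apply: eq_bigr => j _; rewrite ip_sumr//; apply: eq_bigr => j' _.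
have UU : ip Pr (U i j) (U i' j') = ip Pr (xi j) (xi j') * ip mu (Gam i j) (Gam i' j').
  by rewrite -(ito_ip hw a0 (hU i j) (hU i' j')) ip_tens.
have xU : ip Pr (xi j) (U i' j') = 0 by apply: (ito_mean0 hw a0 (hU i' j')).
have Ux : ip Pr (U i j) (xi j') = 0 by rewrite ipC; apply: (ito_mean0 hw a0 (hU i j)).
have l1 k q := L2Z (period_mean k q) (lxi q); have l2 k q := L2Z sigma (lU k q).
rewrite ipDl// !ipDr// !ipZl// ?ipZr//.
by rewrite UU xU Ux; ring.
Qed.

End OnePeriod.

(** * Translations and reflections of time *)

Section Affine.
Context {R : realType}.
Notation mu := (@lebesgue_measure R).
Variables (e : bool) (c : R).

(** A translation for e = false, moving a period to the origin; a reflection for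
    e = true, reversing time in the Gram matrix. *)
Definition affine (s : measurableTypeR R) : measurableTypeR R := (-1) ^+ e * (s : R) + c.

Lemma measurable_affine : measurable_fun [set: measurableTypeR R] affine.
Proof.
by apply: (@measurable_funD _ (measurableTypeR R)).
Qed.

HB.instance Definition _ := isMeasurableFun.Build _ _ _ _ affine measurable_affine.

Lemma affine_measure (X : set (measurableTypeR R)) : measurable X ->
  mu X = pushforward mu affine X.
Proof.
apply: lebesgue_measure_unique => _ [[x y] /= xy <-].
rewrite /pushforward.
have -> : affine @^-1` `]x, y]%classic = if e then `[c - y, c - x[%classic else `]x - c, y - c]%classic.
  apply/seteqP; split => s; rewrite /affine /=; case: e; rewrite /= !in_itv/= ?expr1 ?expr0; lra.
rewrite lebesgue_measure_itv/= lte_fin.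
case: e; rewrite lebesgue_measure_itv /= lte_fin.
  rewrite ltrD2l ltrN2; case: ltP => // _.
  by rewrite -!EFinB; congr EFin; ring.
rewrite ltrD2r; case: ltP => // _.
by rewrite -!EFinB; congr EFin; ring.
Qed.

Lemma integral_affine_ge0 (f : measurableTypeR R -> \bar R) :
  measurable_fun [set: measurableTypeR R] f -> (forall s, 0 <= f s)%E ->
  (\int[mu]_s f (affine s) = \int[mu]_s f s)%E.
Proof.
move=> mf f0; have := ge0_integral_pushforward measurable_affine mu measurableT mf.
rewrite preimage_setT => /(_ (fun y _ => f0 y)) <-.
by apply: eq_measure_integral => X mX _; apply: esym; exact: affine_measure.
Qed.

Lemma integral_affine (f : measurableTypeR R -> R) :
  measurable_fun [set: measurableTypeR R] f ->
  (\int[mu]_s (f (affine s))%:E = \int[mu]_s (f s)%:E)%E.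
Proof.
move=> mf; rewrite integralE [RHS]integralE.
have mE : measurable_fun [set: measurableTypeR R] (EFin \o f) by exact/measurable_EFinP.
congr (_ - _)%E.
- rewrite -[RHS](integral_affine_ge0 (measurable_funepos mE) (fun s => funepos_ge0 _ s)).
  by apply: eq_integral => s _; rewrite !funeposE.
- rewrite -[RHS](integral_affine_ge0 (measurable_funeneg mE) (fun s => funeneg_ge0 _ s)).
  by apply: eq_integral => s _; rewrite !funenegE.
Qed.

Lemma int_affine (f : measurableTypeR R -> R) : measurable_fun [set: measurableTypeR R] f ->
  \int[mu]_s f (affine s) = \int[mu]_s f s.
Proof. by move=> mf; rewrite /Rintegral integral_affine. Qed.

Lemma L1_affine (f : measurableTypeR R -> R) : L1 mu f -> L1 mu (fun s => f (affine s)).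
Proof.
move=> lf; have mf := L1_meas lf; apply/integrableP; split.
  by apply/measurable_EFinP; exact: (measurableT_comp mf measurable_affine).
have /integrableP[_] := lf; congr (_ < _)%E; rewrite -[LHS]integral_affine_ge0//.
by apply: measurableT_comp => //; exact/measurable_EFinP.
Qed.

Lemma L2_affine (f : measurableTypeR R -> R) : L2 mu f -> L2 mu (fun s => f (affine s)).
Proof.
move=> [mf lf]; split; first exact: (measurableT_comp mf measurable_affine).
exact: (L1_affine lf).
Qed.

End Affine.

(** * Completing the square *)

Section PositiveMatrices.
Context {R : realType}.

Lemma quadmxD n (V W : 'M[R]_n) v : quadmx (V + W) v = quadmx V v + quadmx W v.
Proof. by rewrite /quadmx mulmxDr mulmxDl mxE. Qed.

Lemma quadmxZ n c (W : 'M[R]_n) v : quadmx (c *: W) v = c * quadmx W v.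
Proof. by rewrite /quadmx -scalemxAr -scalemxAl mxE. Qed.

Lemma quadmx_conj n p (W : 'M[R]_n) (C : 'M[R]_(n, p)) v :
  quadmx (C^T *m W *m C) v = quadmx W (C *m v).
Proof. by rewrite /quadmx trmx_mul !mulmxA. Qed.

Lemma quadmxE n (W : 'M[R]_n) v : quadmx W v = \sum_i \sum_j W i j * (v i 0 * v j 0).
Proof.
rewrite /quadmx mxE exchange_big; apply: eq_bigr => j _.
by rewrite mxE mulr_suml; apply: eq_bigr => i _; rewrite mxE; ring.
Qed.

Lemma posdefmx_psd n (W : 'M[R]_n) : posdefmx W -> psdmx W.
Proof.
move=> [sW pW]; split => // v; have [->|v0] := eqVneq v 0.
  by rewrite /quadmx mulmx0 mxE.
exact/ltW/pW.
Qed.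

Lemma psdmxD n (V W : 'M[R]_n) : psdmx V -> psdmx W -> psdmx (V + W).
Proof.
move=> [sV pV] [sW pW]; split; first by rewrite linearD /= sV sW.
by move=> v; rewrite quadmxD addr_ge0.
Qed.

Lemma psdmxZ n c (W : 'M[R]_n) : 0 <= c -> psdmx W -> psdmx (c *: W).
Proof.
move=> c0 [sW pW]; split; first by rewrite linearZ /= sW.
by move=> v; rewrite quadmxZ mulr_ge0.
Qed.

Lemma psdmx_conj n p (W : 'M[R]_n) (C : 'M[R]_(n, p)) :
  psdmx W -> psdmx (C^T *m W *m C).
Proof.
move=> [sW pW]; split; first by rewrite !trmx_mul trmxK sW mulmxA.
by move=> v; rewrite quadmx_conj.
Qed.

Lemma posdefmxD_psd n (V W : 'M[R]_n) : posdefmx V -> psdmx W -> posdefmx (V + W).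
Proof.
move=> [sV pV] [sW pW]; split; first by rewrite linearD /= sV sW.
by move=> v v0; rewrite quadmxD ltr_wpDr// pV.
Qed.

Lemma posdefmx1 n : posdefmx (1%:M : 'M[R]_n).
Proof.
split; first exact: trmx1.
move=> v v0; rewrite /quadmx mulmx1 mxE.
have [j vj] : exists j, v j 0 != 0.
  apply/existsP; apply: contraNT v0 => /existsPn h; apply/eqP/colP => j.
  by rewrite mxE; apply/eqP; have := h j; rewrite negbK.
rewrite (bigD1 j)//= ltr_pwDl//; first by rewrite mxE -expr2 exprn_even_gt0.
by apply: sumr_ge0 => k _; rewrite mxE -expr2 sqr_ge0.
Qed.

Lemma posdefmx_unit n (W : 'M[R]_n) : posdefmx W -> W \in unitmx.
Proof.
move=> [sW pW]; rewrite -row_free_unit -kermx_eq0; apply/negPn/negP => k0.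
have /rowV0Pn[v /sub_kermxP vW v0] := k0.
have vT0 : v^T != 0 by rewrite trmx_eq0.
by have := pW _ vT0; rewrite /quadmx trmxK vW mul0mx mxE ltxx.
Qed.

Lemma posdefmx_inv n (W : 'M[R]_n) : posdefmx W -> psdmx (invmx W).
Proof.
move=> pW; have uW := posdefmx_unit pW; have [sW _] := pW.
have sI : (invmx W)^T = invmx W by rewrite trmx_inv sW.
have -> : invmx W = (invmx W)^T *m W *m invmx W by rewrite sI mulVmx// mul1mx.
by apply: psdmx_conj; exact: posdefmx_psd.
Qed.

Lemma sqrtmxP n (W : 'M[R]_n) : psdmx W -> psdmx (sqrtmx W) /\ sqrtmx W *m sqrtmx W = W.
Proof. move=> /sqrtmx_exists [S hS].
by apply: (@xgetPex _ 0 [set S : 'M[R]_n | psdmx S /\ S *m S = W]); exists S. Qed.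

End PositiveMatrices.

Section MatrixIntegrals.
Context {R : realType}.
Notation mu := (@lebesgue_measure R).
Notation time := (measurableTypeR R).

Definition mint p q (G : time -> 'M[R]_(p, q)) : 'M[R]_(p, q) :=
  \matrix_(i, j) \int[mu]_s G s i j.
Definition mL1 p q (G : time -> 'M[R]_(p, q)) := forall i j, L1 mu (fun s => G s i j).
Definition mL2 p q (G : time -> 'M[R]_(p, q)) := forall i j, L2 mu (fun s => G s i j).
(** Gains are extended by zero outside their period, so that all integrals run
    over the whole line. *)
Definition supported p q a b (G : time -> 'M[R]_(p, q)) := forall s, itvf a b s *: G s = G s.

Lemma eq_mint p q (G H : time -> 'M[R]_(p, q)) : G =1 H -> mint G = mint H.
Proof. by move=> /funext ->. Qed.

Lemma eq_mL1 p q (G H : time -> 'M[R]_(p, q)) : G =1 H -> mL1 G -> mL1 H.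
Proof. by move=> /funext ->. Qed.

Lemma eq_mL2 p q (G H : time -> 'M[R]_(p, q)) : G =1 H -> mL2 G -> mL2 H.
Proof. by move=> /funext ->. Qed.

Lemma mL1D p q (G H : time -> 'M[R]_(p, q)) : mL1 G -> mL1 H -> mL1 (fun s => G s + H s).
Proof. by move=> lG lH i j; apply: L1_eq (L1D (lG i j) (lH i j)) => s; rewrite mxE. Qed.

Lemma mL1Z p q c (G : time -> 'M[R]_(p, q)) : mL1 G -> mL1 (fun s => c *: G s).
Proof. by move=> lG i j; apply: L1_eq (L1Z c (lG i j)) => s; rewrite mxE. Qed.

Lemma mL2D p q (G H : time -> 'M[R]_(p, q)) : mL2 G -> mL2 H -> mL2 (fun s => G s + H s).
Proof.
move=> lG lH i j; rewrite (_ : (fun s => _) = (fun s => G s i j + H s i j)).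
  exact: L2D.
by apply/funext => s; rewrite mxE.
Qed.

Lemma mL2N p q (G : time -> 'M[R]_(p, q)) : mL2 G -> mL2 (fun s => - G s).
Proof.
move=> lG i j; rewrite (_ : (fun s => _) = (fun s => -1 * G s i j)).
  exact: L2Z.
by apply/funext => s; rewrite mxE mulN1r.
Qed.

Lemma mL2_tr p q (G : time -> 'M[R]_(p, q)) : mL2 G -> mL2 (fun s => (G s)^T).
Proof.
move=> lG i j; rewrite (_ : (fun s => _) = (fun s => G s j i)); first exact: lG.
by apply/funext => s; rewrite mxE.
Qed.

Lemma mL1_tr p q (G : time -> 'M[R]_(p, q)) : mL1 G -> mL1 (fun s => (G s)^T).
Proof.
move=> lG i j; rewrite (_ : (fun s => _) = (fun s => G s j i)); first exact: lG.
by apply/funext => s; rewrite mxE.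
Qed.

Lemma mL2_mull p q r (C : 'M[R]_(p, q)) (G : time -> 'M[R]_(q, r)) :
  mL2 G -> mL2 (fun s => C *m G s).
Proof.
move=> lG i j; rewrite (_ : (fun s => _) = (fun s => \sum_k C i k * G s k j)).
  by apply: L2_sum => k _; exact: L2Z.
by apply/funext => s; rewrite mxE.
Qed.

Lemma mL2_cts p q r a b (C : R -> 'M[R]_(p, q)) (G : time -> 'M[R]_(q, r)) :
  ctsmx C -> mL2 G -> supported a b G -> mL2 (fun s => C s *m G s).
Proof.
move=> cC lG sG i j; rewrite (_ : (fun s => _) = (fun s : time => \sum_k C s i k * G s k j)).
  apply: L2_sum => k _; apply: (@ctsM_itvf _ _ a b) => // s.
  by rewrite -[in RHS]sG mxE mulrC.
by apply/funext => s; rewrite mxE.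
Qed.

Lemma mL1M p q r (G : time -> 'M[R]_(p, q)) (H : time -> 'M[R]_(q, r)) :
  mL2 G -> mL2 H -> mL1 (fun s => G s *m H s).
Proof.
move=> lG lH i j; rewrite (_ : (fun s => _) = (fun s => \sum_k G s i k * H s k j)).
  by apply: L1_sum => k _; exact: L2M.
by apply/funext => s; rewrite mxE.
Qed.

Lemma mintD p q (G H : time -> 'M[R]_(p, q)) : mL1 G -> mL1 H ->
  mint (fun s => G s + H s) = mint G + mint H.
Proof.
move=> lG lH; apply/matrixP => i j; rewrite !mxE -intD//.
by apply: eq_int => s; rewrite mxE.
Qed.

Lemma mintZ p q c (G : time -> 'M[R]_(p, q)) : mL1 G ->
  mint (fun s => c *: G s) = c *: mint G.
Proof.
move=> lG; apply/matrixP => i j; rewrite !mxE -intZl//.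
by apply: eq_int => s; rewrite mxE.
Qed.

Lemma mint_tr p q (G : time -> 'M[R]_(p, q)) : mint (fun s => (G s)^T) = (mint G)^T.
Proof. by apply/matrixP => i j; rewrite !mxE; apply: eq_int => s; rewrite mxE. Qed.

Lemma mint_mull p q r (C : 'M[R]_(p, q)) (G : time -> 'M[R]_(q, r)) : mL1 G ->
  mL1 (fun s => C *m G s) /\ mint (fun s => C *m G s) = C *m mint G.
Proof.
move=> lG; split.
  move=> i j; rewrite (_ : (fun s => _) = (fun s => \sum_k C i k * G s k j)).
    by apply: L1_sum => k _; exact: L1Z.
  by apply/funext => s; rewrite mxE.
apply/matrixP => i j; rewrite !mxE (@eq_int _ _ _ mu _ (fun s => \sum_k C i k * G s k j)).
  rewrite int_sum; last by move=> k _; exact: L1Z.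
  by apply: eq_bigr => k _; rewrite intZl// mxE.
by move=> s; rewrite mxE.
Qed.

Lemma mint_mulr p q r (C : 'M[R]_(q, r)) (G : time -> 'M[R]_(p, q)) : mL1 G ->
  mL1 (fun s => G s *m C) /\ mint (fun s => G s *m C) = mint G *m C.
Proof.
move=> lG; split.
  move=> i j; rewrite (_ : (fun s => _) = (fun s => \sum_k C k j * G s i k)).
    by apply: L1_sum => k _; exact: L1Z.
  by apply/funext => s; rewrite mxE; apply: eq_bigr => k _; rewrite mulrC.
apply/matrixP => i j; rewrite !mxE (@eq_int _ _ _ mu _ (fun s => \sum_k C k j * G s i k)).
  rewrite int_sum; last by move=> k _; exact: L1Z.
  by apply: eq_bigr => k _; rewrite intZl// mxE mulrC.
by move=> s; rewrite mxE; apply: eq_bigr => k _; rewrite mulrC.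
Qed.

Lemma quadmx_mint n (G : time -> 'M[R]_n) v : mL1 G ->
  L1 mu (fun s => quadmx (G s) v) /\ quadmx (mint G) v = \int[mu]_s quadmx (G s) v.
Proof.
move=> lG; have [l1 e1] := mint_mull v^T lG; have [l2 e2] := mint_mulr v l1.
split; first exact: l2.
by rewrite /quadmx -e1 -e2 mxE.
Qed.

Lemma psdmx_mint n (G : time -> 'M[R]_n) : mL1 G -> (forall s, psdmx (G s)) ->
  psdmx (mint G).
Proof.
move=> lG pG; split; first by rewrite -mint_tr; apply: eq_mint => s; case: (pG s).
by move=> v; have [_ ->] := quadmx_mint v lG; apply: int_ge0 => s; case: (pG s).
Qed.

Lemma mL2_itvf p q a b (C : R -> 'M[R]_(p, q)) : ctsmx C -> mL2 (fun s : time => itvf a b s *: C s).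
Proof.
move=> cC i j; rewrite (_ : (fun s => _) = (fun s : time => C s i j * itvf a b s)).
  exact: L2_cts.
by apply/funext => s; rewrite mxE mulrC.
Qed.

Lemma supported_itvf p q a b (C : time -> 'M[R]_(p, q)) : supported a b (fun s => itvf a b s *: C s).
Proof. by move=> s; rewrite scalerA -expr2 itvf_sqr. Qed.

Lemma supported_mull p q r a b (C : time -> 'M[R]_(p, q)) (G : time -> 'M[R]_(q, r)) :
  supported a b G -> supported a b (fun s => C s *m G s).
Proof. by move=> sG s; rewrite scalemxAr sG. Qed.

Lemma mL2_L1 p q a b (G : time -> 'M[R]_(p, q)) : mL2 G -> supported a b G -> mL1 G.
Proof.
move=> lG sG i j; apply: L1_eq (L2M (lG i j) (L2_itvf a b)) => s.
by rewrite -[in RHS]sG mxE mulrC.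
Qed.

(** The Gram matrix is defined with the time s to the end of the period
    reversed; this brings it to the time of the control. *)
Lemma intmx_reflect p q tau (C : R -> 'M[R]_(p, q)) : 0 <= tau -> ctsmx C ->
  intmx 0 tau C = mint (fun s : time => itvf 0 tau s *: C (tau - s)).
Proof.
move=> tau0 cC; apply/matrixP => i j; rewrite !mxE.
have cf : continuous (fun s => C s i j) by exact: cC.
have mf := cts_meas cf.
have mg : measurable_fun [set: time] (fun s : time => C s i j * itvf 0 tau s).
  by apply: measurable_funM => //; exact: measurable_itvf.
transitivity (\int[mu]_s (C s i j * itvf 0 tau s)).
  rewrite int_itvf_itv /Rintegral; congr fine; apply: esym.
  by apply: integral_itv_bndo_bndc; apply/measurable_EFinP; exact: measurable_funTS.
rewrite -(int_affine true tau mg).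
have me : measurable_fun [set: time] (fun s : time => (itvf 0 tau s *: C (tau - s)) i j).
  rewrite (_ : (fun s => _) = (fun s : time => C (affine true tau s) i j * itvf 0 tau s)).
    apply: measurable_funM; last exact: measurable_itvf.
    exact: (measurableT_comp mf (measurable_affine true tau)).
  by apply/funext => s; rewrite mxE mulrC /affine expr1 mulN1r addrC.
apply: ae_int => //.
  exact: (measurableT_comp mg (measurable_affine true tau)).
exists [set 0; tau]; split.
- by apply: measurableU; exact: measurable_set1.
- apply/eqP; rewrite eq_le measure_ge0 andbT.
  apply: le_trans (measureU2 _ _ _) _ => //.
  have e r : mu [set r : measurableTypeR R] = 0%E by exact: lebesgue_measure_set1.
  have h : (mu [set (0%R : measurableTypeR R)] + mu [set (tau : measurableTypeR R)] <= 0)%E.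
    by rewrite !e adde0.
  exact: h.
move=> s /= h; apply: contrapT => /not_orP[s0 st]; apply: h.
rewrite mxE mulrC /affine expr1 mulN1r addrC; congr (_ * _).
rewrite !itvfE; congr (nat_of_bool _)%:R.
have {}s0 : (s : R) != 0 by apply/eqP.
have {}st : (s : R) != tau by apply/eqP.
by rewrite subr_ge0 ltrBlDr ltrDl [s <= tau]le_eqVlt (negbTE st) [0 <= s]le_eqVlt eq_sym (negbTE s0) /= andbC.
Qed.

End MatrixIntegrals.

Lemma mulmx_expand {R : realType} n m (a b : 'M[R]_(m, n)) (q : 'M[R]_m) :
  (a + b)^T *m (q *m (a + b)) = a^T *m (q *m a) + b^T *m (q *m a) + a^T *m (q *m b)
    + b^T *m (q *m b).
Proof. by rewrite linearD /= mulmxDr mulmxDr !mulmxDl addrA. Qed.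

Lemma mulmx_expand2 {R : realType} n (y z e W X : 'M[R]_n) :
  (y + z)^T *m W *m (y + z)
    + (- ((y - e)^T *m (W *m y)) - z^T *m (W *m y) - y^T *m W *m z + X)
  = e^T *m (W *m y) + (z^T *m W *m z + X).
Proof.
have -> : (y + z)^T = y^T + z^T by rewrite linearD.
have -> : (y - e)^T = y^T - e^T by rewrite linearB.
rewrite mulmxDr !mulmxDl !mulNmx !mulmxA.
move: (y^T *m W *m y) (y^T *m W *m z) (z^T *m W *m y) (z^T *m W *m z) (e^T *m W *m y).
by move=> a b c f g; apply/matrixP => i j; rewrite !mxE; ring.
Qed.

Section LinearQuadratic.
Context {R : realType} {n m : nat}.
Notation mu := (@lebesgue_measure R).
Notation time := (measurableTypeR R).
Variables (A : 'M[R]_n) (B : 'M[R]_(n, m)) (sigma tau : R) (L : 'M[R]_n) (Ru : 'M[R]_m).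
Hypotheses (tau0 : 0 < tau) (pL : posdefmx L) (pRu : posdefmx Ru).

Let E (t : R) := expmx (t *: A).
Let G (s : R) := E (tau - s) *m B.

Let cG : ctsmx G.
Proof.
apply: ctsmxM; last exact: ctsmx_cst.
apply: (@ctsmx_comp _ _ _ E (fun s => tau - s)); first exact: ctsmx_expmx.
by move=> s; apply: cvgB; [exact: cvg_cst|exact: cvg_id].
Qed.

Section weight.
Variable W : 'M[R]_n.
Hypothesis pW : psdmx W.

Let Q0 s := weightQ A B sigma Ru W s.

Let Q0E s : Q0 s = Ru + sigma ^+ 2 *: ((E s *m B)^T *m W *m (E s *m B)).
Proof. by rewrite /Q0 /weightQ expmx_tr trmx_mul !mulmxA. Qed.

Lemma weightQ_posdef s : posdefmx (weightQ A B sigma Ru W s).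
Proof.
rewrite -/(Q0 s) Q0E; apply: posdefmxD_psd => //.
by apply: psdmxZ (psdmx_conj _ pW); exact: sqr_ge0.
Qed.

Let cQ0 : ctsmx Q0.
Proof.
rewrite (_ : Q0 = fun s => Ru + sigma ^+ 2 *: ((E s *m B)^T *m W *m (E s *m B))); last first.
  by apply/funext => s; exact: Q0E.
have cEB : ctsmx (fun s => E s *m B) by apply: ctsmxM; [exact: ctsmx_expmx|exact: ctsmx_cst].
apply: ctsmxD; first exact: ctsmx_cst.
apply: ctsmxZ; apply: ctsmxM => //; apply: ctsmxM; last exact: ctsmx_cst.
exact: ctsmx_tr.
Qed.

Let cQi : ctsmx (fun s => invmx (Q0 s)).
Proof. by apply: ctsmx_inv => // s; apply: posdefmx_unit; exact: weightQ_posdef. Qed.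

Let gram_integrand s := E s *m B *m invmx (Q0 s) *m (E s *m B)^T.

Let cgram : ctsmx gram_integrand.
Proof.
have cEB : ctsmx (fun s => E s *m B) by apply: ctsmxM; [exact: ctsmx_expmx|exact: ctsmx_cst].
by apply: ctsmxM; [exact: ctsmxM|exact: ctsmx_tr].
Qed.

Let M := gramM A B sigma tau Ru W.

Let ME : M = mint (fun s : time => itvf 0 tau s *: gram_integrand (tau - s)).
Proof.
rewrite -(intmx_reflect (ltW tau0) cgram) /M /gramM; congr (intmx _ _ _).
by apply/funext => s; rewrite /gram_integrand expmx_tr trmx_mul !mulmxA.
Qed.

Let lgram : mL1 (fun s : time => itvf 0 tau s *: gram_integrand (tau - s)).
Proof.
have cr : ctsmx (fun s => gram_integrand (tau - s)).
  apply: ctsmx_comp => // s; by apply: cvgB; [exact: cvg_cst|exact: cvg_id].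
by apply: (@mL2_L1 _ _ _ 0 tau); [exact: mL2_itvf|exact: supported_itvf].
Qed.

Let pM : psdmx M.
Proof.
rewrite ME; apply: psdmx_mint => // s; apply: psdmxZ; first exact: itvf_ge0.
rewrite /gram_integrand -{1}[E _ *m B]trmxK; apply: psdmx_conj.
apply: posdefmx_inv; exact: weightQ_posdef.
Qed.

Let S := sqrtmx W.
Let sS : S^T = S. Proof. by have [[]] := sqrtmxP pW. Qed.
Let SS : S *m S = W. Proof. by have [] := sqrtmxP pW. Qed.
Let K1 := 1%:M + S *m M *m S.

Let pK1 : posdefmx K1.
Proof.
apply: posdefmxD_psd; first exact: posdefmx1.
by rewrite -{1}sS; exact: psdmx_conj.
Qed.

(** It equals W (1 + M W)^-1, as core_eq shows; the symmetric form makes its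
    positivity visible and asks for no inverse of W. *)
Definition value_core : 'M[R]_n := S *m invmx K1 *m S.
Let N := value_core.

Lemma riccati_mapE : riccati_map A B sigma tau L Ru W =
  (E tau)^T *m N *m E tau + tau *: L.
Proof. by rewrite /riccati_map expmx_tr /N /value_core /K1 !mulmxA. Qed.

Lemma psdmx_riccati_map : psdmx (riccati_map A B sigma tau L Ru W).
Proof.
rewrite riccati_mapE; apply: psdmxD; last first.
  by apply: psdmxZ (posdefmx_psd pL); exact: ltW.
apply: psdmx_conj; rewrite /N /value_core -{1}sS; apply: psdmx_conj.
exact: posdefmx_inv.
Qed.

Let core_eq : W *m (1%:M - M *m N) = N.
Proof.
have uK1 := posdefmx_unit pK1.
rewrite mulmxBr mulmx1 /N /value_core -SS.
have e : S *m M *m S *m invmx K1 = 1%:M - invmx K1.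
  have : K1 *m invmx K1 = 1%:M by exact: mulmxV.
  by rewrite {1}/K1 mulmxDl mul1mx => <-; rewrite addrC addKr.
have -> : S *m S *m (M *m (S *m invmx K1 *m S)) = S *m (S *m M *m S *m invmx K1) *m S.
  by rewrite !mulmxA.
by rewrite e mulmxBr mulmx1 mulmxBl opprB addrC subrK.
Qed.

Let Q s := Q0 (tau - s).
Let sQ s : (Q s)^T = Q s. Proof. by case: (weightQ_posdef (tau - s)). Qed.
Let cQ : ctsmx Q.
Proof. by apply: ctsmx_comp => // s; apply: cvgB; [exact: cvg_cst|exact: cvg_id]. Qed.

(** Written with the transition G from the time of the control to the end of the
    period, as it meets the form of W there. *)
Definition best_gain (s : time) : 'M[R]_(m, n) :=
  itvf 0 tau s *: - (invmx (Q s) *m (G s)^T *m N *m E tau).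
Let Ko := best_gain.

Lemma best_gainE s : best_gain s = itvf 0 tau s *:
  - (invmx (weightQ A B sigma Ru W (tau - s)) *m B^T *m expmx (- (s : R) *: A^T)
       *m (riccati_map A B sigma tau L Ru W - tau *: L)).
Proof.
rewrite /best_gain riccati_mapE addrK; congr (_ *: - _).
have -> : (G s)^T = B^T *m (expmx (- (s : R) *: A^T) *m (E tau)^T).
  rewrite /G trmx_mul; congr (_ *m _).
  by rewrite expmx_tr -trmx_mul /E -expmxD.
by rewrite !mulmxA.
Qed.

Lemma mL2_best_gain : mL2 best_gain.
Proof.
apply: mL2_itvf => i j; rewrite (_ : (fun s => _) = (fun s : R => -1 * (invmx (Q s) *m (G s)^T *m N *m E tau) i j)).
  have c : ctsmx (fun s => invmx (Q s) *m (G s)^T *m N *m E tau).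
    apply: ctsmxM; last exact: ctsmx_cst.
    apply: ctsmxM; last exact: ctsmx_cst.
    apply: ctsmxM; last exact: ctsmx_tr.
    by apply: (@ctsmx_comp _ _ _ (fun s => invmx (Q0 s))) => // s; apply: cvgB; [exact: cvg_cst|exact: cvg_id].
  by move=> s; apply: cvgM; [exact: cvg_cst|exact: c].
by apply/funext => s; rewrite mxE mulN1r.
Qed.

Lemma supported_best_gain : supported 0 tau best_gain.
Proof. exact: supported_itvf. Qed.

Variable K : time -> 'M[R]_(m, n).
Hypotheses (lK : mL2 K) (sK : supported 0 tau K).

(** The matrix taking the state at the start of a period to its conditional mean
    at the end. *)
Definition mean_gain : 'M[R]_n := E tau + mint (fun s => G s *m K s).
(** The form, evaluated at the initial state, of the cost of one period with
    gain K: the control cost plus the mean final cost weighted by W. *)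
Definition period_value : 'M[R]_n :=
  mean_gain^T *m W *m mean_gain
  + sigma ^+ 2 *: mint (fun s => (G s *m K s)^T *m W *m (G s *m K s))
  + mint (fun s => (K s)^T *m Ru *m K s).

Let dl (s : time) := K s - Ko s.
Let ldl : mL2 dl. Proof. by apply: mL2D => //; apply: mL2N; exact: mL2_best_gain. Qed.
Let sdl : supported 0 tau dl.
Proof. by move=> s; rewrite /dl scalerBr sK supported_best_gain. Qed.

(** What the gain K costs beyond the best one: the terms of period_value that
    are quadratic in K - best_gain. *)
Definition excess : 'M[R]_n :=
  (mint (fun s => G s *m dl s))^T *m W *m mint (fun s => G s *m dl s)
  + mint (fun s => (dl s)^T *m (Q s *m dl s)).

Let lG (H : time -> 'M[R]_(m, n)) : mL2 H -> supported 0 tau H ->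
  mL2 (fun s => G s *m H s) /\ mL1 (fun s => G s *m H s).
Proof.
move=> lH sH; have l2 : mL2 (fun s => G s *m H s) by exact: mL2_cts sH.
by split => //; apply: (mL2_L1 l2); exact: supported_mull.
Qed.

Let lQ (H H' : time -> 'M[R]_(m, n)) : mL2 H -> mL2 H' -> supported 0 tau H' ->
  mL1 (fun s => (H s)^T *m (Q s *m H' s)).
Proof. by move=> lH lH' sH'; apply: mL1M; [exact: mL2_tr|exact: mL2_cts sH']. Qed.

Let y := E tau + mint (fun s => G s *m Ko s).
Let Z := mint (fun s => G s *m dl s).

Let mean_gain_split : mean_gain = y + Z.
Proof.
have [_ l1] := lG mL2_best_gain supported_best_gain; have [_ l2] := lG ldl sdl.
rewrite /mean_gain /y /Z -addrA -mintD//; congr (_ + _); apply: eq_mint => s.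
by rewrite -mulmxDr /dl addrC subrK.
Qed.

(** Under the best gain the mean transition y is (1 - M N) exp (A tau), and
    core_eq turns W y into N exp (A tau); this is the fixed point equation that
    makes best_gain a critical point. *)
Let Wy : W *m y = N *m E tau.
Proof.
suff -> : y = (1%:M - M *m N) *m E tau by rewrite mulmxA core_eq.
rewrite mulmxBl mul1mx /y; congr (_ + _).
have [l1 e1] := mint_mulr (- (N *m E tau)) lgram.
rewrite ME -mulmxA -mulmxN -e1; apply: eq_mint => s.
rewrite /Ko /best_gain /gram_integrand -/(Q s) -/(G s) mulmxN -scalemxAl -scalemxAr mulmxN.
by rewrite scalerN; congr (- (_ *: _)); rewrite !mulmxA.
Qed.

Let QKo s : Q s *m Ko s = - (itvf 0 tau s *: ((G s)^T *m (W *m y))).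
Proof.
rewrite Wy /Ko /best_gain -scalemxAr mulmxN scalerN; congr (- (_ *: _)).
rewrite !mulmxA mulmxV ?mul1mx//; apply: posdefmx_unit; exact: weightQ_posdef.
Qed.

(** The gradient of the cost vanishes at best_gain: on the period Q times the
    best gain is - G^T W y, so the linear terms of the control cost are opposite
    to those of the final cost. *)
Let pair_Ko (H : time -> 'M[R]_(m, n)) : mL2 H -> supported 0 tau H ->
  mint (fun s => (H s)^T *m (Q s *m Ko s)) = - ((mint (fun s => G s *m H s))^T *m (W *m y)).
Proof.
move=> lH sH; have [_ l1] := lG lH sH.
have l2 := mL1_tr l1.
have [_ e2] := mint_mulr (- (W *m y)) l2.
rewrite -mint_tr -mulmxN -e2; apply: eq_mint => s.
rewrite QKo mulmxN mulmxN; congr (- _).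
have e : itvf 0 tau s *: (H s)^T = (H s)^T by rewrite -[in RHS]sH linearZ.
rewrite -scalemxAr scalemxAl e (trmx_mul (G s) (H s)) !mulmxA; reflexivity.
Qed.

(** Expand in K = best_gain + (K - best_gain). By pair_Ko the cross terms
    cancel, and the terms free of K - best_gain add up to the Riccati map. *)
Lemma complete_square :
  period_value = riccati_map A B sigma tau L Ru W - tau *: L + excess.
Proof.
have lo := mL2_best_gain; have so := supported_best_gain.
have [lGK _] := lG lK sK.
have l1 : mL1 (fun s => (G s *m K s)^T *m W *m (G s *m K s)).
  have l := mL1M (mL2_tr lGK) (mL2_mull W lGK).
  by apply: eq_mL1 l => s; rewrite !mulmxA.
have l2 : mL1 (fun s => (K s)^T *m Ru *m K s).
  have l := mL1M (mL2_tr lK) (mL2_mull Ru lK).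
  by apply: eq_mL1 l => s; rewrite !mulmxA.
have e1 : sigma ^+ 2 *: mint (fun s => (G s *m K s)^T *m W *m (G s *m K s))
  + mint (fun s => (K s)^T *m Ru *m K s) = mint (fun s => (K s)^T *m (Q s *m K s)).
  rewrite -mintZ// -mintD//; last exact: mL1Z.
  apply: eq_mint => s; rewrite /Q Q0E -/(G s) mulmxDl mulmxDr addrC !mulmxA; congr (_ + _).
  rewrite -scalemxAr -scalemxAl (trmx_mul (G s) (K s)) !mulmxA; reflexivity.
have KE s : K s = Ko s + dl s by rewrite /dl addrC subrK.
have e2 : mint (fun s => (K s)^T *m (Q s *m K s)) =
  mint (fun s => (Ko s)^T *m (Q s *m Ko s)) + mint (fun s => (dl s)^T *m (Q s *m Ko s))
  + (mint (fun s => (dl s)^T *m (Q s *m Ko s)))^T + mint (fun s => (dl s)^T *m (Q s *m dl s)).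
  rewrite -mint_tr.
  have la := lQ lo lo so; have lb := lQ ldl lo so; have ld := lQ ldl ldl sdl.
  have lc := mL1_tr lb.
  have lab := mL1D la lb; have labc := mL1D lab lc.
  rewrite -(mintD la lb) -(mintD lab lc) -(mintD labc ld).
  apply: eq_mint => s.
  have -> : ((dl s)^T *m (Q s *m Ko s))^T = (Ko s)^T *m (Q s *m dl s).
    by rewrite !trmx_mul trmxK sQ mulmxA.
  by rewrite {1 2}KE; exact: mulmx_expand.
have [sW _] := pW.
rewrite /period_value -addrA e1 e2 (pair_Ko lo so) (pair_Ko ldl sdl) riccati_mapE addrK.
rewrite /excess -/Z mean_gain_split.
have -> : mint (fun s => G s *m Ko s) = y - E tau by rewrite /y addrC addKr.
rewrite [(- _)^T]linearN /= !trmx_mul trmxK sW -[in RHS]mulmxA -Wy.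
exact: mulmx_expand2.
Qed.

Lemma psdmx_excess : psdmx excess.
Proof.
apply: psdmxD; first exact: psdmx_conj.
apply: psdmx_mint; first exact: lQ.
by move=> s; rewrite mulmxA; apply: psdmx_conj; apply: posdefmx_psd; exact: weightQ_posdef.
Qed.

(** The weight Q is positive definite, so a vanishing excess kills the integrand
    almost everywhere. *)
Lemma excess_eq0 v : quadmx excess v = 0 -> {ae mu, forall s, K s *m v = best_gain s *m v}.
Proof.
have lq := lQ ldl ldl sdl.
rewrite quadmxD; have [l1 e1] := quadmx_mint v lq.
have q0 s : 0 <= quadmx ((dl s)^T *m (Q s *m dl s)) v.
  by rewrite mulmxA quadmx_conj; exact: (posdefmx_psd (weightQ_posdef (tau - s))).2.
have h1 : 0 <= quadmx ((mint (fun s => G s *m dl s))^T *m W *m mint (fun s => G s *m dl s)) v.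
  by rewrite quadmx_conj; case: pW.
have h2 : 0 <= \int[mu]_s quadmx ((dl s)^T *m (Q s *m dl s)) v by exact: int_ge0.
rewrite e1 => /eqP; rewrite paddr_eq0// => /andP[_ /eqP i0].
have := int0_ae l1 q0 i0; apply: filterS => s; rewrite mulmxA quadmx_conj => qs.
have [d0|d0] := eqVneq (dl s *m v) 0.
  by apply/eqP; rewrite -subr_eq0 -mulmxBl; apply/eqP.
by have [_ /(_ _ d0)] := weightQ_posdef (tau - s); rewrite qs ltxx.
Qed.

End weight.
End LinearQuadratic.

(** * Gains and second moments *)

Section Extension.
Context {d : measure_display} {Omega : measurableType d} {R : realType}.
Variable Pr : probability Omega R.
Variable F : R -> set (set Omega).
Variable w : R -> Omega -> R.
Hypothesis hw : wiener_process Pr F w.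
Notation mu := (@lebesgue_measure R).
Notation time := (measurableTypeR R).

(** The conclusions of the preceding part with the auxiliary integrals V and W
    chosen, stated for a vector-valued initial state. *)
Lemma period_exists {n : nat} (A : 'M[R]_n) (sigma a b : R) (xi : Omega -> 'cV[R]_n)
  (kap : time -> 'M[R]_n) : 0 <= a -> a < b ->
  (forall j, measurable_wrt (F a) (fun o => xi o j 0)) ->
  (forall j, L2 Pr (fun o => xi o j 0)) -> mL2 kap -> supported a b kap ->
  exists (Y : R -> Omega -> 'cV[R]_n) (J : 'I_n -> R -> Omega -> R),
  [/\ forall t i, a <= t -> measurable_wrt (F t) (fun o => Y t o i 0),
      forall i, measurable_fun [set: (Omega * measurableTypeR R)%type]
        (fun q => Y q.2 q.1 i 0),
      forall t, a <= t -> t <= b -> {ae Pr, forall o, forall i,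
        L1 mu (fun s => (A *m Y s o + kap s *m xi o) i 0 * itvf a t s) /\
        Y t o i 0 = xi o i 0 + \int[mu]_s ((A *m Y s o + kap s *m xi o) i 0 * itvf a t s)
          + sigma * J i t o},
      forall i t, a <= t -> ito Pr F w a t
        (fun p => \sum_j xi p.1 j 0 * (kap p.2 i j * itvf a t p.2)) (J i t) &
      (forall i, L2 Pr (fun o => Y b o i 0)) /\
      forall i i', ip Pr (fun o => Y b o i 0) (fun o => Y b o i' 0) =
        \sum_j \sum_j' (period_mean A a b kap i j * period_mean A a b kap i' j'
          + sigma ^+ 2 * ip mu (period_gain A b kap i j) (period_gain A b kap i' j'))
          * ip Pr (fun o => xi o j 0) (fun o => xi o j' 0)].
Proof.
move=> a0 ab wxi lxi lkap skap'.
have skap i j s : kap s i j * itvf a b s = kap s i j.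
  by rewrite -[in RHS]skap' mxE mulrC.
pose x j o := xi o j 0.
pose h l j (s : time) := (expmx (- (s : R) *: A) *m kap s) l j.
pose hh i l j (s : time) := expmx ((s : R) *: A) i l * h l j s.
have sh l j s : h l j s * itvf a b s = h l j s.
  by rewrite /h !mxE mulr_suml; apply: eq_bigr => k _; rewrite -mulrA skap.
have lh l j : L2 mu (h l j).
  have c : ctsmx (fun s => expmx (- s *: A)).
    apply: (@ctsmx_comp _ _ _ (fun s => expmx (s *: A)) -%R); first exact: ctsmx_expmx.
    exact: opp_continuous.
  exact: (mL2_cts c lkap skap').
have lhh i l j : L2 mu (hh i l j).
  by apply: (@ctsM_itvf _ _ a b) => //; exact: continuous_expmx.
have shh i l j s : hh i l j s * itvf a b s = hh i l j s by rewrite /hh -mulrA sh.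
have [V hV] : exists V, forall l j, is_wint Pr F w a (h l j) (x j) (V l j).
  have ex (p : 'I_n * 'I_n) : exists V, is_wint Pr F w a (h p.1 p.2) (x p.2) V.
    exact: (wint_exists hw a0 ab (lh _ _) (@sh _ _) (wxi _) (lxi _)).
  by have [V hV] := choice ex; exists (fun l j => V (l, j)) => l j; exact: (hV (l, j)).
have [W hW] : exists W, forall i l j, is_wint Pr F w a (hh i l j) (x j) (W i l j).
  have ex (p : 'I_n * 'I_n * 'I_n) :
      exists V, is_wint Pr F w a (hh p.1.1 p.1.2 p.2) (x p.2) V.
    exact: (wint_exists hw a0 ab (lhh _ _ _) (@shh _ _ _) (wxi _) (lxi _)).
  by have [W hW] := choice ex; exists (fun i l j => W (i, l, j)) => i l j; exact: (hW (i, l, j)).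
exists (period_path A sigma a x kap V), (period_noise W).
have ex o : \col_j x j o = xi o by apply/colP => j; rewrite mxE.
split.
- by move=> t i at_; exact: (period_wrt hw sigma a0 wxi hV).
- by move=> i; exact: (period_measurable sigma lxi lkap skap hV).
- move=> t at_ tb; have := period_drift hw sigma a0 lxi lkap skap hV hW at_ tb.
  by apply: filterS => o; rewrite ex.
- by move=> i t at_; exact: (period_ito hw a0 hW).
split=> [i|i i']; first exact: (L2_period_end hw sigma a0 ab lxi lkap skap hV).
exact: (period_moments hw sigma a0 ab wxi lxi lkap skap hV).
Qed.

Lemma is_ito_ext T (H H' : R -> Omega -> R) I :
  (forall s o, 0 <= s < T -> H s o = H' s o) ->
  is_ito_integral Pr F w T H I -> is_ito_integral Pr F w T H' I.
Proof.
move=> e [mH mI [S [aS c1 c2]]]; split => //.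
  apply: eq_measurable_fun mH => -[s y]; rewrite inE /= => -[+ _].
  by rewrite in_itv /= => sT; exact: e.
have e2 : (fun j => \int[Pr]_o \int[mu]_(s in `[0%R, T[)
     ((H' s o - simple_val (S j) s o) ^+ 2)%:E)%E =
   (fun j => \int[Pr]_o \int[mu]_(s in `[0%R, T[)
     ((H s o - simple_val (S j) s o) ^+ 2)%:E)%E.
  apply/funext => j; apply: eq_integral => o _; apply: eq_integral => s.
  by rewrite inE /= in_itv /= => sT; rewrite e.
by exists S; split; [exact: aS|rewrite e2; exact: c1|exact: c2].
Qed.

Section solutions.
Context {n m : nat}.
Variables (A : 'M[R]_n) (B : 'M[R]_(n, m)) (sigma : R) (x : 'cV[R]_n).

Lemma state_solution_restrict T T' u X : T' <= T ->
  state_solution Pr F w A B sigma T x u X -> state_solution Pr F w A B sigma T' x u X.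
Proof.
move=> TT' [h1 h2 h3 h4]; have le t : 0 <= t <= T' -> 0 <= t <= T.
  by move=> /andP[-> /le_trans]; exact.
split.
- by move=> t /le; exact: h1.
- move=> i; apply: measurable_funS (h2 i).
    by apply: measurableX => //; exact: measurable_itv.
  by move=> [s y] /= []; rewrite !in_itv /= => /le.
- apply: filterS h3 => o h i; apply: integrableS (h i) => //.
  by move=> s /=; rewrite !in_itv /= => /andP[-> /lt_le_trans]; exact.
- by move=> t /le; exact: h4.
Qed.

Lemma state_solution_ext T u u' X X' :
  (forall s o, 0 <= s < T -> u s o = u' s o) ->
  (forall s o, 0 <= s <= T -> X s o = X' s o) ->
  state_solution Pr F w A B sigma T x u X -> state_solution Pr F w A B sigma T x u' X'.
Proof.
move=> eu eX [h1 h2 h3 h4]; have le s : 0 <= s < T -> 0 <= s <= T.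
  by move=> /andP[-> /ltW].
split.
- move=> t ht i; rewrite (_ : (fun o => _) = (fun o => X t o i 0)); first exact: h1.
  by apply/funext => o; rewrite eX.
- move=> i; apply: eq_measurable_fun (h2 i) => -[s y]; rewrite inE /= => -[+ _].
  by rewrite in_itv /= => sT; rewrite eX.
- apply: filterS h3 => o h i; apply: eq_integrable (h i) => // s; rewrite inE /= in_itv /= => sT.
  by rewrite eu// eX// le.
- move=> t ht; have [I [hI eI]] := h4 t ht; exists I.
  have lt s : 0 <= s < t -> 0 <= s < T.
    by case/andP: ht => _ tT /andP[-> st]; exact: lt_le_trans tT.
  split; first by move=> i; apply: is_ito_ext (hI i) => s o /lt sT; rewrite eu.
  apply: filterS eI => o h i; rewrite -eX// h; congr (_ + _ + _).
  apply: eq_Rintegral => s; rewrite inE /= in_itv /= => /lt sT.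
  by rewrite eu// eX// le.
Qed.

End solutions.
End Extension.

Section Gains.
Context {R : realType} {n m : nat}.
Notation mu := (@lebesgue_measure R).
Notation time := (measurableTypeR R).
Variable tau : R.
Hypothesis tau0 : 0 < tau.

Definition window_gain (K : R -> 'M[R]_(m, n)) (s : time) : 'M[R]_(m, n) :=
  itvf 0 tau s *: K s.

Let mI : measurable (`[0, tau[%classic : set time). Proof. exact: measurable_itv. Qed.

Let window_patch (K : R -> 'M[R]_(m, n)) i j :
  (fun s : time => window_gain K s i j) = (fun s => K s i j) \_ (`[0, tau[%classic : set time).
Proof.
apply/funext => s; rewrite mxE patchE itvfE mem_setE in_itv /=.
by case: (_ && _); rewrite ?mul1r ?mul0r.
Qed.

Let tr_sq (K : 'M[R]_(m, n)) : \tr (K^T *m K) = \sum_j \sum_i K i j ^+ 2.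
Proof.
by apply: eq_bigr => j _; rewrite mxE; apply: eq_bigr => i _; rewrite mxE -expr2.
Qed.

Lemma admissible_mL2 N (K : nat -> R -> 'M[R]_(m, n)) k : admissible_law tau N K -> (k < N)%N ->
  mL2 (window_gain (K k)).
Proof.
move=> aK kN i j; have [mK lK] := aK k kN.
have mw p q : measurable_fun [set: time] (fun s : time => window_gain (K k) s p q).
  by have := (measurable_restrictT _ mI).1 (mK p q); rewrite window_patch.
apply: L2P => //; apply: le_lt_trans lK; rewrite [leRHS]integral_mkcond.
apply: ge0_le_integral => //.
- by move=> s _; rewrite lee_fin sqr_ge0.
- by apply/measurable_EFinP; exact: measurable_funX.
- have mtr : measurable_fun [set: time] (fun s : time => \sum_q \sum_p window_gain (K k) s p q ^+ 2).
    by apply: measurable_sum => q; apply: measurable_sum => p; exact: measurable_funX.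
  move/measurable_EFinP: mtr; congr (measurable_fun _ _); apply/funext => s /=.
  rewrite patchE mem_setE in_itv /= tr_sq; case: ifPn => h.
    congr EFin; apply: eq_bigr => q _; apply: eq_bigr => p _.
    by rewrite mxE itvfE h mul1r.
  by rewrite big1// => q _; rewrite big1// => p _; rewrite mxE itvfE (negbTE h) mul0r expr0n.
- move=> s _; rewrite patchE mem_setE in_itv /= mxE itvfE; case: ifPn => h.
    rewrite mul1r lee_fin tr_sq (bigD1 j)//= (bigD1 i)//= -addrA lerDl addr_ge0 ?sumr_ge0// => *.
      exact: sqr_ge0.
    by apply: sumr_ge0 => *; exact: sqr_ge0.
  by rewrite mul0r expr0n.
Qed.

Lemma mL2_admissible (K : R -> 'M[R]_(m, n)) : mL2 (window_gain K) ->
  (forall i j, measurable_fun (`[0, tau[ : set time) (fun s => K s i j)) /\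
  (\int[mu]_(s in `[0%R, tau[) (\tr ((K s)^T *m K s))%:E < +oo)%E.
Proof.
move=> lK; split=> [i j|].
  by apply: (measurable_restrictT _ mI).2; rewrite -window_patch; exact: L2_meas (lK i j).
have l : L1 mu (fun s => \sum_q \sum_p (window_gain K s p q * window_gain K s p q)).
  by apply: L1_sum => q _; apply: L1_sum => p _; exact: L2M.
apply: le_lt_trans (ltry (\int[mu]_s \sum_q \sum_p (window_gain K s p q * window_gain K s p q))).
rewrite -fin_L1// [leLHS]integral_mkcond le_eqVlt; apply/orP; left; apply/eqP.
apply: eq_integral => s _; rewrite patchE mem_setE in_itv /= tr_sq; case: ifPn => h.
  congr EFin; apply: eq_bigr => q _; apply: eq_bigr => p _.
  by rewrite mxE itvfE h mul1r expr2.
by rewrite big1// => q _; rewrite big1// => p _; rewrite mxE itvfE (negbTE h) !mul0r.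
Qed.

Lemma itvf_affine a (s : R) : itvf 0 tau (affine false (- a) s) = itvf a (a + tau) s.
Proof. by rewrite !itvfE /affine expr0 mul1r subr_ge0 ltrBlDl. Qed.

Lemma feedbackE {d} {Omega : measurableType d} (K : nat -> R -> 'M[R]_(m, n))
  (X : R -> Omega -> 'cV[R]_n) k t o : k%:R * tau <= t < k.+1%:R * tau ->
  feedback tau K X t o = K k (t - k%:R * tau) *m X (k%:R * tau) o.
Proof.
move=> h; rewrite /feedback /=; have -> // : Num.truncn (t / tau) = k.
by apply: truncn_def; rewrite ler_pdivlMr// ltr_pdivrMr.
Qed.

Lemma period_of (t : R) : 0 <= t ->
  exists k, k%:R * tau <= t < k.+1%:R * tau.
Proof.
move=> t0; exists (Num.truncn (t / tau)).
by rewrite -ler_pdivlMr// -ltr_pdivrMr// truncn_itv// divr_ge0// ltW.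
Qed.

End Gains.

Section Moments.
Context {d : measure_display} {Omega : measurableType d} {R : realType}.
Variable Pr : probability Omega R.
Notation mu := (@lebesgue_measure R).
Notation time := (measurableTypeR R).

Definition EQ n (W : 'M[R]_n) (Y : Omega -> 'cV[R]_n) : R := \int[Pr]_o quadmx W (Y o).

Definition L2v n (Y : Omega -> 'cV[R]_n) := forall i, L2 Pr (fun o => Y o i 0).

Lemma EQE n (W : 'M[R]_n) Y : L2v Y -> L1 Pr (fun o => quadmx W (Y o)) /\
  EQ W Y = \sum_i \sum_j W i j * ip Pr (fun o => Y o i 0) (fun o => Y o j 0).
Proof.
move=> lY; have l i j : L1 Pr (fun o => W i j * (Y o i 0 * Y o j 0)).
  by apply: L1Z; exact: (L2M (lY i) (lY j)).
have ls i : L1 Pr (fun o => \sum_j W i j * (Y o i 0 * Y o j 0)) by apply: L1_sum.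
split.
  have := L1_sum (index_enum 'I_n) (P := xpredT) (fun i _ => ls i).
  by apply: L1_eq => o; rewrite quadmxE.
rewrite /EQ (@eq_int _ _ _ Pr _ (fun o => \sum_i \sum_j W i j * (Y o i 0 * Y o j 0))).
  rewrite int_sum//; apply: eq_bigr => i _; rewrite int_sum//; apply: eq_bigr => j _.
  by rewrite intZl//; exact: (L2M (lY i) (lY j)).
by move=> o; rewrite quadmxE.
Qed.

Lemma EQD n (V W : 'M[R]_n) Y : L2v Y -> EQ (V + W) Y = EQ V Y + EQ W Y.
Proof.
move=> lY; rewrite /EQ -intD; [|exact: (EQE V lY).1|exact: (EQE W lY).1].
by apply: eq_int => o; rewrite quadmxD.
Qed.

Lemma EQZ n c (W : 'M[R]_n) Y : L2v Y -> EQ (c *: W) Y = c * EQ W Y.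
Proof.
move=> lY; rewrite /EQ -intZl; last exact: (EQE W lY).1.
by apply: eq_int => o; rewrite quadmxZ.
Qed.

Lemma EQ_ge0 n (W : 'M[R]_n) Y : psdmx W -> 0 <= EQ W Y.
Proof. by move=> [_ pW]; apply: int_ge0. Qed.

Lemma L2v_ae n (Y Y' : Omega -> 'cV[R]_n) :
  (forall i, measurable_fun [set: Omega] (fun o => Y' o i 0)) ->
  {ae Pr, forall o, Y o = Y' o} -> L2v Y -> L2v Y'.
Proof.
move=> mY' e lY i; apply: (ae_L2 _ _ (lY i)) => //.
by apply: filterS e => o ->.
Qed.

Lemma EQ_ae n (W : 'M[R]_n) Y Y' : L2v Y -> L2v Y' ->
  {ae Pr, forall o, Y o = Y' o} -> EQ W Y = EQ W Y'.
Proof.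
move=> lY lY' e; apply: ae_int.
- exact: L1_meas (EQE W lY).1.
- exact: L1_meas (EQE W lY').1.
- by apply: filterS e => o ->.
Qed.

Lemma conjmxE n (Phi W : 'M[R]_n) j j' :
  (Phi^T *m W *m Phi) j j' = \sum_i \sum_i' W i i' * (Phi i j * Phi i' j').
Proof.
rewrite mxE exchange_big; apply: eq_bigr => i' _; rewrite mxE mulr_suml.
by apply: eq_bigr => i _; rewrite mxE; ring.
Qed.

Lemma exchange_quad (I J : finType) (W : I -> I -> R) (c : I -> J -> I -> J -> R)
  (s : J -> J -> R) :
  \sum_i \sum_i' W i i' * (\sum_j \sum_j' c i j i' j' * s j j') =
  \sum_j \sum_j' (\sum_i \sum_i' W i i' * c i j i' j') * s j j'.
Proof.
rewrite pair_big [RHS]pair_big /=.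
transitivity (\sum_(p : I * I) \sum_(q : J * J)
   W p.1 p.2 * (c p.1 q.1 p.2 q.2 * s q.1 q.2)).
  by apply: eq_bigr => p _; rewrite pair_big mulr_sumr.
rewrite exchange_big; apply: eq_bigr => q _; rewrite pair_big mulr_suml.
by apply: eq_bigr => p _; rewrite mulrA.
Qed.

End Moments.

Section PeriodMoments.
Context {d : measure_display} {Omega : measurableType d} {R : realType}.
Variable Pr : probability Omega R.
Notation mu := (@lebesgue_measure R).
Notation time := (measurableTypeR R).
Context {n m : nat}.
Variables (A : 'M[R]_n) (B : 'M[R]_(n, m)) (sigma tau a : R) (g : time -> 'M[R]_(m, n)).
Hypotheses (lg : mL2 g) (sg : supported 0 tau g).

Definition shifted_gain (s : time) : 'M[R]_n := B *m g (affine false (- a) s).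

(** Dual to the linear map that carries the second moments of the state to those
    at the next sampling instant. *)
Definition second_moment_map (W : 'M[R]_n) : 'M[R]_n :=
  (mean_gain A B tau g)^T *m W *m mean_gain A B tau g
  + sigma ^+ 2 *: mint (fun s : time => (expmx ((tau - s) *: A) *m B *m g s)^T *m W
                             *m (expmx ((tau - s) *: A) *m B *m g s)).

Lemma mL2_shifted : mL2 shifted_gain.
Proof. by apply: mL2_mull => i j; exact: L2_affine (lg i j). Qed.

Lemma supported_shifted : supported a (a + tau) shifted_gain.
Proof. by move=> s; rewrite /shifted_gain scalemxAr -itvf_affine sg. Qed.

Let Gam (s : time) : 'M[R]_n := expmx ((tau - s) *: A) *m B *m g s.

Let lGam : mL2 Gam.
Proof.
apply: (mL2_cts _ lg sg); apply: ctsmxM; last exact: ctsmx_cst.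
apply: (@ctsmx_comp _ _ _ (fun s => expmx (s *: A)) (fun s => tau - s)); first exact: ctsmx_expmx.
by move=> s; apply: cvgB; [exact: cvg_cst|exact: cvg_id].
Qed.

Let gainE i j s : period_gain A (a + tau) shifted_gain i j s = Gam (affine false (- a) s) i j.
Proof.
have e : tau - affine false (- a) s = a + tau - s by rewrite /affine expr0 mul1r; ring.
by rewrite /period_gain /shifted_gain /Gam e mulmxA.
Qed.

Let meanE i j : period_mean A a (a + tau) shifted_gain i j = mean_gain A B tau g i j.
Proof.
rewrite /period_mean /mean_gain addrAC subrr add0r [RHS]mxE; congr (_ + _).
rewrite [RHS]mxE -[RHS](int_affine false (- a) (L2_meas (lGam i j))).
by apply: eq_int => s; rewrite gainE.
Qed.

Let ip_gain i j i' j' :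
  ip mu (period_gain A (a + tau) shifted_gain i j) (period_gain A (a + tau) shifted_gain i' j')
  = \int[mu]_s (Gam s i j * Gam s i' j').
Proof.
have m1 := L1_meas (L2M (lGam i j) (lGam i' j')).
rewrite -[RHS](int_affine false (- a) m1); apply: eq_int => s.
by rewrite !gainE.
Qed.

Lemma second_momentP (W : 'M[R]_n) (xi eta : Omega -> 'cV[R]_n) :
  L2v Pr xi -> L2v Pr eta ->
  (forall i i', ip Pr (fun o => eta o i 0) (fun o => eta o i' 0) =
    \sum_j \sum_j' (period_mean A a (a + tau) shifted_gain i j
        * period_mean A a (a + tau) shifted_gain i' j'
      + sigma ^+ 2 * ip mu (period_gain A (a + tau) shifted_gain i j)
                           (period_gain A (a + tau) shifted_gain i' j'))
      * ip Pr (fun o => xi o j 0) (fun o => xi o j' 0)) ->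
  EQ Pr W eta = EQ Pr (second_moment_map W) xi.
Proof.
move=> lxi leta h; rewrite (EQE W leta).2 (EQE _ lxi).2.
rewrite (eq_bigr (fun i => \sum_i' W i i' * (\sum_j \sum_j'
  (mean_gain A B tau g i j * mean_gain A B tau g i' j'
    + sigma ^+ 2 * \int[mu]_s (Gam s i j * Gam s i' j'))
   * ip Pr (fun o => xi o j 0) (fun o => xi o j' 0)))); last first.
  move=> i _; apply: eq_bigr => i' _; rewrite h; congr (_ * _).
  by apply: eq_bigr => j _; apply: eq_bigr => j' _; rewrite !meanE ip_gain.
rewrite (exchange_quad W (fun i j i' j' => mean_gain A B tau g i j * mean_gain A B tau g i' j'
    + sigma ^+ 2 * \int[mu]_s (Gam s i j * Gam s i' j'))).
apply: eq_bigr => j _; apply: eq_bigr => j' _; congr (_ * _).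
rewrite [RHS]mxE conjmxE [X in _ + X]mxE [X in _ + _ * X]mxE.
rewrite (@eq_int _ _ _ mu _ (fun s => \sum_i \sum_i' W i i' * (Gam s i j * Gam s i' j'))); last first.
  by move=> s; rewrite conjmxE.
rewrite int_sum; last by move=> i _; apply: L1_sum => i' _; apply: L1Z; exact: L2M.
rewrite mulr_sumr -big_split; apply: eq_bigr => i _ /=.
rewrite int_sum; last by move=> i' _; apply: L1Z; exact: L2M.
rewrite mulr_sumr -big_split; apply: eq_bigr => i' _ /=.
by rewrite intZl; [ring|exact: L2M].
Qed.

End PeriodMoments.

(** * Existence of trajectories *)

Section Trajectories.
Context {d : measure_display} {Omega : measurableType d} {R : realType}.
Variable Pr : probability Omega R.
Variable F : R -> set (set Omega).
Variable w : R -> Omega -> R.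
Hypothesis hw : wiener_process Pr F w.
Notation mu := (@lebesgue_measure R).
Notation time := (measurableTypeR R).
Context {n m : nat}.
Variables (A : 'M[R]_n) (B : 'M[R]_(n, m)) (sigma tau : R) (x : 'cV[R]_n).
Hypothesis tau0 : 0 < tau.
Variable K : nat -> R -> 'M[R]_(m, n).

Let gain k := window_gain tau (K k).
Let transfer k := second_moment_map A B sigma tau (gain k).
Let at_ (k : nat) : R := k%:R * tau.

Let at_ge0 k : 0 <= at_ k. Proof. by rewrite /at_ mulr_ge0 ?ler0n ?ltW. Qed.
Let at_le j k : (j <= k)%N -> at_ j <= at_ k.
Proof. by move=> jk; rewrite /at_ ler_wpM2r ?ler_nat ?ltW. Qed.
Let atS k : at_ k.+1 = at_ k + tau.
Proof. by rewrite /at_ -natr1 mulrDl mul1r. Qed.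

(** The induction hypothesis for the construction by periods. Beyond solving the
    equation, the next period needs the state at the last sampling instant to be
    square integrable and the process to be jointly measurable on the whole
    line. *)
Record regular (k : nat) (X : R -> Omega -> 'cV[R]_n) : Prop := Regular {
  regular_init : forall o, X 0 o = x;
  regular_solution : state_solution Pr F w A B sigma (at_ k) x (feedback tau K X) X;
  regular_measurable : forall i, measurable_fun [set: (Omega * time)%type]
    (fun q => X q.2 q.1 i 0);
  regular_L2 : forall j, (j <= k)%N -> L2v Pr (X (at_ j));
  regular_moment : forall j W, (j < k)%N ->
    EQ Pr W (X (at_ j.+1)) = EQ Pr (transfer j W) (X (at_ j)) }.

Lemma regular0 : regular 0 (fun _ _ => x).
Proof.
have T0 : at_ 0 = 0 by rewrite /at_ mul0r.
split => //; last first.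
- by move=> j _ i; exact: L2_cst.
rewrite T0; split.
- by move=> t /andP[t0 _] i; apply: wrt_cst; exact: (sF hw).
- by move=> i; exact: measurable_cst.
- by apply: filterE => o i; rewrite set_itvco0; exact: integrable_set0.
move=> t ht; have -> : t = 0 by apply/le_anti; rewrite andbC.
exists (fun=> 0); split.
  move=> i; apply: (ito_is_ito hw) => //.
    by rewrite set_itvco0 set0X; exact: measurable_fun_set0.
  have h : ito Pr F w 0 0 (fun=> 0) (fun=> 0) by apply: ito_elem => //; exact: elem_nil.
  apply: (ito_ext h) => [p|o]; last by rewrite mxE.
  by rewrite /cut itvfE; case: (leP 0 (p.2 : R)) => _ /=; rewrite mulr0.
apply: filterE => o i; rewrite set_itvco0 Rintegral_set0 mxE mulr0 !addr0.
by [].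
Qed.

(** Given a solution up to k tau, the process X' follows it and then the
    one-period solution Y started from X (k tau). *)
Section step.
Variables (k : nat) (X : R -> Omega -> 'cV[R]_n).
Hypotheses (gX : regular k X) (lg : mL2 (gain k)).

Let a := at_ k.
Let b := at_ k.+1.
Let a0 : 0 <= a. Proof. exact: at_ge0. Qed.
Let bE : b = a + tau. Proof. exact: atS. Qed.
Let ab : a < b. Proof. by rewrite bE ltrDl. Qed.
Let xi := X a.
Let kap := shifted_gain B a (gain k).

Let lxi : L2v Pr xi. Proof. by apply: (regular_L2 gX). Qed.
Let lkap : mL2 kap. Proof. exact: mL2_shifted. Qed.
Let skap : supported a b kap.
Proof. by rewrite bE; apply: supported_shifted; exact: supported_itvf. Qed.

Variables (Y : R -> Omega -> 'cV[R]_n) (J : 'I_n -> R -> Omega -> R).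
Hypothesis wY : forall t i, a <= t -> measurable_wrt (F t) (fun o => Y t o i 0).
Hypothesis mY : forall i, measurable_fun [set: (Omega * time)%type]
  (fun q => Y q.2 q.1 i 0).
Hypothesis eY : forall t, a <= t -> t <= b -> {ae Pr, forall o, forall i,
  L1 mu (fun s => (A *m Y s o + kap s *m xi o) i 0 * itvf a t s) /\
  Y t o i 0 = xi o i 0 + \int[mu]_s ((A *m Y s o + kap s *m xi o) i 0 * itvf a t s)
    + sigma * J i t o}.
Hypothesis iJ : forall i t, a <= t -> ito Pr F w a t
  (fun p => \sum_j xi p.1 j 0 * (kap p.2 i j * itvf a t p.2)) (J i t).
Hypothesis lY : L2v Pr (Y b).
Hypothesis mom : forall W, EQ Pr W (Y b) = EQ Pr (transfer k W) xi.

Let X' t o := if t <= a then X t o else Y t o.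
Let u' := feedback tau K X'.

Let X'le t : t <= a -> X' t = X t.
Proof. by move=> ta; apply/funext => o; rewrite /X' ta. Qed.
Let X'gt t : a < t -> X' t = Y t.
Proof. by move=> ta; apply/funext => o; rewrite /X' leNgt ta. Qed.

Let mX' i : measurable_fun [set: (Omega * time)%type] (fun q => X' q.2 q.1 i 0).
Proof.
rewrite (_ : (fun q => _) = (fun q : Omega * time =>
  if (q.2 : R) <= a then X q.2 q.1 i 0 else Y q.2 q.1 i 0)).
  apply: measurable_fun_ifT => //; last exact: regular_measurable gX i.
  apply: measurable_fun_ler => //; exact: measurable_snd.
by apply/funext => q; rewrite /X'; case: ifP.
Qed.

Let u'_old s o : 0 <= s < a -> feedback tau K X s o = u' s o.
Proof.
move=> /andP[s0 sa]; have [j hj] := period_of tau0 s0.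
rewrite /u' !(feedbackE tau0 _ _ _ hj) X'le//.
by have /andP[js _] := hj; exact: le_trans js (ltW sa).
Qed.

Let u'_new s o : a <= s < b -> B *m u' s o = kap s *m xi o.
Proof.
move=> h; rewrite /u' (feedbackE tau0 _ _ _ h) X'le// /kap /shifted_gain /gain /window_gain.
rewrite itvf_affine -bE itvfE h scale1r -mulmxA; congr (_ *m (K k _ *m _)).
by rewrite /affine expr0 mul1r.
Qed.

Let sol_a : state_solution Pr F w A B sigma a x u' X'.
Proof.
apply: state_solution_ext (regular_solution gX); first exact: u'_old.
by move=> s o /andP[_ sa]; rewrite X'le.
Qed.

Let ctrl_split t i s o : a <= t -> t <= b ->
  (B *m u' s o) i 0 * itvf 0 t s = (B *m u' s o) i 0 * itvf 0 a s
    + \sum_j xi o j 0 * (kap s i j * itvf a t s).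
Proof.
move=> a_t tb; rewrite (itvf_split s a0 a_t) mulrDr; congr (_ + _).
rewrite itvfE; case: (boolP (a <= s < t)) => h; last by rewrite mulr0 big1// => j _; rewrite !mulr0.
rewrite u'_new; last by have /andP[-> st] := h; exact: lt_le_trans st tb.
by rewrite mulr1 mxE; apply: eq_bigr => j _; rewrite mulr1 mulrC.
Qed.

Let ictrl_a : exists I : Omega -> 'cV[R]_n,
  (forall i, is_ito_integral Pr F w a (fun s o => (B *m u' s o) i 0) (fun o => I o i 0)) /\
  {ae Pr, forall o, forall i, X' a o i 0 = x i 0
     + (\int[mu]_(s in `[0, a[) ((A *m X' s o + B *m u' s o) i 0))%R + sigma * I o i 0}.
Proof. by apply: (state_equation sol_a); rewrite a0 lexx. Qed.

Let mctrl t i : a <= t -> t <= b -> measurable_fun [set: (Omega * time)%type]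
  (cut t (fun s o => (B *m u' s o) i 0)).
Proof.
move=> a_t tb; rewrite (_ : cut t _ = (fun p => cut a (fun s o => (B *m u' s o) i 0) p
   + \sum_j xi p.1 j 0 * (kap p.2 i j * itvf a t p.2))); last first.
  by apply/funext => p; rewrite /cut ctrl_split.
have [I [hI _]] := ictrl_a; have [mI _ _] := hI i.
apply: measurable_funD; first exact: measurable_cut.
apply: measurable_sum => j; apply: measurable_funM.
  exact: (measurableT_comp (L2_meas (lxi j)) (@measurable_fst _ _ Omega time)).
have mk : measurable_fun [set: time] (fun s => kap s i j * itvf a t s).
  by apply: measurable_funM; [exact: L2_meas (lkap i j)|exact: measurable_itvf].
exact: (measurable_time mk).
Qed.

Let mctrl_set t i : a <= t -> t <= b ->
  measurable_fun ((`[0, t[ : set time) `*` setT)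
    (fun p : time * Omega => (B *m u' p.1 p.2) i 0).
Proof.
move=> a_t tb; have h := measurableT_comp (mctrl i a_t tb) (@measurable_swap _ _ time Omega).
have h' : measurable_fun ((`[0, t[ : set time) `*` setT)
    (fun p : time * Omega => cut t (fun s o => (B *m u' s o) i 0) (p.2, p.1)).
  by apply: measurable_funTS; exact: h.
apply: eq_measurable_fun h' => -[s y]; rewrite inE /= => -[+ _].
by rewrite in_itv /= /cut /= itvfE => ->; rewrite mulr1.
Qed.

Let drift o i s := (A *m X' s o + B *m u' s o) i 0.

Let drift_path t o i : a <= t -> t <= b ->
  L1 mu (fun s => drift o i s * itvf 0 a s) ->
  L1 mu (fun s => (A *m Y s o + kap s *m xi o) i 0 * itvf a t s) ->
  L1 mu (fun s => drift o i s * itvf 0 t s) /\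
  \int[mu]_s (drift o i s * itvf 0 t s) = \int[mu]_s (drift o i s * itvf 0 a s)
    + \int[mu]_s ((A *m Y s o + kap s *m xi o) i 0 * itvf a t s).
Proof.
move=> a_t tb l1 l2; have l := L1D l1 l2.
have mf : measurable_fun [set: time] (fun s => drift o i s * itvf 0 t s).
  rewrite (_ : (fun s => _) = (fun s : time => (\sum_j A i j * X' s o j 0) * itvf 0 t s
     + cut t (fun s o => (B *m u' s o) i 0) (o, s))); last first.
    by apply/funext => s; rewrite /drift /cut /= [X in X * _]mxE mulrDl mxE.
  apply: measurable_funD.
    apply: measurable_funM; last exact: measurable_itvf.
    apply: measurable_sum => j; apply: measurable_funM => //.
    exact: (measurableT_comp (mX' j) (measurable_pair1 o)).
  exact: (measurableT_comp (mctrl i a_t tb) (measurable_pair1 o)).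
(* At s = a the process X' still has the old value, whence a null set. *)
have e : {ae mu, forall s : time, drift o i s * itvf 0 a s
    + (A *m Y s o + kap s *m xi o) i 0 * itvf a t s = drift o i s * itvf 0 t s}.
  exists [set a]; split; [exact: measurable_set1|exact: lebesgue_measure_set1|].
  move=> s /= h; apply: contrapT => sa; apply: h.
  rewrite (itvf_split s a0 a_t) mulrDr; congr (_ + _).
  rewrite itvfE; case: (boolP (a <= s < t)) => h; last by rewrite !mulr0.
  have /andP[las st] := h.
  have lts : a < s by rewrite lt_neqAle las andbT; apply/eqP => e; apply: sa; rewrite e.
  rewrite /drift X'gt// u'_new// las; exact: lt_le_trans st tb.
split; first exact: ae_L1 e l.
by rewrite -intD//; apply: esym; apply: ae_int => //; exact: L1_meas l.
Qed.

Let drift_a : {ae Pr, forall o, forall i, L1 mu (fun s => drift o i s * itvf 0 a s)}.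
Proof. by apply: filterS (state_drift sol_a) => o h i; have /L1_itv := h i. Qed.

Lemma regular_step : regular k.+1 X'.
Proof.
split.
- by move=> o; rewrite X'le// (regular_init gX).
- split.
  + move=> t /andP[t0 tb] i; have [ta|ta] := leP t a.
      by apply: (state_adapted sol_a); rewrite t0.
    by rewrite (X'gt ta); apply: wY; exact: ltW.
  + move=> i; have h := measurableT_comp (mX' i) (@measurable_swap _ _ time Omega).
    by apply: measurable_funTS; exact: h.
  + apply: filterS2 drift_a (eY (ltW ab) (lexx b)) => o l1 l2 i; apply/L1_itv.
    by have [l2' _] := l2 i; have [] := drift_path (ltW ab) (lexx b) (l1 i) l2'.
  move=> t /andP[t0 tb]; have [ta|ta] := leP t a.
    by apply: (state_equation sol_a); rewrite t0.
  have [I [hI eI]] := ictrl_a; have at' := ltW ta.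
  exists (fun o => \col_i (I o i 0 + J i t o)); split.
    move=> i; apply: (ito_is_ito hw t0); first exact: mctrl_set.
    have h1 := ito_widen (lexx 0) at' (is_ito_ito hw a0 (hI i)).
    have h2 := ito_widen a0 (lexx t) (iJ i at').
    apply: (ito_ext (ito_add hw (lexx 0) h1 h2)) => [p|o].
      by rewrite /cut [RHS](ctrl_split _ _ _ at' tb).
    by rewrite mxE.
  apply: filterS2 (ae_and eI drift_a) (eY at' tb) => o [e1 l1] e2 i.
  have [l2 e2'] := e2 i; have [_ e3] := drift_path at' tb (l1 i) l2.
  have eR c : \int[mu]_(s in `[0, c[) ((A *m X' s o + B *m u' s o) i 0) =
    \int[mu]_s (drift o i s * itvf 0 c s) by rewrite int_itvf_itv.
  have eC : (\col_i (I o i 0 + J i t o)) i 0 = I o i 0 + J i t o by rewrite mxE.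
  have exi : xi o i 0 = x i 0 + \int[mu]_s (drift o i s * itvf 0 a s) + sigma * I o i 0.
    by rewrite -eR -(e1 i) (X'le (lexx a)).
  rewrite (X'gt ta) e2' eR e3 eC exi.
  move: (\int[mu]_s _) (\int[mu]_s _) => p q; ring.
- exact: mX'.
- move=> j; rewrite leq_eqVlt => /predU1P[->|jk].
    by rewrite (X'gt ab).
  by rewrite X'le; [exact: (regular_L2 gX)|exact: at_le].
- move=> j W; rewrite ltnS leq_eqVlt => /predU1P[->|jk].
    by rewrite (X'gt ab) (X'le (lexx a)) mom.
  rewrite !X'le; [exact: (regular_moment gX)|exact: at_le (ltnW jk)|exact: at_le].
Qed.

End step.

Lemma regular_exists N : (forall k, (k < N)%N -> mL2 (gain k)) -> exists X, regular N X.
Proof.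
elim: N => [|k ih] lg; first by exists (fun _ _ => x); exact: regular0.
have [j jk|X gX] := ih; first by apply: lg; exact: leqW.
have lgk := lg k (ltnSn k); have sg := @supported_itvf R m n 0 tau (K k).
have a0 := at_ge0 k; have ab : at_ k < at_ k.+1 by rewrite atS ltrDl.
have lxi : L2v Pr (X (at_ k)) by apply: (regular_L2 gX).
have wxi j : measurable_wrt (F (at_ k)) (fun o => X (at_ k) o j 0).
  by apply: (state_adapted (regular_solution gX)); rewrite a0 lexx.
have lk := mL2_shifted B (at_ k) lgk.
have sk : supported (at_ k) (at_ k.+1) (shifted_gain B (at_ k) (gain k)).
  by rewrite atS; exact: supported_shifted.
have [Y [J [wY mY eY iJ [lY mom]]]] := period_exists hw A sigma a0 ab wxi lxi lk sk.
eexists; apply: (regular_step gX lgk wY mY eY iJ lY) => W.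
rewrite atS in lY mom; rewrite atS.
exact: (second_momentP lgk sg W lxi lY mom).
Qed.

End Trajectories.

(** * The cost of a law *)

Lemma ae_affine {R : realType} (e : bool) (c : R) (P : measurableTypeR R -> Prop) :
  {ae @lebesgue_measure R, forall s : measurableTypeR R, P s} ->
  {ae @lebesgue_measure R, forall s : measurableTypeR R, P (affine e c s)}.
Proof.
move=> [N [mN N0 sN]]; exists (affine e c @^-1` N); split.
- by have := measurable_affine e c measurableT mN; rewrite setTI.
- by have := affine_measure e c mN; rewrite N0 => /esym.
- by move=> s /= h; apply: sN.
Qed.

Section Comparison.
Context {d : measure_display} {Omega : measurableType d} {R : realType}.
Variable Pr : probability Omega R.
Variable F : R -> set (set Omega).
Variable w : R -> Omega -> R.
Hypothesis hw : wiener_process Pr F w.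
Notation mu := (@lebesgue_measure R).
Notation time := (measurableTypeR R).
Context {n m : nat}.
Variables (A : 'M[R]_n) (B : 'M[R]_(n, m)) (sigma tau : R) (x : 'cV[R]_n).
Hypothesis tau0 : 0 < tau.
Variable N : nat.

(** Induction over the periods: controls that agree up to j tau give, by
    state_solution_unique, states that agree at j tau, and the gains of period j
    then act on the same state. With K = K' it is uniqueness of the trajectory
    of a law; in general it compares two laws whose gains differ only where the
    state does not see it. *)
Lemma trajectory_compare (K K' : nat -> R -> 'M[R]_(m, n)) X X' :
  trajectory Pr F w A B sigma tau N x K X ->
  trajectory Pr F w A B sigma tau N x K' X' ->
  (forall k, (k < N)%N -> {ae mu, forall s : time, (0 <= (s : R) < tau) ->
     {ae Pr, forall o, K k s *m X (k%:R * tau) o = K' k s *m X (k%:R * tau) o}}) ->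
  (forall t, 0 <= t <= N%:R * tau -> {ae Pr, forall o, X t o = X' t o}) /\
  same_control Pr tau N (feedback tau K X) (feedback tau K' X').
Proof.
move=> hX hX' hK.
have T0 j : 0 <= j%:R * tau by rewrite mulr_ge0 ?ler0n ?ltW.
have Tle j k : (j <= k)%N -> j%:R * tau <= k%:R * tau by move=> jk; rewrite ler_wpM2r ?ler_nat ?ltW.
pose ctrl j := {ae mu, forall t, t \in `[0, j%:R * tau[ ->
  {ae Pr, forall o, feedback tau K X t o = feedback tau K' X' t o}}.
have uniq j : (j <= N)%N -> ctrl j ->
    forall t, 0 <= t <= j%:R * tau -> {ae Pr, forall o, X t o = X' t o}.
  move=> jN cj; have TjN := Tle _ _ jN.
  exact: (state_solution_unique hw (T0 j) (state_solution_restrict TjN hX)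
    (state_solution_restrict TjN hX') cj).
have all_ctrl j : (j <= N)%N -> ctrl j.
  elim: j => [_|j ih jN].
    have res0 : {ae mu, forall t : time, (t : R) \in `[0, 0%:R * tau[ ->
       {ae Pr, forall o, feedback tau K X t o = feedback tau K' X' t o}}.
      apply: filterE => t; rewrite mul0r in_itv /= => /andP[t0 t1].
      by have := le_lt_trans t0 t1; rewrite ltxx.
    exact: res0.
  have cj := ih (ltnW jN).
  have Xj : {ae Pr, forall o, X (j%:R * tau) o = X' (j%:R * tau) o}.
    by apply: (uniq j (ltnW jN) cj); rewrite T0 lexx.
  have := ae_affine false (- (j%:R * tau)) (hK j jN).
  move=> aj; have cj' : {ae mu, forall t : time, (t : R) \in `[0, j%:R * tau[ ->
     {ae Pr, forall o, feedback tau K X t o = feedback tau K' X' t o}} := cj.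
  have res : {ae mu, forall t : time, (t : R) \in `[0, j.+1%:R * tau[ ->
     {ae Pr, forall o, feedback tau K X t o = feedback tau K' X' t o}}.
    apply: filterS2 cj' aj => t h1 h2 tT.
    have [tj|jt] := ltP (t : R) (j%:R * tau).
      by apply: h1; move: tT; rewrite !in_itv /= tj => /andP[-> _].
    have tp : j%:R * tau <= (t : R) < j.+1%:R * tau.
      by move: tT; rewrite in_itv /= jt => /andP[_ ->].
    have es : affine false (- (j%:R * tau)) t = t - j%:R * tau by rewrite /affine expr0 mul1r.
    have := h2; rewrite es => h2'.
    have st : 0 <= t - j%:R * tau < tau.
      have /andP[_ lt] := tp; rewrite subr_ge0 jt /= ltrBlDl.
      by move: lt; rewrite -natr1 mulrDl mul1r.
    apply: filterS2 (h2' st) Xj => o e1 e2.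
    by rewrite !(feedbackE tau0 _ _ _ tp) e1 e2.
  exact: res.
split; last exact: (all_ctrl N (leqnn N)).
exact: (uniq N (leqnn N) (all_ctrl N (leqnn N))).
Qed.

Section one_law.
Variables (K : nat -> R -> 'M[R]_(m, n)) (X : R -> Omega -> 'cV[R]_n).
Hypotheses (aK : admissible_law tau N K) (hX : trajectory Pr F w A B sigma tau N x K X).

Let gain k := window_gain tau (K k).
Let lg k : (k < N)%N -> mL2 (gain k). Proof. exact: admissible_mL2. Qed.
Let sg k : supported 0 tau (gain k). Proof. exact: supported_itvf. Qed.
Let T0 j : 0 <= j%:R * tau. Proof. by rewrite mulr_ge0 ?ler0n ?ltW. Qed.
Let Tle j k : (j <= k)%N -> j%:R * tau <= k%:R * tau.
Proof. by move=> jk; rewrite ler_wpM2r ?ler_nat ?ltW. Qed.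

(** Square integrability is not part of the state equation. It holds because the
    trajectory coincides, at each time almost surely, with the one constructed
    in regular_exists. *)
Lemma trajectory_moments :
  [/\ {ae Pr, forall o, X 0 o = x},
      forall j, (j <= N)%N -> L2v Pr (X (j%:R * tau)) &
      forall j W, (j < N)%N -> EQ Pr W (X (j.+1%:R * tau)) =
        EQ Pr (second_moment_map A B sigma tau (gain j) W) (X (j%:R * tau))].
Proof.
have [Y gY] := regular_exists hw A B sigma x tau0 lg.
have hY := regular_solution gY.
have [e _] : (forall t, 0 <= t <= N%:R * tau -> {ae Pr, forall o, Y t o = X t o}) /\
    same_control Pr tau N (feedback tau K Y) (feedback tau K X).
  by apply: trajectory_compare => // k kN; apply: filterE => s _; apply: filterE.
have Tj j : (j <= N)%N -> 0 <= j%:R * tau <= N%:R * tau by move=> jN; rewrite T0 Tle.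
have lX j : (j <= N)%N -> L2v Pr (X (j%:R * tau)).
  move=> jN; apply: (L2v_ae _ (e _ (Tj j jN))); last exact: (regular_L2 gY).
  by move=> i; apply: (wrt_measurable hw (T0 j)); apply: (state_adapted hX); exact: Tj.
split => //.
  have e0 : {ae Pr, forall o, Y 0 o = X 0 o} by apply: e; rewrite lexx T0.
  by apply: filterS e0 => o <-; exact: (regular_init gY).
move=> j W jN; have jN' := ltnW jN.
rewrite -(EQ_ae W _ (lX _ jN) (e _ (Tj _ jN))); last exact: (regular_L2 gY).
rewrite (regular_moment gY)//; apply: EQ_ae; [exact: (regular_L2 gY)|exact: lX|exact: e (Tj _ jN')].
Qed.

Variable Ru : 'M[R]_m.
Let cost_rate k := mint (fun s => (gain k s)^T *m Ru *m gain k s).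

(** The control is linear in the state at the start of its period, so its cost
    over the period is a deterministic form of that state. *)
Lemma control_cost o :
  (\int[mu]_(t in `[0%R, (N%:R * tau)%R[) (quadmx Ru (feedback tau K X t o))%:E)%E =
  (\sum_(k < N) quadmx (cost_rate k) (X (k%:R * tau) o))%:E.
Proof.
pose term (k : nat) (s : time) := quadmx ((gain k s)^T *m Ru *m gain k s) (X (k%:R * tau) o).
pose sh (k : nat) : time -> time := affine false (- (k%:R * tau)).
have lterm k : (k < N)%N -> L1 mu (term k) /\
    quadmx (cost_rate k) (X (k%:R * tau) o) = \int[mu]_s term k s.
  move=> kN; apply: quadmx_mint.
  have l := mL1M (mL2_tr (lg kN)) (mL2_mull Ru (lg kN)).
  by apply: eq_mL1 l => s; rewrite mulmxA.
have lsh (k : 'I_N) : L1 mu (fun t => term k (sh k t)).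
  by apply: (@L1_affine _ false (- (k%:R * tau)) (term k)); have [] := lterm k (ltn_ord k).
transitivity (\int[mu]_t (\sum_(k < N) term k (sh k t))%:E)%E; last first.
  rewrite fin_L1; last by apply: L1_sum.
  rewrite int_sum//; congr EFin; apply: eq_bigr => k _.
  have [l ->] := lterm k (ltn_ord k).
  exact: (int_affine false (- (k%:R * tau)) (L1_meas l)).
rewrite [LHS]integral_mkcond; apply: eq_integral => t _.
have termE k : term k (sh k t) =
    itvf (k%:R * tau) (k.+1%:R * tau) t * quadmx Ru (K k ((t : R) - k%:R * tau) *m X (k%:R * tau) o).
  rewrite /term quadmx_conj /gain /window_gain itvf_affine.
  have -> : sh k t = (t : R) - k%:R * tau by rewrite /sh /affine expr0 mul1r.
  have -> : k%:R * tau + tau = k.+1%:R * tau by rewrite -[in RHS]natr1 mulrDl mul1r.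
  rewrite itvfE; case: (_ && _); first by rewrite scale1r mul1r.
  by rewrite scale0r mul0mx mul0r /quadmx mulmx0 mxE.
rewrite patchE mem_setE in_itv /=; case: ifPn => [/andP[t0 tN]|h].
  have [j hj] := period_of tau0 t0; have /andP[jt tj] := hj.
  have jN : (j < N)%N by have := le_lt_trans jt tN; rewrite ltr_pM2r// ltr_nat.
  rewrite (bigD1 (Ordinal jN))//= big1 ?addr0 => [|k kj].
    by rewrite termE itvfE hj mul1r (feedbackE tau0 _ _ _ hj).
  rewrite termE itvfE; case: (boolP (_ && _)) => [/andP[kt tk]|]; last by rewrite mul0r.
  have h1 : (k < j.+1)%N by have := le_lt_trans kt tj; rewrite ltr_pM2r// ltr_nat.
  have h2 : (j < k.+1)%N by have := le_lt_trans jt tk; rewrite ltr_pM2r// ltr_nat.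
  by move: kj; rewrite -val_eqE /= eqn_leq -ltnS h1 -ltnS h2.
rewrite big1// => k _; rewrite termE itvfE; case: (boolP (_ && _)) => [/andP[kt tk]|]; last by rewrite mul0r.
by case/negP: h; rewrite (le_trans (T0 k) kt) (lt_le_trans tk)//; exact: Tle.
Qed.

Lemma cost_moments (L P : 'M[R]_n) : cost Pr tau N L P Ru K X =
  (\sum_(k < N) (tau * EQ Pr L (X (k%:R * tau)) + EQ Pr (cost_rate k) (X (k%:R * tau)))
   + EQ Pr P (X (N%:R * tau)))%:E.
Proof.
have [_ lX _] := trajectory_moments.
have l W k : (k <= N)%N -> L1 Pr (fun o => quadmx W (X (k%:R * tau) o)).
  by move=> kN; have [] := EQE W (lX k kN).
have lk W (k : 'I_N) : L1 Pr (fun o => quadmx W (X (k%:R * tau) o)) by exact: l (ltnW (ltn_ord k)).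
have l1 : L1 Pr (fun o => tau * \sum_(k < N) quadmx L (X (k%:R * tau) o)).
  by apply: L1Z; apply: L1_sum.
have l2 : L1 Pr (fun o => \sum_(k < N) quadmx (cost_rate k) (X (k%:R * tau) o)) by apply: L1_sum.
have l12 := L1D l1 l2; have l3 := l P N (leqnn N).
transitivity (\int[Pr]_o (tau * \sum_(k < N) quadmx L (X (k%:R * tau) o)
   + \sum_(k < N) quadmx (cost_rate k) (X (k%:R * tau) o) + quadmx P (X (N%:R * tau) o))%:E)%E.
  by apply: eq_integral => o _; rewrite control_cost !EFinD.
rewrite fin_L1; last exact: L1D.
rewrite intD// intD// intZl; last by apply: L1_sum.
rewrite !int_sum//; congr (_ + _)%:E; rewrite mulr_sumr -big_split.
by [].
Qed.

End one_law.
End Comparison.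

(** * Optimality *)

Lemma excess_best {R : realType} {n m : nat} (A : 'M[R]_n) (B : 'M[R]_(n, m)) sigma tau Ru W :
  excess A B sigma tau Ru W (best_gain A B sigma tau Ru W) = 0.
Proof.
have z p q (G : measurableTypeR R -> 'M[R]_(p, q)) : (forall s, G s = 0) -> mint G = 0.
  move=> G0; apply/matrixP => i j; rewrite !mxE (@eq_int _ _ _ _ _ (fun=> 0)) => [|s].
    by rewrite Rintegral_cst// mul0r.
  by rewrite G0 mxE.
rewrite /excess !z ?trmx0 ?mul0mx ?add0r//= => s; rewrite subrr ?mulmx0//.
Qed.

Section Optimality.
Context {d : measure_display} {Omega : measurableType d} {R : realType}.
Variable Pr : probability Omega R.
Variable F : R -> set (set Omega).
Variable w : R -> Omega -> R.
Hypothesis hw : wiener_process Pr F w.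
Notation mu := (@lebesgue_measure R).
Notation time := (measurableTypeR R).
Context {n m : nat}.
Variables (A : 'M[R]_n) (B : 'M[R]_(n, m)) (sigma tau : R) (N : nat).
Variables (L P : 'M[R]_n) (Ru : 'M[R]_m) (x : 'cV[R]_n).
Hypotheses (tau0 : 0 < tau) (hL : posdefmx L) (hP : posdefmx P) (hRu : posdefmx Ru).

Let W k := riccati A B sigma tau L Ru P N k.
Let Kopt := optimal_gain A B sigma tau L Ru P N.
Let best k := best_gain A B sigma tau Ru (W k.+1).

Let WN : W N = P. Proof. by rewrite /W /riccati subnn. Qed.

Let WS k : (k < N)%N -> W k = riccati_map A B sigma tau L Ru (W k.+1).
Proof. by move=> kN; rewrite /W /riccati -(subnSK kN). Qed.

Let pW k : psdmx (W k).
Proof.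
rewrite /W /riccati; elim: (N - k)%N => [|j ih] /=; first exact: posdefmx_psd.
exact: psdmx_riccati_map.
Qed.

(** The optimal gain of period k is the best gain for the weight W_(k+1), since
    W_k - tau L is the corresponding part of the Riccati map. *)
Lemma window_optimal k : (k < N)%N -> forall s, window_gain tau (Kopt k) s = best k s.
Proof.
move=> kN s; rewrite /best (best_gainE _ _ _ _ L) -?WS//.
Qed.

Lemma admissible_optimal : admissible_law tau N Kopt.
Proof.
move=> k kN; apply: mL2_admissible => //.
apply: (@eq_mL2 _ _ _ (best k)); first by move=> s; rewrite window_optimal.
exact: mL2_best_gain.
Qed.

Let exc K k := excess A B sigma tau Ru (W k.+1) (window_gain tau (K k)).

Lemma psdmx_law_excess K k : admissible_law tau N K -> (k < N)%N ->
  psdmx (exc K k).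
Proof.
move=> aK kN; apply: psdmx_excess => //; first exact: admissible_mL2 aK kN.
exact: supported_itvf.
Qed.

(** By complete_square, the cost of period k plus the mean of the form of
    W_(k+1) at its end is the mean of the form of W_k at its start plus that of
    the excess; these equalities telescope from P = W_N to W_0. *)
Lemma cost_excess K X : admissible_law tau N K ->
  trajectory Pr F w A B sigma tau N x K X ->
  cost Pr tau N L P Ru K X =
    (quadmx (W 0) x + \sum_(k < N) EQ Pr (exc K k) (X (k%:R * tau)))%:E.
Proof.
move=> aK hX; have [X0 lX mom] := trajectory_moments hw tau0 aK hX.
rewrite (cost_moments hw tau0 aK hX); congr EFin.
pose rate k := mint (fun s : time =>
  (window_gain tau (K k) s)^T *m Ru *m window_gain tau (K k) s).
have step k : (k < N)%N ->
  tau * EQ Pr L (X (k%:R * tau)) + EQ Pr (rate k) (X (k%:R * tau))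
  + EQ Pr (W k.+1) (X (k.+1%:R * tau)) =
  EQ Pr (W k) (X (k%:R * tau)) + EQ Pr (exc K k) (X (k%:R * tau)).
  move=> kN; have lk := lX k (ltnW kN); rewrite (mom k _ kN) -(EQZ tau L lk).
  rewrite -(EQD (tau *: L) (rate k) lk) -(EQD (W k) (exc K k) lk).
  rewrite -(EQD _ (second_moment_map A B sigma tau (window_gain tau (K k)) (W k.+1)) lk).
  suff -> : tau *: L + rate k + second_moment_map A B sigma tau (window_gain tau (K k)) (W k.+1)
    = W k + exc K k by [].
  have e : second_moment_map A B sigma tau (window_gain tau (K k)) (W k.+1) + rate k
      = W k - tau *: L + exc K k.
    have sg : supported 0 tau (window_gain tau (K k)) by exact: supported_itvf.
    have c := complete_square A B sigma L tau0 hRu (pW k.+1) (admissible_mL2 aK kN) sg.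
    rewrite (WS kN) -c /period_value /second_moment_map -addrA.
    by rewrite /rate addrA.
  by rewrite -addrA [rate k + _]addrC e addrA [tau *: L + _]addrC subrK.
have tel j : (j <= N)%N ->
  \sum_(k < j) (tau * EQ Pr L (X (k%:R * tau)) + EQ Pr (rate k) (X (k%:R * tau)))
  + EQ Pr (W j) (X (j%:R * tau)) =
  EQ Pr (W 0) (X (0%:R * tau)) + \sum_(k < j) EQ Pr (exc K k) (X (k%:R * tau)).
  elim: j => [|j ih] jN; first by rewrite !big_ord0 add0r addr0.
  rewrite !big_ord_recr /= -addrA (step j jN) addrA ih ?(ltnW jN)//; ring.
rewrite -WN (tel N (leqnn N)) mul0r; congr (_ + _).
have lx : L2v Pr (fun=> x) by move=> i; exact: L2_cst.
have l0 : L2v Pr (X 0) by have := lX 0%N (leq0n N); rewrite mul0r.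
rewrite (EQ_ae _ l0 lx X0) /EQ Rintegral_cst//.
have -> : fine (Pr setT) = 1 by rewrite probability_setT.
by rewrite mulr1.
Qed.

Lemma cost_optimal X : trajectory Pr F w A B sigma tau N x Kopt X ->
  cost Pr tau N L P Ru Kopt X = (quadmx (W 0) x)%:E.
Proof.
move=> hX; rewrite (cost_excess admissible_optimal hX) big1 ?addr0// => k _.
have -> : exc Kopt k = 0.
  rewrite /exc (_ : window_gain tau (Kopt k) = best k); first exact: excess_best.
  by apply/funext => s; exact: window_optimal.
by rewrite /EQ (@eq_int _ _ _ _ _ (fun=> 0)) => [|o]; rewrite ?Rintegral_cst ?mul0r// /quadmx mulmx0 mul0mx mxE.
Qed.

(** The excess form, being nonnegative with zero mean, vanishes almost surely;
    excess_eq0 then gives equality for almost every time on almost every path,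
    and the quantifiers are exchanged by joint measurability. *)
Lemma excess0_gain K X k : admissible_law tau N K -> (k < N)%N ->
  L2v Pr (X (k%:R * tau)) -> EQ Pr (exc K k) (X (k%:R * tau)) = 0 ->
  {ae mu, forall s : time, (0 <= (s : R) < tau) ->
     {ae Pr, forall o, K k s *m X (k%:R * tau) o = Kopt k s *m X (k%:R * tau) o}}.
Proof.
move=> aK kN lX e0; have pe := psdmx_law_excess aK kN; have lg := admissible_mL2 aK kN.
have sg := @supported_itvf _ _ _ 0 tau (K k).
have lb : mL2 (best k) by exact: mL2_best_gain.
have q0 := int0_ae (EQE (exc K k) lX).1 (fun o => pe.2 _) e0.
pose D s := window_gain tau (K k) s - best k s.
pose h (p : Omega * time) : R := \sum_i (D p.2 *m X (k%:R * tau) p.1) i 0 ^+ 2.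
have mh : measurable_fun [set: (Omega * time)%type] h.
  apply: measurable_sum => i; apply: measurable_funX.
  rewrite (_ : (fun p => _) = (fun p : Omega * time =>
     \sum_j D p.2 i j * X (k%:R * tau) p.1 j 0)); last by apply/funext => p; rewrite mxE.
  apply: measurable_sum => j; apply: measurable_funM.
    have lD : L2 mu (fun s => D s i j) by apply: mL2D => //; exact: mL2N.
    exact: (measurable_time (L2_meas lD)).
  exact: (measurableT_comp (L2_meas (lX j)) (@measurable_fst _ _ Omega time)).
have hz (v : 'cV[R]_n) s : D s *m v = 0 -> \sum_i (D s *m v) i 0 ^+ 2 = 0.
  by move=> ->; rewrite big1// => i _; rewrite mxE expr0n.
have zh (v : 'cV[R]_n) s : \sum_i (D s *m v) i 0 ^+ 2 = 0 -> D s *m v = 0.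
  move=> /eqP; rewrite psumr_eq0 => [/allP z|i _]; last exact: sqr_ge0.
  apply/colP => i; rewrite [RHS]mxE; apply/eqP; rewrite -sqrf_eq0.
  by have := z i; rewrite mem_index_enum => /(_ isT).
have a1 : {ae Pr, forall o, {ae mu, forall s, h (o, s) = 0}}.
  apply: filterS q0 => o qo.
  have := excess_eq0 (A := A) (B := B) (sigma := sigma) (tau := tau) hRu (pW k.+1) lg sg qo.
  by apply: filterS => s es; apply: hz; rewrite /D mulmxBl es subrr.
have /(ae_prod2 Pr mu mh) a2 := (ae_prod1 Pr mu mh).1 a1.
apply: filterS a2 => s hs s01; apply: filterS hs => o /zh.
have i1 : itvf 0 tau s = 1 by rewrite itvfE s01.
rewrite /D -window_optimal// /window_gain i1 !scale1r mulmxBl => /eqP.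
by rewrite subr_eq0 => /eqP.
Qed.

End Optimality.

Theorem theorem3 (R : realType) (d : measure_display) (Omega : measurableType d)
    (Pr : probability Omega R) (F : R -> set (set Omega)) (w : R -> Omega -> R)
    (hw : wiener_process Pr F w)
    (n m : nat) (A : 'M[R]_n) (B : 'M[R]_(n, m)) (sigma tau : R) (N : nat)
    (L P : 'M[R]_n) (Ru : 'M[R]_m)
    (htau : 0 < tau) (hL : posdefmx L) (hP : posdefmx P) (hRu : posdefmx Ru)
    (x : 'cV[R]_n) :
  let Kopt := optimal_gain A B sigma tau L Ru P N in
  let traj := trajectory Pr F w A B sigma tau N x in
  let J := cost Pr tau N L P Ru in
  [/\ (* every law in U_N drives the state equation from x *)
      forall K, admissible_law tau N K -> exists X, traj K X,
      admissible_law tau N Kopt,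
      forall X, traj Kopt X ->
        J Kopt X = (quadmx (riccati A B sigma tau L Ru P N 0) x)%:E
    & forall Xopt K X, traj Kopt Xopt -> admissible_law tau N K -> traj K X ->
        (J Kopt Xopt <= J K X)%E /\
        (J K X = J Kopt Xopt ->
         same_control Pr tau N (feedback tau K X) (feedback tau Kopt Xopt))].
Proof.
move=> Kopt traj J.
have psd_exc K k : admissible_law tau N K -> (k < N)%N ->
    psdmx (excess A B sigma tau Ru (riccati A B sigma tau L Ru P N k.+1)
      (window_gain tau (K k))).
  by move=> aK kN; exact: psdmx_law_excess aK kN.
split.
- move=> K aK; have [X gX] := regular_exists hw A B sigma x htau (fun k => admissible_mL2 aK).
  by exists X; exact: regular_solution gX.
- exact: admissible_optimal.
- by move=> X hX; exact: (cost_optimal hw htau hL hP hRu hX).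
move=> Xopt K X hXopt aK hX; rewrite /J (cost_optimal hw htau hL hP hRu hXopt).
rewrite (cost_excess hw htau hL hP hRu aK hX).
have e0 (k : 'I_N) : 0 <= EQ Pr (excess A B sigma tau Ru
    (riccati A B sigma tau L Ru P N k.+1) (window_gain tau (K k))) (X (k%:R * tau)).
  by apply: EQ_ge0; exact: psd_exc.
split; first by rewrite lee_fin lerDl sumr_ge0.
move=> [] /(canRL (addKr _)); rewrite addNr => /eqP.
rewrite psumr_eq0// => /allP z.
have [_ lX _] := trajectory_moments hw htau aK hX.
have [|_ //] := trajectory_compare hw htau hX hXopt.
move=> k kN; apply: (@excess0_gain _ _ _ Pr _ _ A B sigma tau N L P Ru htau hL hP hRu K X k aK kN).
  exact: lX (ltnW kN).
by have := z (Ordinal kN); rewrite mem_index_enum => /(_ isT) /eqP.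
Qed.
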